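(* Let $\ell$ be a positive integer and let $x>\ell/2$ be real. Let $\rho_1(t)=\frac{\pi}{2}\operatorname{sech}^2(\pi t)$ and let $\rho_\ell$ be its $\ell$-fold convolution, i.e. $\rho_\ell(t)=\int_{-\infty}^{\infty}\rho_{\ell-1}(u)\rho_1(t-u)\,du$ for $\ell\ge2$. Then, with $b=(x-\ell/2)^{-2}$, $$\int_0^\infty \log(1+bu^2)\,\rho_\ell(u)\,du = -\log\left|x-\frac{\ell}{2}\right| - H_{\ell-1} + \frac{d^{\ell-1}}{dx^{\ell-1}}\left\{\binom{x-1}{\ell-1}\psi\!\left(x-\left\lfloor\tfrac{\ell}{2}\right\rfloor\right)\right\}.$$
   Context: $H_n$ is the $n$-th harmonic number ($H_0=0$), $\psi=\Gamma'/\Gamma$ is the digamma function, and $\binom{x}{n}=\frac{x(x-1)\cdots(x-n+1)}{n!}$ is the generalized binomial coefficient. *)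

(* Defs.v *)
From Stdlib Require Import Reals.
From Coquelicot Require Import Coquelicot.
Open Scope R_scope.

Fixpoint harmonic (n : nat) : R :=
  match n with
  | O => 0
  | S m => harmonic m + / INR (S m)
  end.

Fixpoint falling (x : R) (n : nat) : R :=
  match n with
  | O => 1
  | S m => falling x m * (x - INR m)
  end.
Definition gbinom (x : R) (n : nat) : R := falling x n / INR (Factorial.fact n).

Definition Gamma (x : R) : R :=
  RInt_gen (fun t => Rpower t (x - 1) * exp (- t))
           (at_right 0) (Rbar_locally p_infty).

Definition digamma (x : R) : R := Derive Gamma x / Gamma x.

Definition rho1 (t : R) : R := (PI / 2) / (cosh (PI * t)) ^ 2.

(* rhoS n = rho_{n+1}: the (n+1)-fold convolution of rho_1. *)
Fixpoint rhoS (n : nat) (t : R) : R :=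
  match n with
  | O => rho1 t
  | S m => RInt_gen (fun u => rhoS m u * rho1 (t - u))
                    (Rbar_locally m_infty) (Rbar_locally p_infty)
  end.

Definition rho (l : nat) : R -> R := rhoS (l - 1).

(* Main.v *)
Require Import Defs.
From Stdlib Require Import Reals Lra Lia Psatz Factorial.
From Coquelicot Require Import Coquelicot.
Open Scope R_scope.

(* Put w = x - l/2 and F_l(w) = E (log |w + i U|) with U of density rho_l, so that the left-hand side is F_l(w) - log w. Shifting the line of integration of coth (pi z) / (w + i z) up to its pole at z = i/2 gives, for w > 1/2 and every real a,
     int rho_1(u) (log |w + 1/2 + i (a + u)| - log |w - 1/2 + i (a + u)|) du = Re (1 / (w + i a)),
   and averaging over a with density rho_{l-1} turns this into the difference equation F_l(w + 1/2) - F_l(w - 1/2) = F_{l-1}'(w), with 1/w on the right when l = 1.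
   The right-hand side of the theorem, plus log w, satisfies the same equation, by Pascal's rule and digamma (z + 1) = digamma z + 1/z: the pole of 1/z is cancelled by a factor of the binomial coefficient, and what remains is a polynomial of degree l - 2, killed by the derivative of order l - 1.
   Both functions are log w + o(1) at infinity, and a 1-periodic function tending to 0 vanishes, so they agree by induction on l. For l = 1 this says F_1(w) = digamma (w + 1/2), which also yields the smoothness of digamma and the asymptotics of all its derivatives. *)

(** * Integrals over the real line dominated by the Cauchy density *)

(** The contour is moved with real integrals only. The height [e] of the line becomes a parameter;
    the Cauchy-Riemann equations turn the [e]-derivative of the integrand into an exact
    [u]-derivative, so that a shift costs only endpoint values of size O(1/A). The real family used
    pairs a fraction at w + e with one at w - e: at e = 1/2 the cotangent is tanh, twice an
    antiderivative of rho_1, and as e tends to 0 both fractions merge at w while the imaginary part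
    of the cotangent concentrates into a point mass. All functions on the line are measured against
    the Cauchy density: its tails are explicit, it is stable under translation, and products of two
    such bounds justify Fubini. Limits thus become O(1/A) estimates. The identity F_1(w) = digamma
    (w + 1/2) with w > 0 misses the arguments in (0, 1/2], which even l requires; digamma z is
    therefore represented as F_1(z + 1/2) - 1/z. The harmonic number is the constant in the
    derivative of order m of y^m log y, which is m! (log y + H_m). *)

Definition dominated (f : R -> R) (C : R) : Prop :=
  (forall x, continuous f x) /\ (forall x, Rabs (f x) <= C * / (1 + x ^ 2)).

Definition intR (f : R -> R) : R :=
  RInt_gen f (Rbar_locally m_infty) (Rbar_locally p_infty).

Lemma one_plus_sq_pos (x : R) : 0 < 1 + x ^ 2.
Proof. nra. Qed.

Lemma dominated_nonneg f C : dominated f C -> 0 <= C.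
Proof.
  intros [_ H]. specialize (H 0). pose proof (Rabs_pos (f 0)).
  replace (C * / (1 + 0 ^ 2)) with C in H by field. lra.
Qed.

Lemma continuous_ex_RInt (f : R -> R) a b :
  (forall x, continuous f x) -> ex_RInt f a b.
Proof. intros H. apply (ex_RInt_continuous (V := R_CompleteNormedModule)). auto. Qed.

Lemma is_RInt_cauchy a b : is_RInt (fun x => / (1 + x ^ 2)) a b (atan b - atan a).
Proof.
  apply (is_RInt_derive (V := R_CompleteNormedModule) atan).
  - intros x _. apply is_derive_Reals, Ratan.derivable_pt_lim_atan.
  - intros x _. apply (ex_derive_continuous (fun x => / (1 + x ^ 2))).
    auto_derive. pose proof (one_plus_sq_pos x). simpl in *. lra.
Qed.

Lemma dominated_RInt_le f C a b : dominated f C -> a <= b ->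
  Rabs (RInt f a b) <= C * (atan b - atan a).
Proof.
  intros [Hc Hb] Hab.
  apply (norm_RInt_le (V := R_NormedModule) f (fun x => C * / (1 + x ^ 2)) a b); auto.
  - apply (RInt_correct (V := R_CompleteNormedModule)), continuous_ex_RInt, Hc.
  - apply (is_RInt_scal (V := R_NormedModule)), is_RInt_cauchy.
Qed.

(** The left-hand side is atan (1/A). This is the source of all the explicit 1/A tails below. *)
Lemma atan_tail A : 0 < A -> PI / 2 - atan A <= / A.
Proof.
  intros HA. rewrite <- atan_inv by auto.
  pose proof (Rinv_0_lt_compat A HA).
  destruct (MVT_gen atan 0 (/ A) (fun x => / (1 + x ^ 2))) as [c [_ Hc]].
  - intros x _. apply is_derive_Reals, Ratan.derivable_pt_lim_atan.
  - intros x _. apply derivable_continuous_pt, derivable_pt_atan.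
  - rewrite atan_0 in Hc.
    assert (/ (1 + c ^ 2) <= 1).
    { rewrite <- Rinv_1. apply Rinv_le_contravar; nra. }
    nra.
Qed.

Lemma dominated_tail_right f C A a b : dominated f C -> 0 < A -> A <= a -> a <= b ->
  Rabs (RInt f a b) <= C / A.
Proof.
  intros Hd HA Ha Hab. pose proof (dominated_nonneg _ _ Hd).
  eapply Rle_trans. apply dominated_RInt_le; eauto.
  apply Rmult_le_compat_l; auto.
  pose proof (atan_tail A HA). pose proof (atan_bound b).
  assert (atan A <= atan a).
  { destruct (Req_dec A a). subst; lra. left; apply atan_increasing; lra. }
  lra.
Qed.

Lemma dominated_tail_left f C A a b : dominated f C -> 0 < A -> a <= b -> b <= - A ->
  Rabs (RInt f a b) <= C / A.
Proof.
  intros Hd HA Ha Hab. pose proof (dominated_nonneg _ _ Hd).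
  eapply Rle_trans. apply dominated_RInt_le; eauto.
  apply Rmult_le_compat_l; auto.
  pose proof (atan_tail A HA). pose proof (atan_bound a).
  assert (atan b <= atan (- A)).
  { destruct (Req_dec b (- A)). subst; lra. left; apply atan_increasing; lra. }
  rewrite atan_opp in *. lra.
Qed.

(** The two endpoints move independently, as the definition of the two-sided improper integral
    demands; afterwards symmetric windows suffice. *)
Lemma dominated_RInt_window f C A a b : dominated f C -> 0 < A -> a <= - A -> A <= b ->
  Rabs (RInt f a b - RInt f (- A) A) <= 2 * C / A.
Proof.
  intros Hd HA Ha Hb.
  assert (Hex : forall p q, ex_RInt f p q) by (intros; apply continuous_ex_RInt, Hd).
  rewrite <- (RInt_Chasles (V := R_CompleteNormedModule) f a (- A) b) by auto.
  rewrite <- (RInt_Chasles (V := R_CompleteNormedModule) f (- A) A b) by auto.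
  unfold plus; simpl.
  pose proof (dominated_tail_left f C A a (- A) Hd HA Ha (Rle_refl _)).
  pose proof (dominated_tail_right f C A A b Hd HA (Rle_refl _) Hb).
  replace (2 * C / A) with (C / A + C / A) by (field; lra).
  revert H H0. unfold Rabs; repeat destruct Rcase_abs; lra.
Qed.

Lemma filter_window A :
  filter_prod (Rbar_locally m_infty) (Rbar_locally p_infty)
    (fun ab : R * R => fst ab <= - A /\ A <= snd ab).
Proof.
  exists (fun a => a < - A) (fun b => A < b).
  - exists (- A). auto.
  - exists A. auto.
  - simpl. intros; lra.
Qed.

Lemma ex_radius (K eps : R) : 0 < eps -> exists A, 0 < A /\ K / A < eps.
Proof.
  (* The absolute value and the + 1 keep the radius positive whatever the sign of [K]. *)
  intros He. exists ((Rabs K + 1) / eps).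
  pose proof (Rabs_pos K).
  assert (0 < (Rabs K + 1) / eps) by (apply Rdiv_lt_0_compat; lra).
  split; auto.
  apply Rle_lt_trans with (Rabs K / ((Rabs K + 1) / eps)).
  - apply Rmult_le_compat_r. left; apply Rinv_0_lt_compat; auto. apply Rle_abs.
  - replace (Rabs K / ((Rabs K + 1) / eps)) with (eps * (Rabs K / (Rabs K + 1)))
      by (field; lra).
    rewrite <- (Rmult_1_r eps) at 2. apply Rmult_lt_compat_l; auto.
    apply Rlt_div_l; lra.
Qed.

Lemma dominated_is_RInt_gen f C : dominated f C ->
  is_RInt_gen f (Rbar_locally m_infty) (Rbar_locally p_infty) (intR f).
Proof.
  intros Hd. apply (RInt_gen_correct (V := R_CompleteNormedModule)).
  assert (Hex : forall p q, ex_RInt f p q) by (intros; apply continuous_ex_RInt, Hd).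
  destruct (proj1 (filterlim_locally_cauchy (U := R_CompleteSpace)
    (F := filter_prod (Rbar_locally m_infty) (Rbar_locally p_infty))
    (fun ab : R * R => RInt f (fst ab) (snd ab)))) as [l Hl].
  (* Two windows are each compared with the central one, which doubles the error 2 * C / A. *)
  - intros eps. destruct (ex_radius (2 * (2 * C)) eps (cond_pos eps)) as [A [HA HK]].
    exists (fun ab : R * R => fst ab <= - A /\ A <= snd ab). split.
    apply filter_window.
    intros u v [Hu1 Hu2] [Hv1 Hv2].
    pose proof (dominated_RInt_window f C A _ _ Hd HA Hu1 Hu2).
    pose proof (dominated_RInt_window f C A _ _ Hd HA Hv1 Hv2).
    unfold ball; simpl. unfold AbsRing_ball, abs, minus, plus, opp; simpl.
    replace (2 * (2 * C) / A) with (2 * C / A + 2 * C / A) in HK by (field; lra).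
    revert H H0. unfold Rabs; repeat destruct Rcase_abs; lra.
  - exists l. intros P HP. specialize (Hl P HP). unfold filtermap in Hl.
    unfold filtermapi. eapply filter_imp. 2: apply Hl.
    intros [a b] Hab. exists (RInt f a b). split; auto.
    apply (RInt_correct (V := R_CompleteNormedModule)), Hex.
Qed.

Lemma is_RInt_gen_filterlim (f : R -> R) Fa Fb (l : R) {FFa : Filter Fa} {FFb : Filter Fb} :
  (forall a b, ex_RInt f a b) ->
  is_RInt_gen f Fa Fb l ->
  filterlim (fun ab : R * R => RInt f (fst ab) (snd ab)) (filter_prod Fa Fb) (locally l).
Proof.
  intros Hex H P HP. specialize (H P HP).
  unfold filtermapi in H. unfold filtermap.
  eapply filter_imp. 2: apply H. intros [a b] [y [Hy HPy]]. simpl in *.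
  rewrite (is_RInt_unique (V := R_CompleteNormedModule) _ _ _ _ Hy). auto.
Qed.

Lemma intR_approx f C A : dominated f C -> 0 < A ->
  Rabs (intR f - RInt f (- A) A) <= 2 * C / A.
Proof.
  intros Hd HA. pose proof (dominated_is_RInt_gen f C Hd) as H.
  apply is_RInt_gen_filterlim in H; try (intros; apply continuous_ex_RInt, Hd); try apply Rbar_locally_filter.
  destruct (Rle_or_lt (Rabs (intR f - RInt f (- A) A)) (2 * C / A)) as [|Hlt]; auto.
  exfalso.
  set (d := Rabs (intR f - RInt f (- A) A) - 2 * C / A) in *.
  assert (Hd0 : 0 < d) by (unfold d; lra).
  specialize (H (ball (intR f) d) (locally_ball (intR f) (mkposreal d Hd0))).
  unfold filtermap in H.
  destruct (filter_ex _ (filter_and _ _ H (filter_window A))) as [[a b] [H1 [H2 H3]]].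
  simpl in *.
  pose proof (dominated_RInt_window f C A _ _ Hd HA H2 H3).
  unfold ball in H1; simpl in H1. unfold AbsRing_ball, abs, minus, plus, opp in H1; simpl in H1.
  unfold d in H1.
  revert H1 H0. unfold Rabs; repeat destruct Rcase_abs; lra.
Qed.

Lemma intR_is_lim f C : dominated f C ->
  is_lim (fun A => RInt f (- A) A) p_infty (intR f).
Proof.
  intros Hd. apply is_lim_spec. intros eps.
  destruct (ex_radius (2 * C) eps (cond_pos eps)) as [A [HA HK]].
  exists A. intros B HB.
  pose proof (intR_approx f C B Hd ltac:(lra)).
  pose proof (dominated_nonneg _ _ Hd).
  assert (2 * C / B <= 2 * C / A).
  { apply Rmult_le_compat_l. lra. apply Rinv_le_contravar; lra. }
  rewrite Rabs_minus_sym. lra.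
Qed.

(** The working tool for evaluating [intR]: for a dominated function a limit over symmetric windows
    is enough. *)
Lemma intR_unique f C l : dominated f C ->
  is_lim (fun A => RInt f (- A) A) p_infty (Finite l) -> intR f = l.
Proof.
  intros Hd Hl. pose proof (intR_is_lim f C Hd) as H.
  apply is_lim_unique in H. apply is_lim_unique in Hl. rewrite Hl in H. congruence.
Qed.

Lemma dominated_ext f g C : (forall x, f x = g x) -> dominated f C -> dominated g C.
Proof.
  intros He [Hc Hb]. split.
  - intros x. apply continuous_ext with f; auto.
  - intros x. rewrite <- He. auto.
Qed.

Lemma RInt_ext_all (f g : R -> R) a b : (forall x, f x = g x) -> RInt f a b = RInt g a b.
Proof. intros H. apply RInt_ext. auto. Qed.

Lemma intR_ext f g C : dominated f C -> (forall x, f x = g x) -> intR f = intR g.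
Proof.
  intros Hd He. symmetry. apply intR_unique with C. eapply dominated_ext; eauto.
  eapply is_lim_ext. 2: apply (intR_is_lim f C Hd).
  intros A. simpl. apply RInt_ext_all, He.
Qed.

Lemma dominated_plus f g C D : dominated f C -> dominated g D ->
  dominated (fun x => f x + g x) (C + D).
Proof.
  intros [H1 H2] [H3 H4]. split.
  - intros x. apply (continuous_plus (V := R_NormedModule)); auto.
  - intros x. eapply Rle_trans. apply Rabs_triang. rewrite Rmult_plus_distr_r.
    apply Rplus_le_compat; auto.
Qed.

Lemma dominated_scal f k C : dominated f C -> dominated (fun x => k * f x) (Rabs k * C).
Proof.
  intros [H1 H2]. split.
  - intros x. apply (continuous_scal_r (V := R_NormedModule)); auto.
  - intros x. rewrite Rabs_mult, Rmult_assoc. apply Rmult_le_compat_l; auto. apply Rabs_pos.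
Qed.

Lemma intR_plus f g C D : dominated f C -> dominated g D ->
  intR (fun x => f x + g x) = intR f + intR g.
Proof.
  intros Hf Hg. apply intR_unique with (C + D). apply dominated_plus; auto.
  eapply is_lim_ext.
  2: apply (is_lim_plus' _ _ _ _ _ (intR_is_lim f C Hf) (intR_is_lim g D Hg)).
  intros A. simpl. symmetry.
  apply (RInt_plus (V := R_CompleteNormedModule)); apply continuous_ex_RInt; [apply Hf | apply Hg].
Qed.

Lemma intR_scal f k C : dominated f C -> intR (fun x => k * f x) = k * intR f.
Proof.
  intros Hf. apply intR_unique with (Rabs k * C). apply dominated_scal; auto.
  eapply is_lim_ext.
  2: apply (is_lim_scal_l _ k _ _ (intR_is_lim f C Hf)).
  intros A. simpl. symmetry.
  apply (RInt_scal (V := R_CompleteNormedModule)); apply continuous_ex_RInt, Hf.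
Qed.

Lemma dominated_minus f g C D : dominated f C -> dominated g D ->
  dominated (fun x => f x - g x) (C + D).
Proof.
  intros Hf Hg. apply dominated_ext with (fun x => f x + (-1) * g x). intros; ring.
  apply dominated_plus; auto. replace D with (Rabs (-1) * D). apply dominated_scal; auto.
  rewrite Rabs_left by lra. ring.
Qed.

Lemma intR_minus f g C D : dominated f C -> dominated g D ->
  intR (fun x => f x - g x) = intR f - intR g.
Proof.
  intros Hf Hg. 
  rewrite (intR_ext _ (fun x => f x + (-1) * g x) (C + D)); [| apply dominated_minus; auto | intros; ring].
  erewrite intR_plus; eauto using dominated_scal. erewrite intR_scal; eauto. ring.
Qed.

Lemma dominated_intR_le f C : dominated f C -> Rabs (intR f) <= C * PI.
Proof.
  intros Hd. pose proof (dominated_nonneg _ _ Hd).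
  apply le_epsilon. intros eps He.
  destruct (ex_radius (2 * C) eps He) as [A [HA HK]].
  pose proof (intR_approx f C A Hd HA).
  assert (Rabs (RInt f (- A) A) <= C * PI).
  { eapply Rle_trans. apply dominated_RInt_le; eauto. lra.
    apply Rmult_le_compat_l; auto.
    pose proof (atan_bound A). pose proof (atan_bound (- A)). lra. }
  revert H0 H1. unfold Rabs; repeat destruct Rcase_abs; lra.
Qed.

Lemma intR_le f g C D : dominated f C -> dominated g D -> (forall x, f x <= g x) ->
  intR f <= intR g.
Proof.
  intros Hf Hg H.
  apply (is_lim_le_loc (fun A => RInt f (- A) A) (fun A => RInt g (- A) A) p_infty
    (Finite (intR f)) (Finite (intR g))).
  - exists 0. intros A HA. apply RInt_le; auto. lra.
    apply continuous_ex_RInt, Hf. apply continuous_ex_RInt, Hg.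
  - eapply intR_is_lim; eauto.
  - eapply intR_is_lim; eauto.
Qed.

Lemma RInt_shift (f : R -> R) s a b : (forall x, continuous f x) ->
  RInt (fun x => f (x + s)) a b = RInt f (a + s) (b + s).
Proof.
  intros Hc.
  rewrite <- (RInt_comp (V := R_CompleteNormedModule) f (fun x => x + s) (fun _ => 1) a b).
  - apply RInt_ext. intros x _. unfold scal; simpl; unfold mult; simpl. ring.
  - auto.
  - intros x _. split. auto_derive; auto; ring. apply continuous_const.
Qed.

Lemma RInt_reflect (f : R -> R) a b : (forall x, continuous f x) ->
  RInt (fun x => f (- x)) a b = RInt f (- b) (- a).
Proof.
  intros Hc.
  apply (is_RInt_unique (V := R_CompleteNormedModule)).
  apply is_RInt_ext with (fun x => opp (opp (f (- x)))).
  - intros x _. apply opp_opp.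
  - rewrite <- (opp_RInt_swap (V := R_CompleteNormedModule) f (- a) (- b))
      by (apply continuous_ex_RInt; auto).
    apply (is_RInt_opp (V := R_NormedModule)), (is_RInt_comp_opp (V := R_NormedModule)).
    apply (RInt_correct (V := R_CompleteNormedModule)), continuous_ex_RInt, Hc.
Qed.

Lemma dominated_reflect f C : dominated f C -> dominated (fun x => f (- x)) C.
Proof.
  intros [Hc Hb]. split.
  - intros x. apply (continuous_comp (fun x : R => - x) f).
    apply (continuous_opp (V := R_NormedModule)), continuous_id. auto.
  - intros x. replace (x ^ 2) with ((- x) ^ 2) by ring. auto.
Qed.

Lemma intR_reflect f C : dominated f C -> intR (fun x => f (- x)) = intR f.
Proof.
  intros Hd. apply intR_unique with C. apply dominated_reflect; auto.
  eapply is_lim_ext. 2: apply (intR_is_lim f C Hd). intros A. simpl.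
  rewrite RInt_reflect by apply Hd. rewrite Ropp_involutive. auto.
Qed.

(** Peetre's inequality: right side minus left side is 1 + (x - y)^2 + 2 (x y)^2. It carries the
    weight 1 + x^2 across translations and convolutions. *)
Lemma peetre (x y : R) : 1 + (x + y) ^ 2 <= 2 * (1 + x ^ 2) * (1 + y ^ 2).
Proof. pose proof (pow2_ge_0 (x - y)). pose proof (pow2_ge_0 (x * y)). nra. Qed.

Lemma dominated_shift f C s : dominated f C ->
  dominated (fun x => f (x + s)) (2 * C * (1 + s ^ 2)).
Proof.
  intros Hd. pose proof (dominated_nonneg _ _ Hd). split.
  - intros x. apply continuous_comp. 2: apply Hd.
    apply (continuous_plus (V := R_NormedModule)). apply continuous_id. apply continuous_const.
  - intros x. eapply Rle_trans. apply Hd.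
    pose proof (peetre (x + s) (- s)). replace (x + s + - s) with x in H0 by ring.
    pose proof (one_plus_sq_pos x). pose proof (one_plus_sq_pos (x + s)).
    replace ((- s) ^ 2) with (s ^ 2) in H0 by ring.
    apply Rmult_le_reg_r with ((1 + x ^ 2) * (1 + (x + s) ^ 2)).
    apply Rmult_lt_0_compat; auto.
    replace (C * / (1 + (x + s) ^ 2) * ((1 + x ^ 2) * (1 + (x + s) ^ 2))) with
      (C * (1 + x ^ 2)) by (field; simpl in *; lra).
    replace (2 * C * (1 + s ^ 2) * / (1 + x ^ 2) * ((1 + x ^ 2) * (1 + (x + s) ^ 2))) with
      (C * (2 * (1 + (x + s) ^ 2) * (1 + s ^ 2))) by (field; simpl in *; lra).
    apply Rmult_le_compat_l; auto.
Qed.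

(** A translated window still contains [-A, A] once its half-width exceeds A + |s|, so the window
    estimate applies to it. *)
Lemma intR_shift f C s : dominated f C -> intR (fun x => f (x + s)) = intR f.
Proof.
  intros Hd. apply intR_unique with (2 * C * (1 + s ^ 2)). apply dominated_shift; auto.
  apply is_lim_spec. intros eps. 
  destruct (ex_radius (4 * C) eps (cond_pos eps)) as [A [HA HK]].
  exists (A + Rabs s). intros B HB. pose proof (Rabs_pos s).
  rewrite RInt_shift by apply Hd.
  pose proof (intR_approx f C A Hd HA).
  assert (s <= Rabs s) by apply Rle_abs. 
  assert (- s <= Rabs s) by (rewrite <- Rabs_Ropp; apply Rle_abs).
  pose proof (dominated_RInt_window f C A (- B + s) (B + s) Hd HA ltac:(lra) ltac:(lra)).
  replace (4 * C / A) with (2 * C / A + 2 * C / A) in HK by (field; lra).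
  revert H0 H3. unfold Rabs; repeat destruct Rcase_abs; lra.
Qed.

(** * Interchange of integrals and differentiation under the integral *)

Lemma continuity_2d_pt_continuous_l f s u : continuity_2d_pt f s u ->
  continuous (fun s => f s u) s.
Proof.
  intros H. intros P [e He].
  destruct (H e) as [d Hd]. exists d. intros y Hy. apply He.
  apply (Hd y u). apply Hy. rewrite Rminus_diag, Rabs_R0. apply d.
Qed.

Lemma continuity_2d_pt_continuous_r f s u : continuity_2d_pt f s u ->
  continuous (f s) u.
Proof.
  intros H. intros P [e He].
  destruct (H e) as [d Hd]. exists d. intros y Hy. apply He.
  apply (Hd s y). rewrite Rminus_diag, Rabs_R0. apply d. apply Hy.
Qed.

Lemma continuous_RInt_param (f : R -> R -> R) a b s0 : a <= b ->
  (forall s u, continuity_2d_pt f s u) ->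
  continuous (fun s => RInt (f s) a b) s0.
Proof.
  intros Hab Hc. intros P [e He].
  (* The + 1 covers the degenerate interval a = b. *)
  assert (He' : 0 < e / (b - a + 1)) by (apply Rdiv_lt_0_compat; [apply e | lra]).
  destruct (uniform_continuity_2d_1d' f a b s0 ltac:(auto) (mkposreal _ He')) as [d Hd].
  simpl in Hd. exists d. intros s Hs. apply He. unfold ball; simpl.
  unfold AbsRing_ball, abs, minus, plus, opp; simpl.
  assert (Hex : forall s, ex_RInt (f s) a b).
  { intros s'. apply continuous_ex_RInt. intros u. apply continuity_2d_pt_continuous_r, Hc. }
  assert (Hs' : Rabs (s - s0) < d) by apply Hs.
  pose proof (cond_pos d).
  apply Rle_lt_trans with ((b - a) * (e / (b - a + 1))).
  - apply (norm_RInt_le_const (V := R_NormedModule) (fun u => f s u - f s0 u)); auto.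
    + intros u Hu. left. apply (Hd u s0 u s); auto.
      lra. revert Hs'. unfold Rabs; destruct Rcase_abs; lra.
      rewrite Rminus_diag, Rabs_R0. auto.
    + apply (is_RInt_minus (V := R_NormedModule));
      apply (RInt_correct (V := R_CompleteNormedModule)); auto.
  - replace ((b - a) * (e / (b - a + 1))) with (e * ((b - a) / (b - a + 1))) by (field; lra).
    rewrite <- (Rmult_1_r e) at 2. apply Rmult_lt_compat_l. apply e.
    apply Rlt_div_l; lra.
Qed.

Lemma is_derive_RInt_continuous (f : R -> R) a t : (forall x, continuous f x) ->
  is_derive (fun t => RInt f a t) t (f t).
Proof.
  intros Hc. apply (is_derive_RInt (V := R_NormedModule) f (fun t => RInt f a t) a t).
  - apply filter_forall. intros x. apply (RInt_correct (V := R_CompleteNormedModule)), continuous_ex_RInt, Hc.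
  - apply Hc.
Qed.

Lemma is_derive_RInt_parameter (f df : R -> R -> R) a b x :
  (locally x (fun y => forall t, is_derive (fun y => f y t) y (df y t))) ->
  (locally x (fun y => forall t, continuous (f y) t)) ->
  (forall t, continuity_2d_pt df x t) ->
  is_derive (fun y => RInt (f y) a b) x (RInt (df x) a b).
Proof.
  intros Hd Hc H2.
  replace (RInt (df x) a b) with (RInt (fun t => Derive (fun u => f u t) x) a b).
  - apply (is_derive_RInt_param f a b x).
    + eapply filter_imp. 2: exact Hd. intros y Hy t _. eexists. apply Hy.
    + intros t _. apply continuity_2d_pt_ext_loc with df. 2: apply H2.
      destruct Hd as [d Hd]. exists d. intros u v Hu _.
      symmetry. apply is_derive_unique, Hd, Hu.
    + eapply filter_imp. 2: exact Hc. intros y Hy. apply continuous_ex_RInt, Hy.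
  - apply RInt_ext. intros t _. apply is_derive_unique.
    apply locally_singleton in Hd. apply Hd.
Qed.

(** Fubini on a rectangle: with the upper limit [b] replaced by a variable t, both sides vanish at t
    = a and have the same derivative in t. *)
Lemma RInt_swap (f : R -> R -> R) a b c d : a < b -> c <= d ->
  (forall s u, continuity_2d_pt f s u) ->
  RInt (fun s => RInt (fun u => f s u) c d) a b = RInt (fun u => RInt (fun s => f s u) a b) c d.
Proof.
  intros Hab Hcd Hc.
  assert (Hl : forall u t, continuous (fun s => f s u) t)
    by (intros; apply continuity_2d_pt_continuous_l, Hc).
  assert (Hr : forall s t, continuous (f s) t)
    by (intros; apply continuity_2d_pt_continuous_r, Hc).
  assert (Hswap : forall s u, continuity_2d_pt (fun u s => f s u) u s).
  { intros s u e. destruct (Hc s u e) as [d' Hd']. exists d'. intros; apply Hd'; auto. }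
  pose (h := fun t => RInt (fun s => RInt (f s) c d) a t - RInt (fun u => RInt (fun s => f s u) a t) c d).
  assert (Hh : h a = h b).
  { apply (eq_is_derive (V := R_NormedModule)); auto. intros t _.
    unfold zero; simpl. replace 0 with (RInt (f t) c d - RInt (fun u => f t u) c d) by apply Rminus_diag.
    apply (is_derive_minus (V := R_NormedModule)).
    - apply (is_derive_RInt_continuous (fun s => RInt (f s) c d)).
      intros x. apply continuous_RInt_param; auto.
    - apply (is_derive_RInt_parameter (fun t u => RInt (fun s => f s u) a t) f).
      + apply filter_forall. intros y u. apply (is_derive_RInt_continuous (fun s => f s u)). auto.
      + apply filter_forall. intros y u.
        destruct (Rle_dec a y).
        * apply (continuous_RInt_param (fun u s => f s u)); auto.
        * apply continuous_ext with (fun u => - RInt (fun s => f s u) y a).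
          { intros v. rewrite <- (opp_RInt_swap (V := R_CompleteNormedModule)). unfold opp; simpl; ring.
            apply continuous_ex_RInt; auto. }
          apply (continuous_opp (V := R_NormedModule)).
          apply (continuous_RInt_param (fun u s => f s u)); auto. lra.
      + auto. }
  unfold h in Hh. 
  rewrite (RInt_point (V := R_CompleteNormedModule)) in Hh.
  rewrite (RInt_ext_all (fun u => RInt (fun s => f s u) a a) (fun _ => 0)) in Hh.
  2: { intros u. apply (RInt_point (V := R_CompleteNormedModule)). }
  rewrite (RInt_const (V := R_CompleteNormedModule)) in Hh.
  unfold scal, zero in Hh; simpl in Hh; unfold mult in Hh; simpl in Hh.
  replace (0 - (d - c) * 0) with 0 in Hh by ring.
  apply Rminus_diag_uniq. symmetry. exact Hh.
Qed.

Lemma RInt_minus_le (f g h : R -> R) a b : a <= b ->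
  (forall x, continuous f x) -> (forall x, continuous g x) -> (forall x, continuous h x) ->
  (forall x, a <= x <= b -> Rabs (f x - g x) <= h x) ->
  Rabs (RInt f a b - RInt g a b) <= RInt h a b.
Proof.
  intros Hab Hf Hg Hh H.
  apply (norm_RInt_le (V := R_NormedModule) (fun x => f x - g x) h a b); auto.
  - apply (is_RInt_minus (V := R_NormedModule));
    apply (RInt_correct (V := R_CompleteNormedModule)), continuous_ex_RInt; auto.
  - apply (RInt_correct (V := R_CompleteNormedModule)), continuous_ex_RInt; auto.
Qed.

Lemma RInt_cauchy_le a b : RInt (fun x => / (1 + x ^ 2)) a b <= PI.
Proof.
  rewrite (is_RInt_unique (V := R_CompleteNormedModule) _ _ _ _ (is_RInt_cauchy a b)).
  pose proof (atan_bound a). pose proof (atan_bound b). lra.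
Qed.

Lemma continuous_cauchy x : continuous (fun x => / (1 + x ^ 2)) x.
Proof.
  apply (ex_derive_continuous (fun x => / (1 + x ^ 2))).
  auto_derive. pose proof (one_plus_sq_pos x). simpl in *. lra.
Qed.

(** Half of the error 4 C pi / A comes from truncating the outer integral; the other half is the
    inner truncation error integrated against the Cauchy density, whose mass is at most pi. *)
Lemma intR_window_double (f : R -> R -> R) C A : 0 < A ->
  (forall s u, continuity_2d_pt f s u) ->
  (forall s u, Rabs (f s u) <= C * / (1 + s ^ 2) * / (1 + u ^ 2)) ->
  (forall s, continuous (fun s => intR (f s)) s) ->
  dominated (fun s => intR (f s)) (C * PI) /\
  Rabs (intR (fun s => intR (f s)) - RInt (fun s => RInt (f s) (- A) A) (- A) A) <= 4 * C * PI / A.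
Proof.
  intros HA Hc Hb Hg.
  assert (Hd : forall s, dominated (f s) (C * / (1 + s ^ 2))).
  { intros s. split; auto. intros u. apply continuity_2d_pt_continuous_r, Hc. }
  assert (Hdg : dominated (fun s => intR (f s)) (C * PI)).
  { split; auto. intros s. eapply Rle_trans. eapply dominated_intR_le; eauto. lra. }
  split; auto.
  pose proof (intR_approx _ _ A Hdg HA).
  assert (H2 : Rabs (RInt (fun s => intR (f s)) (- A) A - RInt (fun s => RInt (f s) (- A) A) (- A) A)
    <= 2 * C / A * PI).
  { eapply Rle_trans.
    apply RInt_minus_le with (h := fun s => 2 * C / A * / (1 + s ^ 2)); auto. lra.
    - intros s. apply continuous_RInt_param; auto. lra.
    - intros s. apply (continuous_scal_r (V := R_NormedModule) (2 * C / A)), continuous_cauchy.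
    - intros s _. eapply Rle_trans. eapply intR_approx; eauto.
      right. field. split; [apply Rgt_not_eq, one_plus_sq_pos | lra].
    - rewrite (RInt_scal (V := R_CompleteNormedModule)).
      apply Rmult_le_compat_l. 2: apply RInt_cauchy_le.
      pose proof (dominated_nonneg _ _ (Hd 0)). replace (C * / (1 + 0 ^ 2)) with C in H0 by field.
      apply Rmult_le_pos. lra. left; apply Rinv_0_lt_compat; auto.
      apply continuous_ex_RInt. intros; apply continuous_cauchy. }
  replace (4 * C * PI / A) with (2 * (C * PI) / A + 2 * C / A * PI) by (field; lra).
  revert H H2. unfold Rabs; repeat destruct Rcase_abs; lra.
Qed.

(** Both iterated integrals lie within O(1/A) of the integral over the square of half-side A, where
    the order can be exchanged. *)
Lemma intR_swap (f : R -> R -> R) C :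
  (forall s u, continuity_2d_pt f s u) ->
  (forall s u, Rabs (f s u) <= C * / (1 + s ^ 2) * / (1 + u ^ 2)) ->
  (forall s, continuous (fun s => intR (f s)) s) ->
  (forall u, continuous (fun u => intR (fun s => f s u)) u) ->
  intR (fun s => intR (f s)) = intR (fun u => intR (fun s => f s u)).
Proof.
  intros Hc Hb H1 H2. apply cond_eq. intros eps He.
  destruct (ex_radius (8 * C * PI) eps He) as [A [HA HK]].
  destruct (intR_window_double f C A HA Hc Hb H1) as [_ Ha].
  destruct (intR_window_double (fun u s => f s u) C A HA) as [_ Hb']; auto.
  - intros s u e. destruct (Hc u s e) as [d Hd]. exists d. intros; apply Hd; auto.
  - intros s u. eapply Rle_trans. apply Hb. right; ring.
  - rewrite <- (RInt_swap f (- A) A (- A) A) in Hb' by (auto; lra).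
    replace (8 * C * PI / A) with (4 * C * PI / A + 4 * C * PI / A) in HK by (field; lra).
    pose (X := RInt (fun s => RInt (f s) (- A) A) (- A) A).
    change (Rabs (intR (fun s => intR (f s)) - X) <= 4 * C * PI / A) in Ha.
    change (Rabs (intR (fun u => intR (fun s => f s u)) - X) <= 4 * C * PI / A) in Hb'.
    revert Ha Hb'. unfold Rabs; repeat destruct Rcase_abs; lra.
Qed.

(** The mean value theorem is used twice, the second time between [x] and the first intermediate
    point; this yields [M] instead of the M / 2 of Taylor's formula. *)
Lemma second_order_bound (f f1 f2 : R -> R) x y M : 
  (forall z, Rmin x y <= z <= Rmax x y -> is_derive f z (f1 z)) ->
  (forall z, Rmin x y <= z <= Rmax x y -> is_derive f1 z (f2 z)) ->
  (forall z, Rmin x y <= z <= Rmax x y -> Rabs (f2 z) <= M) ->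
  Rabs (f y - f x - f1 x * (y - x)) <= M * (y - x) ^ 2.
Proof.
  intros H1 H2 HM.
  destruct (MVT_gen f x y f1) as [c [Hc Ec]].
  - intros z Hz. apply H1. lra.
  - intros z Hz. apply continuity_pt_filterlim, (ex_derive_continuous (V := R_NormedModule)). eexists. apply H1, Hz.
  - assert (Hsub : forall z, Rmin x c <= z <= Rmax x c -> Rmin x y <= z <= Rmax x y).
    { intros z. simpl in Hc. revert Hc. unfold Rmin, Rmax. repeat destruct Rle_dec; lra. }
    destruct (MVT_gen f1 x c f2) as [e [Hee Ee]].
    + intros z Hz. apply H2, Hsub. lra.
    + intros z Hz. apply continuity_pt_filterlim, (ex_derive_continuous (V := R_NormedModule)). eexists. apply H2, Hsub, Hz.
    + rewrite Ec. replace (f1 c * (y - x) - f1 x * (y - x)) with ((f1 c - f1 x) * (y - x)) by ring.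
      rewrite Ee, !Rabs_mult.
      specialize (HM e (Hsub e Hee)).
      replace ((y - x) ^ 2) with (Rabs (y - x) * Rabs (y - x)).
      2: { rewrite <- pow2_abs. ring. }
      assert (Rabs (c - x) <= Rabs (y - x)).
      { revert Hc. unfold Rmin, Rmax, Rabs. repeat destruct Rle_dec; repeat destruct Rcase_abs; lra. }
      rewrite <- Rmult_assoc. apply Rmult_le_compat_r. apply Rabs_pos.
      apply Rmult_le_compat; auto; apply Rabs_pos.
Qed.

Lemma is_derive_of_quadratic_error (f : R -> R) x l M d : 0 < d ->
  (forall y, Rabs (y - x) < d -> Rabs (f y - f x - l * (y - x)) <= M * (y - x) ^ 2) ->
  is_derive f x l.
Proof.
  intros Hd H. apply is_derive_Reals. intros eps He.
  assert (HM : 0 < eps / (Rabs M + 1)).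
  { apply Rdiv_lt_0_compat; auto. pose proof (Rabs_pos M). lra. }
  assert (Hm : 0 < Rmin d (eps / (Rabs M + 1))) by (apply Rmin_glb_lt; auto).
  exists (mkposreal _ Hm). simpl. intros h Hh0 Hh.
  specialize (H (x + h)). replace (x + h - x) with h in H by ring.
  pose proof (Rmin_l d (eps / (Rabs M + 1))). pose proof (Rmin_r d (eps / (Rabs M + 1))).
  specialize (H ltac:(lra)).
  replace ((f (x + h) - f x) / h - l) with ((f (x + h) - f x - l * h) / h) by (field; auto).
  unfold Rdiv. rewrite Rabs_mult, Rabs_inv.
  assert (0 < Rabs h) by (apply Rabs_pos_lt; auto).
  apply Rmult_lt_reg_r with (Rabs h); auto.
  rewrite Rmult_assoc, Rinv_l, Rmult_1_r by lra.
  eapply Rle_lt_trans. apply H.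
  replace (h ^ 2) with (Rabs h * Rabs h).
  2: { rewrite <- pow2_abs. ring. }
  rewrite <- Rmult_assoc. apply Rmult_lt_compat_r; auto.
  apply Rle_lt_trans with (Rabs M * Rabs h).
  - apply Rmult_le_compat_r. lra. apply Rle_abs.
  - pose proof (Rabs_pos M). apply Rle_lt_trans with (Rabs M * (eps / (Rabs M + 1))).
    apply Rmult_le_compat_l; lra.
    replace (Rabs M * (eps / (Rabs M + 1))) with (eps - eps / (Rabs M + 1)) by (field; lra). lra.
Qed.

(** A bound on the second parameter derivative by a fixed multiple of the Cauchy density makes the
    first-order remainder integrate to O((y - x)^2). This takes the place of dominated
    convergence. *)
Lemma is_derive_intR (f f1 f2 : R -> R -> R) C1 M x d : 0 < d ->
  (forall y, Rabs (y - x) < d -> exists C, dominated (f y) C) ->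
  dominated (f1 x) C1 ->
  (forall y u, Rabs (y - x) < d -> is_derive (fun y => f y u) y (f1 y u)) ->
  (forall y u, Rabs (y - x) < d -> is_derive (fun y => f1 y u) y (f2 y u)) ->
  (forall y u, Rabs (y - x) < d -> Rabs (f2 y u) <= M * / (1 + u ^ 2)) ->
  is_derive (fun y => intR (f y)) x (intR (f1 x)).
Proof.
  intros Hd Hf Hf1 D1 D2 HM.
  apply is_derive_of_quadratic_error with (M * PI) d; auto.
  intros y Hy.
  assert (Hx : Rabs (x - x) < d) by (rewrite Rminus_diag, Rabs_R0; auto).
  destruct (Hf y Hy) as [Cy Hfy]. destruct (Hf x Hx) as [Cx Hfx].
  assert (Hdom : dominated (fun u => f y u - f x u - (y - x) * f1 x u) (M * (y - x) ^ 2)).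
  { split.
    - apply (dominated_minus _ _ _ _ (dominated_minus _ _ _ _ Hfy Hfx) (dominated_scal _ (y - x) _ Hf1)).
    - intros u. replace ((y - x) * f1 x u) with (f1 x u * (y - x)) by ring.
      eapply Rle_trans.
      apply (second_order_bound (fun y => f y u) (fun y => f1 y u) (fun y => f2 y u)) with (M := M * / (1 + u ^ 2)).
      + intros z Hz. apply D1. revert Hz Hy. unfold Rmin, Rmax, Rabs. repeat destruct Rle_dec; repeat destruct Rcase_abs; lra.
      + intros z Hz. apply D2. revert Hz Hy. unfold Rmin, Rmax, Rabs. repeat destruct Rle_dec; repeat destruct Rcase_abs; lra.
      + intros z Hz. apply HM. revert Hz Hy. unfold Rmin, Rmax, Rabs. repeat destruct Rle_dec; repeat destruct Rcase_abs; lra.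
      + right. ring. }
  rewrite (Rmult_comm (intR (f1 x))).
  rewrite <- (intR_minus _ _ _ _ Hfy Hfx), <- (intR_scal _ _ _ Hf1).
  rewrite <- (intR_minus _ _ _ _ (dominated_minus _ _ _ _ Hfy Hfx) (dominated_scal _ (y - x) _ Hf1)).
  eapply Rle_trans. apply (dominated_intR_le _ _ Hdom). right; ring.
Qed.

(** * The densities rho *)

(** Decay faster than every power absorbs polynomial and logarithmic weights and is preserved by
    convolution, so it is the invariant kept along the construction of the densities. *)
Definition rapid_decay (f : R -> R) : Prop :=
  (forall x, continuous f x) /\
  forall k : nat, exists C, forall x, Rabs (f x) <= C * / (1 + x ^ 2) ^ k.

Lemma exp_ge_sq y : 0 <= y -> 1 + y ^ 2 / 4 <= exp y.
Proof.
  intros Hy. replace y with (y / 2 + y / 2) at 2 by field. rewrite exp_plus.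
  pose proof (exp_ineq1_le (y / 2)). nra.
Qed.

(** Each step of the induction spends half of the exponential rate on one factor 1 + t^2:
    [exp_ge_sq] at d |t| / 2 gives (1 + t^2) exp (- d |t| / 2) <= 1 + 16 / d^2. *)
Lemma exp_decay (k : nat) : forall d, 0 < d ->
  exists C, forall t, exp (- (d * Rabs t)) <= C * / (1 + t ^ 2) ^ k.
Proof.
  induction k as [|k IH]; intros d Hd.
  - exists 1. intros t. simpl. rewrite Rinv_1, Rmult_1_r, <- exp_0.
    destruct (Req_dec (- (d * Rabs t)) 0) as [->|Hn]. lra.
    left. apply exp_increasing. pose proof (Rabs_pos t). nra.
  - destruct (IH (d / 2)) as [C HC]. lra.
    exists (C * (1 + 16 / d ^ 2)). intros t.
    replace (- (d * Rabs t)) with (- (d / 2 * Rabs t) + - (d / 2 * Rabs t)) by field.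
    rewrite exp_plus. specialize (HC t).
    change ((1 + t ^ 2) ^ S k) with ((1 + t ^ 2) * (1 + t ^ 2) ^ k). rewrite Rinv_mult.
    replace (C * (1 + 16 / d ^ 2) * (/ (1 + t ^ 2) * / (1 + t ^ 2) ^ k)) with
      (C * / (1 + t ^ 2) ^ k * ((1 + 16 / d ^ 2) * / (1 + t ^ 2))) by ring.
    apply Rmult_le_compat; auto; try (left; apply exp_pos).
    rewrite exp_Ropp. pose proof (Rabs_pos t).
    assert (H1 : 1 + (d / 2 * Rabs t) ^ 2 / 4 <= exp (d / 2 * Rabs t)) by (apply exp_ge_sq; nra).
    replace ((d / 2 * Rabs t) ^ 2) with ((d / 2) ^ 2 * t ^ 2) in H1
      by (rewrite Rpow_mult_distr, pow2_abs; auto).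
    pose proof (exp_pos (d / 2 * Rabs t)). pose proof (one_plus_sq_pos t).
    apply Rmult_le_reg_r with (exp (d / 2 * Rabs t) * (1 + t ^ 2)).
    apply Rmult_lt_0_compat; auto.
    replace (/ exp (d / 2 * Rabs t) * (exp (d / 2 * Rabs t) * (1 + t ^ 2))) with (1 + t ^ 2)
      by (field; lra).
    replace ((1 + 16 / d ^ 2) * / (1 + t ^ 2) * (exp (d / 2 * Rabs t) * (1 + t ^ 2))) with
      ((1 + 16 / d ^ 2) * exp (d / 2 * Rabs t)) by (field; split; [simpl in *; lra | lra]).
    apply Rle_trans with ((1 + 16 / d ^ 2) * (1 + (d / 2) ^ 2 * t ^ 2 / 4)).
    + replace ((1 + 16 / d ^ 2) * (1 + (d / 2) ^ 2 * t ^ 2 / 4)) with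
        (1 + t ^ 2 + 16 / d ^ 2 + (d / 2) ^ 2 * t ^ 2 / 4) by (field; lra).
      assert (0 < 16 / d ^ 2) by (apply Rdiv_lt_0_compat; [lra | apply pow_lt; auto]).
      pose proof (pow2_ge_0 (d / 2)). pose proof (pow2_ge_0 t). nra.
    + apply Rmult_le_compat_l; auto.
      assert (0 < 16 / d ^ 2) by (apply Rdiv_lt_0_compat; [lra | apply pow_lt; auto]). lra.
Qed.

Lemma rapid_decay_of_exp (f : R -> R) K d : 0 < d -> (forall x, continuous f x) ->
  (forall x, Rabs (f x) <= K * exp (- (d * Rabs x))) -> rapid_decay f.
Proof.
  intros Hd Hc H. split; auto. intros k. destruct (exp_decay k d Hd) as [C HC].
  exists (Rabs K * C). intros x. eapply Rle_trans. apply H.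
  eapply Rle_trans. apply Rmult_le_compat_r. left; apply exp_pos. apply Rle_abs.
  rewrite Rmult_assoc. apply Rmult_le_compat_l. apply Rabs_pos. apply HC.
Qed.

Lemma decay_const_nonneg (f : R -> R) C k :
  (forall x, Rabs (f x) <= C * / (1 + x ^ 2) ^ k) -> 0 <= C.
Proof.
  intros H. specialize (H 0). pose proof (Rabs_pos (f 0)).
  replace (1 + 0 ^ 2) with 1 in H by ring. rewrite pow1 in H. lra.
Qed.

Lemma rapid_decay_dominated (f g : R -> R) (K : R) j : rapid_decay f ->
  (forall x, continuous g x) -> (forall x, Rabs (g x) <= K * (1 + x ^ 2) ^ j) ->
  exists C, dominated (fun x => g x * f x) C.
Proof.
  intros [Hf Hd] Hg HK. destruct (Hd (S j)) as [C HC]. exists (K * C). split.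
  - intros x. apply (continuous_mult (K := R_AbsRing)); auto.
  - intros x. rewrite Rabs_mult. specialize (HC x). specialize (HK x).
    eapply Rle_trans. apply Rmult_le_compat; eauto; apply Rabs_pos.
    right. pose proof (one_plus_sq_pos x) as H. revert H. generalize (1 + x ^ 2).
    intros a H. simpl pow. field. split; [|apply pow_nonzero]; lra.
Qed.

Lemma rapid_decay_dominated_bounded (f g : R -> R) (K : R) : rapid_decay f ->
  (forall x, continuous g x) -> (forall x, Rabs (g x) <= K) ->
  exists C, dominated (fun x => g x * f x) C.
Proof.
  intros. apply rapid_decay_dominated with K 0%nat; auto.
  intros x; simpl; rewrite Rmult_1_r; auto.
Qed.

Lemma rapid_decay_dominated_1 (f : R -> R) : rapid_decay f -> exists C, dominated f C.
Proof.
  intros Hf. destruct (rapid_decay_dominated_bounded f (fun _ => 1) 1 Hf) as [C HC].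
  intros; apply continuous_const. intros; rewrite Rabs_R1; lra.
  exists C. eapply dominated_ext. 2: exact HC. intros; simpl; ring.
Qed.

Lemma continuous_of_lipschitz (f : R -> R) K x :
  (forall y z, Rabs (f y - f z) <= K * Rabs (y - z)) -> continuous f x.
Proof.
  intros H P [e He].
  assert (HK : 0 <= K).
  { specialize (H 1 0). rewrite Rminus_0_r, Rabs_R1 in H. pose proof (Rabs_pos (f 1 - f 0)). lra. }
  assert (Hd : 0 < e / (K + 1)) by (apply Rdiv_lt_0_compat; [apply e | lra]).
  exists (mkposreal _ Hd). intros y Hy. apply He.
  unfold ball in *; simpl in *. unfold AbsRing_ball, abs, minus, plus, opp in *; simpl in *.
  eapply Rle_lt_trans. apply H. 
  apply Rle_lt_trans with ((K + 1) * Rabs (y + - x)).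
  apply Rmult_le_compat_r. apply Rabs_pos. lra.
  apply Rlt_le_trans with ((K + 1) * (e / (K + 1))).
  apply Rmult_lt_compat_l; lra. right; field; lra.
Qed.

Lemma lipschitz_of_derive (f df : R -> R) K :
  (forall x, is_derive f x (df x)) -> (forall x, Rabs (df x) <= K) ->
  forall y z, Rabs (f y - f z) <= K * Rabs (y - z).
Proof.
  intros H HK y z. destruct (MVT_gen f z y df) as [c [_ ->]].
  - auto.
  - intros x _. apply continuity_pt_filterlim, (ex_derive_continuous (V := R_NormedModule)). eexists; apply H.
  - rewrite Rabs_mult. apply Rmult_le_compat_r; auto. apply Rabs_pos.
Qed.

Lemma continuous_reflect_shift (k : R -> R) u s : (forall x, continuous k x) ->
  continuous (fun s => k (u - s)) s.
Proof.
  intros H. apply continuous_comp; auto.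
  apply (continuous_minus (V := R_NormedModule)). apply continuous_const. apply continuous_id.
Qed.

Lemma convol_dominated f k u : rapid_decay f -> rapid_decay k ->
  exists C, dominated (fun s => f s * k (u - s)) C.
Proof.
  intros Hf [Hk Hd]. destruct (Hd 0%nat) as [C HC].
  destruct (rapid_decay_dominated_bounded f (fun s => k (u - s)) C Hf) as [D HD].
  - intros; apply continuous_reflect_shift; auto.
  - intros x. specialize (HC (u - x)). simpl in HC. lra.
  - exists D. eapply dominated_ext. 2: apply HD. intros; apply Rmult_comm.
Qed.

(** A Lipschitz kernel gives a Lipschitz convolution; its constant is multiplied by C pi, a bound
    for the integral of |f|. *)
Lemma convol_continuous f k K u : rapid_decay f -> rapid_decay k ->
  (forall y z, Rabs (k y - k z) <= K * Rabs (y - z)) ->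
  continuous (fun u => intR (fun s => f s * k (u - s))) u.
Proof.
  intros Hf Hk HL. destruct (rapid_decay_dominated_1 f Hf) as [C HC].
  pose proof (dominated_nonneg _ _ HC).
  apply continuous_of_lipschitz with (K * C * PI). intros y z.
  destruct (convol_dominated f k y Hf Hk) as [Cy Hy].
  destruct (convol_dominated f k z Hf Hk) as [Cz Hz].
  rewrite <- (intR_minus _ _ _ _ Hy Hz).
  replace (K * C * PI * Rabs (y - z)) with (K * C * Rabs (y - z) * PI) by ring.
  apply dominated_intR_le. split. apply (dominated_minus _ _ _ _ Hy Hz).
  intros s. rewrite <- Rmult_minus_distr_l, Rabs_mult.
  replace (K * C * Rabs (y - z) * / (1 + s ^ 2)) with (C * / (1 + s ^ 2) * (K * Rabs (y - z))) by ring.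
  apply Rmult_le_compat; try apply Rabs_pos. apply HC.
  eapply Rle_trans. apply HL. right. f_equal. f_equal. ring.
Qed.

(** [peetre] for u = s + (u - s) converts order j in s and in u - s into order j in u; the
    additional power asked of [f] remains for the integration in s. *)
Lemma convol_bound f k C D j :
  (forall x, Rabs (f x) <= C * / (1 + x ^ 2) ^ S j) ->
  (forall x, Rabs (k x) <= D * / (1 + x ^ 2) ^ j) -> 
  forall s u, Rabs (f s * k (u - s)) <= 2 ^ j * C * D * / (1 + s ^ 2) * / (1 + u ^ 2) ^ j.
Proof.
  intros Hf Hk s u.
  pose proof (decay_const_nonneg _ _ _ Hf) as HC. pose proof (decay_const_nonneg _ _ _ Hk) as HD.
  rewrite Rabs_mult.
  eapply Rle_trans. apply Rmult_le_compat; try apply Rabs_pos. apply Hf. apply Hk.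
  pose proof (peetre s (u - s)) as Hp. replace (s + (u - s)) with u in Hp by ring.
  pose proof (one_plus_sq_pos s). pose proof (one_plus_sq_pos u). pose proof (one_plus_sq_pos (u - s)).
  set (a := 1 + s ^ 2) in *. set (b := 1 + u ^ 2) in *. set (c := 1 + (u - s) ^ 2) in *.
  assert (Hj : b ^ j <= 2 ^ j * a ^ j * c ^ j).
  { rewrite <- !Rpow_mult_distr. apply pow_incr. lra. }
  pose proof (pow_lt a j H). pose proof (pow_lt b j H0). pose proof (pow_lt c j H1).
  simpl pow. 
  apply Rmult_le_reg_r with (a ^ j * c ^ j * b ^ j * a).
  repeat apply Rmult_lt_0_compat; auto.
  replace (C * / (a * a ^ j) * (D * / c ^ j) * (a ^ j * c ^ j * b ^ j * a)) with (C * D * b ^ j) by (field; lra).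
  replace (2 ^ j * C * D * / a * / b ^ j * (a ^ j * c ^ j * b ^ j * a)) with
    (C * D * (2 ^ j * a ^ j * c ^ j)) by (field; lra).
  apply Rmult_le_compat_l; auto. apply Rmult_le_pos; auto.
Qed.

Lemma rapid_decay_convol f k K : rapid_decay f -> rapid_decay k ->
  (forall y z, Rabs (k y - k z) <= K * Rabs (y - z)) ->
  rapid_decay (fun u => intR (fun s => f s * k (u - s))).
Proof.
  intros Hf Hk HL. split. intros; eapply convol_continuous; eauto.
  intros j. destruct Hf as [Hcf Hf], Hk as [Hck Hk].
  destruct (Hf (S j)) as [C HC]. destruct (Hk j) as [D HD].
  exists (2 ^ j * C * D * PI). intros u.
  replace (2 ^ j * C * D * PI * / (1 + u ^ 2) ^ j) with (2 ^ j * C * D * / (1 + u ^ 2) ^ j * PI) by ring.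
  apply dominated_intR_le. split.
  - intros s. apply (continuous_mult (K := R_AbsRing)); auto. apply continuous_reflect_shift; auto.
  - intros s. eapply Rle_trans. apply (convol_bound f k C D j); auto. right; ring.
Qed.

Lemma continuity_2d_pt_fst (f : R -> R) s u : continuous f s -> continuity_2d_pt (fun s _ => f s) s u.
Proof.
  intros H. apply (continuity_1d_2d_pt_comp f (fun s _ => s)). apply continuity_pt_filterlim, H.
  apply continuity_2d_pt_id1.
Qed.

Lemma continuity_2d_pt_snd (f : R -> R) s u : continuous f u -> continuity_2d_pt (fun _ u => f u) s u.
Proof.
  intros H. apply (continuity_1d_2d_pt_comp f (fun _ u => u)). apply continuity_pt_filterlim, H.
  apply continuity_2d_pt_id2.
Qed.

(** The adjoint of convolution: a weight [g] tested against f * k is its average [h] over translates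
    of [k], tested against [f]. It lifts what is known for rho_1 to all the convolutions. *)
Lemma intR_convol_swap (f k g h : R -> R) K M : rapid_decay f -> rapid_decay k ->
  (forall y z, Rabs (k y - k z) <= K * Rabs (y - z)) ->
  (forall u, continuous g u) -> (forall u, Rabs (g u) <= M * (1 + u ^ 2)) ->
  (forall s, intR (fun u => g u * k (u - s)) = h s) -> (forall s, continuous h s) ->
  intR (fun u => g u * intR (fun s => f s * k (u - s))) = intR (fun s => f s * h s).
Proof.
  intros Hf Hk HL Hg HM Hh Hch.
  pose proof (rapid_decay_convol f k K Hf Hk HL) as Hconv.
  pose proof Hf as [Hcf Df]. pose proof Hk as [Hck Dk].
  (* Orders 3 and 2 make [convol_bound] leave one power of 1 + s^2 and two of 1 + u^2 in the
     denominator; one of the latter pays for the growth of [g]. *)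
  destruct (Df 3%nat) as [C HC]. destruct (Dk 2%nat) as [D HD].
  set (F := fun s u => f s * (g u * k (u - s))).
  assert (HFb : forall s u, Rabs (F s u) <= 2 ^ 2 * C * D * M * / (1 + s ^ 2) * / (1 + u ^ 2)).
  { intros s u. unfold F. replace (f s * (g u * k (u - s))) with (g u * (f s * k (u - s))) by ring.
    rewrite Rabs_mult. eapply Rle_trans. apply Rmult_le_compat; try apply Rabs_pos. apply HM.
    apply (convol_bound f k C D 2); auto. right. field.
    split; apply Rgt_not_eq, one_plus_sq_pos. }
  assert (HF2 : forall s u, continuity_2d_pt F s u).
  { intros s u. apply continuity_2d_pt_mult. apply continuity_2d_pt_fst; auto.
    apply continuity_2d_pt_mult. apply continuity_2d_pt_snd; auto.
    apply (continuity_1d_2d_pt_comp k (fun s u => u - s)). apply continuity_pt_filterlim, Hck.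
    apply continuity_2d_pt_minus. apply continuity_2d_pt_id2. apply continuity_2d_pt_id1. }
  assert (Hgk : forall s, exists C, dominated (fun u => g u * k (u - s)) C).
  { intros s. destruct (rapid_decay_dominated k (fun u => g (u + s)) (2 * M * (1 + s ^ 2)) 1 Hk) as [B HB].
    - intros x. apply continuous_comp; auto. apply (continuous_plus (V := R_NormedModule)).
      apply continuous_id. apply continuous_const.
    - intros x. eapply Rle_trans. apply HM. 
      assert (0 <= M) by (specialize (HM 0); pose proof (Rabs_pos (g 0)); lra).
      pose proof (peetre x s). simpl pow in *. nra.
    - exists (2 * B * (1 + (- s) ^ 2)).
      eapply dominated_ext. 2: apply (dominated_shift _ _ (- s) HB).
      intros x. simpl. f_equal. f_equal. ring. }
  assert (E1 : forall s, intR (F s) = f s * h s).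
  { intros s. destruct (Hgk s) as [B HB]. rewrite <- Hh.
    unfold F. rewrite (intR_scal _ (f s) _ HB). auto. }
  assert (E2 : forall u, intR (fun s => F s u) = g u * intR (fun s => f s * k (u - s))).
  { intros u. destruct (convol_dominated f k u Hf Hk) as [B HB].
    rewrite <- (intR_scal _ (g u) _ HB). 
    apply intR_ext with (2 ^ 2 * C * D * M * / (1 + u ^ 2)).
    split. intros; apply (continuity_2d_pt_continuous_l F); auto.
    intros s. eapply Rle_trans. apply HFb. right; ring.
    intros s. unfold F. ring. }
  assert (Hc1 : forall s, continuous (fun s => intR (F s)) s).
  { intros s. apply continuous_ext with (fun s => f s * h s). intros; symmetry; apply E1.
    apply (continuous_mult (K := R_AbsRing)); auto. }
  assert (Hc2 : forall u, continuous (fun u => intR (fun s => F s u)) u).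
  { intros u. apply continuous_ext with (fun u => g u * intR (fun s => f s * k (u - s))).
    intros; symmetry; apply E2. apply (continuous_mult (K := R_AbsRing)); auto. apply Hconv. }
  destruct (intR_window_double F (2 ^ 2 * C * D * M) 1 ltac:(lra) HF2 HFb Hc1) as [HdF _].
  destruct (rapid_decay_dominated _ g M 1 Hconv Hg) as [B HB]. intros; rewrite pow_1; auto.
  transitivity (intR (fun s => intR (F s))).
  - rewrite (intR_swap F _ HF2 HFb Hc1 Hc2). apply intR_ext with B; auto.
  - eapply intR_ext. apply HdF. auto.
Qed.

(** * Hyperbolic functions and the density rho_1 *)

Lemma cosh_ge_exp x : exp (Rabs x) / 2 <= cosh x.
Proof.
  unfold cosh. pose proof (exp_pos x). pose proof (exp_pos (- x)).
  unfold Rabs; destruct Rcase_abs; lra.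
Qed.

Lemma cosh_pos x : 0 < cosh x.
Proof. unfold cosh. pose proof (exp_pos x). pose proof (exp_pos (- x)). lra. Qed.

Lemma cosh_sq x : cosh x ^ 2 = 1 + sinh x ^ 2.
Proof.
  unfold cosh, sinh. rewrite exp_Ropp. pose proof (exp_pos x). field. lra.
Qed.

Lemma cosh_ge_1 x : 1 <= cosh x.
Proof. pose proof (cosh_sq x). pose proof (cosh_pos x). nra. Qed.

(** This antiderivative is half of coth (pi (u - i/2)), which is how rho_1 enters the contour
    argument. *)
Lemma is_derive_half_tanh (u : R) :
  is_derive (fun u => sinh (PI * u) / cosh (PI * u) / 2) u (rho1 u).
Proof.
  unfold rho1. pose proof (cosh_pos (PI * u)). auto_derive. lra.
  pose proof (cosh_sq (PI * u)) as E. revert E H.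
  generalize (cosh (PI * u)) (sinh (PI * u)). intros c s E H.
  apply Rmult_eq_reg_r with (2 * c ^ 2); [| apply Rgt_not_eq; nra].
  replace (PI / 2 / c ^ 2 * (2 * c ^ 2)) with PI by (field; lra).
  transitivity (PI * (c ^ 2 - s ^ 2)). field; lra. rewrite E; ring.
Qed.

Lemma is_derive_rho1 (u : R) :
  is_derive rho1 u (- PI ^ 2 * sinh (PI * u) / cosh (PI * u) ^ 3).
Proof.
  unfold rho1. pose proof (cosh_pos (PI * u)). auto_derive.
  apply (pow_nonzero (cosh (PI * u)) 2). lra.
  field. lra.
Qed.

Lemma continuous_rho1 u : continuous rho1 u.
Proof. apply (ex_derive_continuous (V := R_NormedModule)). eexists. apply is_derive_rho1. Qed.

Lemma rho1_lipschitz y z : Rabs (rho1 y - rho1 z) <= PI ^ 2 * Rabs (y - z).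
Proof.
  apply (lipschitz_of_derive rho1 _ _ is_derive_rho1). intros u.
  pose proof (cosh_sq (PI * u)) as E. pose proof (cosh_ge_1 (PI * u)) as H. revert E H.
  generalize (cosh (PI * u)) (sinh (PI * u)). intros c s E H.
  pose proof PI_RGT_0. 
  unfold Rdiv. rewrite !Rabs_mult, Rabs_Ropp, Rabs_inv.
  rewrite (Rabs_right (PI ^ 2)), (Rabs_right (c ^ 3)) by (apply Rle_ge, pow_le; lra).
  rewrite Rmult_assoc. rewrite <- (Rmult_1_r (PI ^ 2)) at 2.
  apply Rmult_le_compat_l. apply pow_le; lra.
  assert (0 < c ^ 3) by (apply pow_lt; lra).
  apply Rmult_le_reg_r with (c ^ 3); auto. rewrite Rmult_assoc, Rinv_l, Rmult_1_l, Rmult_1_r by lra.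
  assert (Rabs s <= c) by (rewrite <- (Rabs_right c) by lra; apply Rsqr_le_abs_0; unfold Rsqr; nra).
  apply Rle_trans with c; auto. assert (1 <= c * c) by nra. simpl. nra.
Qed.

Lemma rapid_decay_rho1 : rapid_decay rho1.
Proof.
  pose proof PI_RGT_0.
  apply rapid_decay_of_exp with (2 * PI) PI; auto. apply continuous_rho1.
  intros x. unfold rho1. pose proof (cosh_ge_1 (PI * x)). pose proof (cosh_ge_exp (PI * x)) as H1.
  rewrite Rabs_mult, (Rabs_right PI) in H1 by lra.
  pose proof (exp_pos (PI * Rabs x)).
  rewrite Rabs_right.
  2: { apply Rle_ge, Rmult_le_pos. lra. left; apply Rinv_0_lt_compat, pow_lt; lra. }
  rewrite exp_Ropp.
  apply Rle_trans with (PI / 2 / cosh (PI * x)).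
  - apply Rmult_le_compat_l. lra. apply Rinv_le_contravar. lra. nra.
  - replace (2 * PI * / exp (PI * Rabs x)) with (PI / 2 * (4 / exp (PI * Rabs x))) by (field; lra).
    apply Rmult_le_compat_l. lra. apply Rle_trans with (2 / exp (PI * Rabs x)).
    + replace (2 / exp (PI * Rabs x)) with (/ (exp (PI * Rabs x) / 2)) by (field; lra).
      apply Rinv_le_contravar; lra.
    + apply Rmult_le_compat_r. left; apply Rinv_0_lt_compat; auto. lra.
Qed.

Lemma rho1_even u : rho1 (- u) = rho1 u.
Proof. unfold rho1, cosh. replace (PI * - u) with (- (PI * u)) by ring. rewrite Ropp_involutive, (Rplus_comm (exp _)). auto. Qed.

(** The difference is -exp (-x) / cosh x, exponentially small; the rate 1/x is the form that
    [is_lim_of_inv_bound] consumes. *)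
Lemma tanh_bound x : 0 < x -> Rabs (sinh x / cosh x - 1) <= 2 / x.
Proof.
  intros Hx. pose proof (cosh_pos x).
  replace (sinh x / cosh x - 1) with (- (exp (- x) / cosh x)).
  2: { unfold cosh, sinh in *. field. lra. }
  rewrite Rabs_Ropp, Rabs_right.
  2: { apply Rle_ge. left. apply Rdiv_lt_0_compat; auto. apply exp_pos. }
  pose proof (cosh_ge_1 x). pose proof (exp_ineq1_le x). pose proof (exp_pos (- x)).
  apply Rle_trans with (exp (- x)).
  - rewrite <- Rdiv_1_r. apply Rmult_le_compat_l. lra. apply Rinv_le_contravar; lra.
  - rewrite exp_Ropp. apply Rle_trans with (/ x). apply Rinv_le_contravar; lra.
    assert (0 < / x) by (apply Rinv_0_lt_compat; auto). unfold Rdiv. lra.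
Qed.

Lemma sinh_opp x : sinh (- x) = - sinh x.
Proof. unfold sinh. rewrite Ropp_involutive. field. Qed.

Lemma cosh_opp x : cosh (- x) = cosh x.
Proof. unfold cosh. rewrite Ropp_involutive. field. Qed.

Lemma is_lim_of_inv_bound (f : R -> R) l K A0 : 
  (forall A, A0 < A -> Rabs (f A - l) <= K / A) -> is_lim f p_infty l.
Proof.
  intros H. apply is_lim_spec. intros eps.
  destruct (ex_radius K eps (cond_pos eps)) as [A [HA HK]].
  (* For K <= 0 the hypothesis already forces f A = l at large A, and the monotonicity of K / A is
     only of use for K > 0. *)
  destruct (Rle_or_lt K 0) as [HK0|HK0].
  - exists (Rmax A0 0). intros B HB. pose proof (Rmax_l A0 0). pose proof (Rmax_r A0 0).
    eapply Rle_lt_trans. apply H; lra. apply Rle_lt_trans with 0; [|apply eps].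
    apply Rmult_le_reg_r with B. lra. unfold Rdiv. rewrite Rmult_assoc, Rinv_l; lra.
  - exists (Rmax A A0). intros B HB. pose proof (Rmax_l A A0). pose proof (Rmax_r A A0).
    eapply Rle_lt_trans. apply H; lra. eapply Rle_lt_trans. 2: apply HK.
    apply Rmult_le_compat_l. lra. apply Rinv_le_contravar; lra.
Qed.

Lemma intR_rho1 : intR rho1 = 1.
Proof.
  destruct (rapid_decay_dominated_1 _ rapid_decay_rho1) as [C HC].
  apply intR_unique with C; auto.
  apply is_lim_of_inv_bound with (2 / PI) 0. intros A HA. pose proof PI_RGT_0.
  rewrite (is_RInt_unique (V := R_CompleteNormedModule) rho1 (- A) A (sinh (PI * A) / cosh (PI * A))).
  - replace (2 / PI / A) with (2 / (PI * A)) by (field; lra). apply tanh_bound. nra.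
  - replace (sinh (PI * A) / cosh (PI * A)) with
      (minus (sinh (PI * A) / cosh (PI * A) / 2) (sinh (PI * - A) / cosh (PI * - A) / 2)).
    + apply (is_RInt_derive (V := R_CompleteNormedModule) (fun u => sinh (PI * u) / cosh (PI * u) / 2)).
      intros; apply is_derive_half_tanh. intros; apply continuous_rho1.
    + unfold minus, plus, opp; simpl. replace (PI * - A) with (- (PI * A)) by ring.
      rewrite sinh_opp, cosh_opp. pose proof (cosh_pos (PI * A)). field. lra.
Qed.

Lemma rapid_decay_rhoS n : rapid_decay (rhoS n).
Proof.
  induction n as [|n IH].
  - apply rapid_decay_rho1.
  - apply (rapid_decay_convol (rhoS n) rho1 (PI ^ 2) IH rapid_decay_rho1 rho1_lipschitz).
Qed.

Lemma rhoS_even n u : rhoS n (- u) = rhoS n u.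
Proof.
  revert u. induction n as [|n IH]; intros u. apply rho1_even.
  change (intR (fun s => rhoS n s * rho1 (- u - s)) = intR (fun s => rhoS n s * rho1 (u - s))).
  destruct (convol_dominated _ _ u (rapid_decay_rhoS n) rapid_decay_rho1) as [C HC].
  rewrite <- (intR_reflect _ _ HC). symmetry. eapply intR_ext.
  - apply (dominated_reflect _ _ HC).
  - intros s. rewrite IH. f_equal. rewrite <- rho1_even. f_equal. ring.
Qed.

(** Convolution multiplies total masses: the adjoint identity with the weight 1, whose average
    against rho_1 is again 1. *)
Lemma intR_rhoS n : intR (rhoS n) = 1.
Proof.
  induction n as [|n IH]. apply intR_rho1.
  destruct (rapid_decay_dominated_1 _ rapid_decay_rho1) as [C HC].
  destruct (rapid_decay_dominated_1 _ (rapid_decay_rhoS n)) as [D HD].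
  destruct (rapid_decay_dominated_1 _ (rapid_decay_rhoS (S n))) as [E HE].
  rewrite (intR_ext _ (fun u => 1 * rhoS (S n) u) E HE) by (intros; rewrite Rmult_1_l; reflexivity).
  change (intR (fun u => 1 * intR (fun s => rhoS n s * rho1 (u - s))) = 1).
  rewrite (intR_convol_swap (rhoS n) rho1 (fun _ => 1) (fun _ => 1) (PI ^ 2) 1).
  - etransitivity. 2: exact IH. symmetry. apply intR_ext with D; auto. intros; rewrite Rmult_1_r; reflexivity.
  - apply rapid_decay_rhoS.
  - apply rapid_decay_rho1.
  - apply rho1_lipschitz.
  - intros; apply continuous_const.
  - intros u. rewrite Rabs_R1. pose proof (one_plus_sq_pos u). nra.
  - intros s. etransitivity. 2: exact intR_rho1. rewrite <- (intR_shift _ _ (- s) HC).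
    symmetry. eapply intR_ext. apply (dominated_shift _ _ (- s) HC). intros u. rewrite Rmult_1_l. auto.
  - intros; apply continuous_const.
Qed.

(** * Contour shift for the hyperbolic cotangent *)

(** With z = s + i v, the five functions are log |z|, Re (1/z), -Im (1/z), Re (1/z^2) and -Im
    (1/z^2); the sign of [inv_im] makes it the v-derivative of [logmod]. *)
Definition logmod (s v : R) : R := ln (s ^ 2 + v ^ 2) / 2.
Definition inv_re (s v : R) : R := s / (s ^ 2 + v ^ 2).
Definition inv_im (s v : R) : R := v / (s ^ 2 + v ^ 2).
Definition inv_sq_re (s v : R) : R := (s ^ 2 - v ^ 2) / (s ^ 2 + v ^ 2) ^ 2.
Definition inv_sq_im (s v : R) : R := 2 * s * v / (s ^ 2 + v ^ 2) ^ 2.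

Lemma sum_sq_pos (s v : R) : 0 < s -> 0 < s ^ 2 + v ^ 2.
Proof. intros. nra. Qed.

Lemma is_derive_eq (f : R -> R) (x l l' : R) : is_derive f x l -> l = l' -> is_derive f x l'.
Proof. intros H <-. exact H. Qed.

Lemma is_derive_inv_re_l (s v : R) : 0 < s ->
  is_derive (fun s => inv_re s v) s (- inv_sq_re s v).
Proof.
  intros Hs. pose proof (sum_sq_pos s v Hs). unfold inv_re, inv_sq_re.
  auto_derive. simpl in *; lra. field. simpl in *; lra.
Qed.

Lemma is_derive_inv_re_r (s v : R) : 0 < s ->
  is_derive (fun v => inv_re s v) v (- inv_sq_im s v).
Proof.
  intros Hs. pose proof (sum_sq_pos s v Hs). unfold inv_re, inv_sq_im.
  auto_derive. simpl in *; lra. field. simpl in *; lra.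
Qed.

Lemma is_derive_inv_im_l (s v : R) : 0 < s ->
  is_derive (fun s => inv_im s v) s (- inv_sq_im s v).
Proof.
  intros Hs. pose proof (sum_sq_pos s v Hs). unfold inv_im, inv_sq_im.
  auto_derive. simpl in *; lra. field. simpl in *; lra.
Qed.

Lemma is_derive_inv_im_r (s v : R) : 0 < s ->
  is_derive (fun v => inv_im s v) v (inv_sq_re s v).
Proof.
  intros Hs. pose proof (sum_sq_pos s v Hs). unfold inv_im, inv_sq_re.
  auto_derive. simpl in *; lra. field. simpl in *; lra.
Qed.

Lemma is_derive_logmod_l (s v : R) : 0 < s ->
  is_derive (fun s => logmod s v) s (inv_re s v).
Proof.
  intros Hs. pose proof (sum_sq_pos s v Hs). unfold logmod, inv_re.
  auto_derive. simpl in *; lra. field. simpl in *; lra.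
Qed.

Lemma is_derive_logmod_r (s v : R) : 0 < s ->
  is_derive (fun v => logmod s v) v (inv_im s v).
Proof.
  intros Hs. pose proof (sum_sq_pos s v Hs). unfold logmod, inv_im.
  auto_derive. simpl in *; lra. field. simpl in *; lra.
Qed.

Lemma inv_sq_bounds (s v : R) : 0 < s ->
  Rabs (inv_sq_re s v) <= / s ^ 2 /\ Rabs (inv_sq_im s v) <= / s ^ 2.
Proof.
  intros Hs. pose proof (sum_sq_pos s v Hs) as H.
  assert (H2 : / (s ^ 2 + v ^ 2) <= / s ^ 2).
  { apply Rinv_le_contravar. apply pow_lt; auto. nra. }
  assert (H0 : 0 < / (s ^ 2 + v ^ 2)) by (apply Rinv_0_lt_compat; auto).
  assert (Hgen : forall x, Rabs x <= s ^ 2 + v ^ 2 -> Rabs (x / (s ^ 2 + v ^ 2) ^ 2) <= / s ^ 2).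
  { intros x Hx. eapply Rle_trans. 2: apply H2.
    unfold Rdiv. rewrite Rabs_mult, Rabs_inv, (Rabs_right ((s ^ 2 + v ^ 2) ^ 2)) by (apply Rle_ge, pow2_ge_0).
    apply Rmult_le_reg_r with ((s ^ 2 + v ^ 2) ^ 2). apply pow_lt; auto.
    rewrite Rmult_assoc, Rinv_l, Rmult_1_r by (apply Rgt_not_eq, pow_lt; auto).
    replace (/ (s ^ 2 + v ^ 2) * (s ^ 2 + v ^ 2) ^ 2) with (s ^ 2 + v ^ 2) by (field; lra). auto. }
  pose proof (pow2_ge_0 (s - v)). pose proof (pow2_ge_0 (s + v)).
  pose proof (pow2_ge_0 s). pose proof (pow2_ge_0 v).
  split; apply Hgen; apply Rabs_le; split; lra.
Qed.

(** * The cotangent on a shifted line and the Cauchy-Riemann equations *)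

Definition coth_den (e u : R) : R := sinh (PI * u) ^ 2 + sin (PI * e) ^ 2.
(* Real and imaginary parts of [coth (PI * (u - i e))]. *)
Definition coth_re (e u : R) : R := sinh (PI * u) * cosh (PI * u) / coth_den e u.
Definition coth_im (e u : R) : R := sin (PI * e) * cos (PI * e) / coth_den e u.
Definition dcoth_re (e u : R) : R :=
  PI * (cosh (PI * u) ^ 2 + sinh (PI * u) ^ 2) / coth_den e u
  - 2 * PI * (sinh (PI * u) * cosh (PI * u)) ^ 2 / coth_den e u ^ 2.
Definition dcoth_im (e u : R) : R :=
  - 2 * PI * (sin (PI * e) * cos (PI * e)) * (sinh (PI * u) * cosh (PI * u)) / coth_den e u ^ 2.

Lemma coth_den_pos e u : 0 < e < 1 -> 0 < coth_den e u.
Proof.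
  intros He. pose proof PI_RGT_0.
  assert (0 < sin (PI * e)) by (apply sin_gt_0; nra).
  unfold coth_den. nra.
Qed.

Lemma is_derive_coth_re_r (e u : R) : 0 < e < 1 ->
  is_derive (fun u => coth_re e u) u (dcoth_re e u).
Proof.
  intros He. pose proof (coth_den_pos e u He). unfold coth_re, dcoth_re, coth_den in *.
  auto_derive. simpl in *; lra. field. simpl in *; lra.
Qed.

Lemma is_derive_coth_im_r (e u : R) : 0 < e < 1 ->
  is_derive (fun u => coth_im e u) u (dcoth_im e u).
Proof.
  intros He. pose proof (coth_den_pos e u He). unfold coth_im, dcoth_im, coth_den in *.
  auto_derive. simpl in *; lra. field. simpl in *; lra.
Qed.

Lemma is_derive_coth_re_l (e u : R) : 0 < e < 1 ->
  is_derive (fun e => coth_re e u) e (dcoth_im e u).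
Proof.
  intros He. pose proof (coth_den_pos e u He). unfold coth_re, dcoth_im, coth_den in *.
  auto_derive. simpl in *; lra. field. simpl in *; lra.
Qed.

(** With [is_derive_coth_re_l] this expresses d/de = -i d/du for a holomorphic function of u - i e.
    Unlike its companions it is not a formal identity in sinh, cosh, sin and cos: both Pythagorean
    relations are used. *)
Lemma is_derive_coth_im_l (e u : R) : 0 < e < 1 ->
  is_derive (fun e => coth_im e u) e (- dcoth_re e u).
Proof.
  intros He. pose proof (coth_den_pos e u He). unfold coth_im, dcoth_re, coth_den in *.
  auto_derive. simpl in *; lra.
  pose proof (cosh_sq (PI * u)) as E. pose proof (sin2_cos2 (PI * e)) as E2. unfold Rsqr in E2.
  revert E E2 H. generalize (sinh (PI * u)) (cosh (PI * u)) (sin (PI * e)) (cos (PI * e)).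
  intros sh ch s c E E2 H.
  apply Rmult_eq_reg_r with ((sh ^ 2 + s ^ 2) ^ 2). 2: apply Rgt_not_eq, pow_lt; auto.
  match goal with |- _ = ?r => replace r with (- (PI * (ch ^ 2 + sh ^ 2) * (sh ^ 2 + s ^ 2) - 2 * PI * sh ^ 2 * ch ^ 2)) by (field; simpl in *; lra) end.
  match goal with |- ?l = _ => replace l with (PI * (c * c - s * s) * (sh ^ 2 + s ^ 2) - 2 * PI * (s * s) * (c * c)) by (field; simpl in *; lra) end.
  rewrite E. replace (c * c) with (1 - s * s) by lra. ring.
Qed.

Lemma is_derive_mul (f g : R -> R) x df dg : is_derive f x df -> is_derive g x dg ->
  is_derive (fun x => f x * g x) x (df * g x + f x * dg).
Proof.
  intros Hf Hg. apply (is_derive_mult f g x df dg Hf Hg). intros; apply Rmult_comm.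
Qed.

Lemma is_derive_add (f g : R -> R) x df dg : is_derive f x df -> is_derive g x dg ->
  is_derive (fun x => f x + g x) x (df + dg).
Proof. apply (is_derive_plus (V := R_NormedModule)). Qed.

Lemma is_derive_sub (f g : R -> R) x df dg : is_derive f x df -> is_derive g x dg ->
  is_derive (fun x => f x - g x) x (df - dg).
Proof. apply (is_derive_minus (V := R_NormedModule)). Qed.

Lemma is_derive_comp_add (f : R -> R) c x df : is_derive f (c + x) df ->
  is_derive (fun x => f (c + x)) x df.
Proof.
  intros H. eapply is_derive_eq. apply (is_derive_comp f (fun x => c + x) x df 1 H).
  auto_derive; auto; ring. apply Rmult_1_l.
Qed.

Lemma is_derive_comp_sub (f : R -> R) c x df : is_derive f (c - x) df ->
  is_derive (fun x => f (c - x)) x (- df).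
Proof.
  intros H. eapply is_derive_eq. apply (is_derive_comp f (fun x => c - x) x df (-1) H).
  auto_derive; auto; ring. unfold scal; simpl; unfold mult; simpl; ring.
Qed.

(* With T = coth (PI (u - i e)) and v = a + u, [contour_f] is Im (T / (w + e + i v) - conj T / (w - e + i v)) / 2 and [contour_g] is Re (T / (w + e + i v) + conj T / (w - e + i v)) / 2; by Cauchy-Riemann, [contour_df] is both the e-derivative of [contour_f] and minus the u-derivative of [contour_g]. *)
Definition contour_f (w a e u : R) : R :=
  (coth_im e u * (inv_re (w + e) (a + u) + inv_re (w - e) (a + u))
   + coth_re e u * (inv_im (w - e) (a + u) - inv_im (w + e) (a + u))) / 2.
Definition contour_g (w a e u : R) : R :=
  (coth_re e u * (inv_re (w + e) (a + u) + inv_re (w - e) (a + u))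
   + coth_im e u * (inv_im (w + e) (a + u) - inv_im (w - e) (a + u))) / 2.
Definition contour_df (w a e u : R) : R :=
  (coth_im e u * (inv_sq_re (w - e) (a + u) - inv_sq_re (w + e) (a + u))
   - dcoth_re e u * (inv_re (w + e) (a + u) + inv_re (w - e) (a + u))
   + dcoth_im e u * (inv_im (w - e) (a + u) - inv_im (w + e) (a + u))
   + coth_re e u * (inv_sq_im (w - e) (a + u) + inv_sq_im (w + e) (a + u))) / 2.

Lemma is_derive_contour_f (w a e u : R) : 0 < e < 1 -> e < w ->
  is_derive (fun e => contour_f w a e u) e (contour_df w a e u).
Proof.
  intros He Hw. unfold contour_f, contour_df, Rdiv.
  eapply is_derive_eq.
  apply is_derive_mul. 2: apply (is_derive_const (V := R_NormedModule)).
  apply is_derive_add; apply is_derive_mul.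
  apply is_derive_coth_im_l; auto.
  apply is_derive_add.
  apply (is_derive_comp_add (fun s => inv_re s (a + u))), is_derive_inv_re_l; lra.
  apply (is_derive_comp_sub (fun s => inv_re s (a + u))), is_derive_inv_re_l; lra.
  apply is_derive_coth_re_l; auto.
  apply is_derive_sub.
  apply (is_derive_comp_sub (fun s => inv_im s (a + u))), is_derive_inv_im_l; lra.
  apply (is_derive_comp_add (fun s => inv_im s (a + u))), is_derive_inv_im_l; lra.
  unfold zero; simpl. ring.
Qed.

Lemma is_derive_contour_g (w a e u : R) : 0 < e < 1 -> e < w ->
  is_derive (fun u => contour_g w a e u) u (- contour_df w a e u).
Proof.
  intros He Hw. unfold contour_g, contour_df, Rdiv.
  eapply is_derive_eq.
  apply is_derive_mul. 2: apply (is_derive_const (V := R_NormedModule)).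
  apply is_derive_add; apply is_derive_mul.
  apply is_derive_coth_re_r; auto.
  apply is_derive_add.
  apply (is_derive_comp_add (fun v => inv_re (w + e) v)), is_derive_inv_re_r; lra.
  apply (is_derive_comp_add (fun v => inv_re (w - e) v)), is_derive_inv_re_r; lra.
  apply is_derive_coth_im_r; auto.
  apply is_derive_sub.
  apply (is_derive_comp_add (fun v => inv_im (w + e) v)), is_derive_inv_im_r; lra.
  apply (is_derive_comp_add (fun v => inv_im (w - e) v)), is_derive_inv_im_r; lra.
  unfold zero; simpl. ring.
Qed.

Lemma continuity_2d_pt_pow f n x y : continuity_2d_pt f x y ->
  continuity_2d_pt (fun u v => f u v ^ n) x y.
Proof.
  intros H. induction n as [|n IH]; simpl. apply continuity_2d_pt_const.
  apply continuity_2d_pt_mult; auto.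
Qed.

Lemma continuity_2d_pt_div f g x y : continuity_2d_pt f x y -> continuity_2d_pt g x y ->
  g x y <> 0 -> continuity_2d_pt (fun u v => f u v / g u v) x y.
Proof.
  intros Hf Hg H. apply continuity_2d_pt_mult; auto. apply continuity_2d_pt_inv; auto.
Qed.

Lemma continuous_sinh x : continuous sinh x.
Proof. apply continuity_pt_filterlim, derivable_continuous_pt, derivable_pt_sinh. Qed.

Lemma continuous_cosh x : continuous cosh x.
Proof. apply continuity_pt_filterlim, derivable_continuous_pt, derivable_pt_cosh. Qed.

Ltac cont2d := repeat first
  [ apply continuity_2d_pt_const | apply continuity_2d_pt_id1 | apply continuity_2d_pt_id2
  | apply (continuity_1d_2d_pt_comp sinh); [apply continuity_pt_filterlim, continuous_sinh |]
  | apply (continuity_1d_2d_pt_comp cosh); [apply continuity_pt_filterlim, continuous_cosh |]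
  | apply (continuity_1d_2d_pt_comp sin); [apply continuity_sin |]
  | apply (continuity_1d_2d_pt_comp cos); [apply continuity_cos |]
  | apply continuity_2d_pt_plus | apply continuity_2d_pt_minus | apply continuity_2d_pt_opp
  | apply continuity_2d_pt_pow | apply continuity_2d_pt_div | apply continuity_2d_pt_mult ].

Lemma continuity_2d_pt_contour_df (w a e u : R) : 0 < e < 1 -> e < w ->
  continuity_2d_pt (contour_df w a) e u.
Proof.
  intros He Hw. pose proof (coth_den_pos e u He).
  pose proof (sum_sq_pos (w + e) (a + u) ltac:(lra)).
  pose proof (sum_sq_pos (w - e) (a + u) ltac:(lra)).
  unfold contour_df, coth_re, coth_im, dcoth_re, dcoth_im, inv_sq_re, inv_sq_im, inv_re, inv_im, coth_den in *.
  cont2d; try apply pow_nonzero; lra.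
Qed.

Lemma sinh_ge x : Rabs x <= Rabs (sinh x).
Proof.
  destruct (MVT_gen sinh 0 x cosh) as [c [_ Hc]].
  - intros y _. apply is_derive_Reals, derivable_pt_lim_sinh.
  - intros y _. apply continuity_pt_filterlim, continuous_sinh.
  - rewrite sinh_0, !Rminus_0_r in Hc. rewrite Hc, Rabs_mult.
    pose proof (cosh_ge_1 c). rewrite (Rabs_right (cosh c)) by lra.
    pose proof (Rabs_pos x). nra.
Qed.

Lemma sinh_sq_ge x : x ^ 2 <= sinh x ^ 2.
Proof.
  rewrite <- (pow2_abs x), <- (pow2_abs (sinh x)). apply pow_incr.
  split. apply Rabs_pos. apply sinh_ge.
Qed.

Lemma Rabs_div_le x y z : 0 < y -> Rabs x <= z * y -> Rabs (x / y) <= z.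
Proof.
  intros Hy H. unfold Rdiv. rewrite Rabs_mult, Rabs_inv, (Rabs_right y) by lra.
  apply Rmult_le_reg_r with y; auto. rewrite Rmult_assoc, Rinv_l; lra.
Qed.

Lemma coth_bounds e u : 0 < e < 1 -> 1 <= Rabs u ->
  Rabs (coth_re e u) <= 2 /\ Rabs (coth_im e u) <= 1.
Proof.
  intros He Hu. pose proof (coth_den_pos e u He) as Hd.
  assert (H9 : 9 <= sinh (PI * u) ^ 2).
  { eapply Rle_trans. 2: apply sinh_sq_ge. rewrite <- pow2_abs, Rabs_mult.
    pose proof PI2_3_2. rewrite (Rabs_right PI) by lra.
    assert (3 <= PI * Rabs u) by nra. nra. }
  pose proof (cosh_sq (PI * u)) as E. pose proof (sin2_cos2 (PI * e)) as E2. unfold Rsqr in E2.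
  unfold coth_re, coth_im, coth_den in *. revert E E2 H9 Hd.
  generalize (sinh (PI * u)) (cosh (PI * u)) (sin (PI * e)) (cos (PI * e)).
  intros sh ch s c E E2 H9 Hd.
  pose proof (pow2_ge_0 s).
  split; apply Rabs_div_le; auto.
  - pose proof (pow2_ge_0 (sh - ch)). pose proof (pow2_ge_0 (sh + ch)). apply Rabs_le. split; nra.
  - pose proof (pow2_ge_0 (s - c)). pose proof (pow2_ge_0 (s + c)). apply Rabs_le. split; nra.
Qed.

Lemma inv_re_im_bounds s v : 0 < s -> 1 <= Rabs v ->
  Rabs (inv_re s v) <= s / Rabs v /\ Rabs (inv_im s v) <= 1 / Rabs v.
Proof.
  intros Hs Hv. pose proof (sum_sq_pos s v Hs).
  assert (E : v ^ 2 = Rabs v * Rabs v) by (rewrite <- pow2_abs; ring).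
  unfold inv_re, inv_im. rewrite E in *. revert Hv H. generalize (Rabs_pos v).
  split; apply Rabs_div_le; auto.
  - rewrite Rabs_right by lra. apply Rmult_le_reg_r with (Rabs v). lra.
    replace (s / Rabs v * (s ^ 2 + Rabs v * Rabs v) * Rabs v) with (s * (s ^ 2 + Rabs v * Rabs v)) by (field; lra).
    apply Rmult_le_compat_l. lra. nra.
  - apply Rmult_le_reg_r with (Rabs v). lra.
    replace (1 / Rabs v * (s ^ 2 + Rabs v * Rabs v) * Rabs v) with (s ^ 2 + Rabs v * Rabs v) by (field; lra).
    nra.
Qed.

Lemma Rabs_mult_le x y a b : Rabs x <= a -> Rabs y <= b -> Rabs (x * y) <= a * b.
Proof. intros. rewrite Rabs_mult. apply Rmult_le_compat; auto; apply Rabs_pos. Qed.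

Lemma Rabs_plus_le x y a b : Rabs x <= a -> Rabs y <= b -> Rabs (x + y) <= a + b.
Proof. intros. eapply Rle_trans. apply Rabs_triang. lra. Qed.

Lemma Rabs_minus_le x y a b : Rabs x <= a -> Rabs y <= b -> Rabs (x - y) <= a + b.
Proof. intros. unfold Rminus. apply Rabs_plus_le; auto. rewrite Rabs_Ropp; auto. Qed.

(** Far from the pole the cotangent is bounded and the fractions decay like 1 / |a + u|; these
    endpoint values are all that a contour shift leaves behind. *)
Lemma contour_g_bound w a e u : 0 < e < 1 -> e < w -> 1 <= Rabs u -> 1 <= Rabs (a + u) ->
  Rabs (contour_g w a e u) <= (2 * w + 1) / Rabs (a + u).
Proof.
  intros He Hw Hu Hv. destruct (coth_bounds e u He Hu) as [B1 B2].
  destruct (inv_re_im_bounds (w + e) (a + u)) as [B3 B4]; try lra.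
  destruct (inv_re_im_bounds (w - e) (a + u)) as [B5 B6]; try lra.
  unfold contour_g. apply Rabs_div_le. lra.
  eapply Rle_trans.
  - apply Rabs_plus_le; apply Rabs_mult_le. apply B1. apply Rabs_plus_le; [apply B3 | apply B5].
    apply B2. apply Rabs_minus_le; [apply B4 | apply B6].
  - right. field. lra.
Qed.

Lemma contour_f_continuous w a e u : 0 < e < 1 -> e < w -> continuous (contour_f w a e) u.
Proof.
  intros He Hw. apply continuity_2d_pt_continuous_r.
  pose proof (coth_den_pos e u He).
  pose proof (sum_sq_pos (w + e) (a + u) ltac:(lra)).
  pose proof (sum_sq_pos (w - e) (a + u) ltac:(lra)).
  unfold contour_f, coth_re, coth_im, inv_re, inv_im, coth_den in *.
  cont2d; lra.
Qed.

Lemma locally_between (a b x : R) : a < x < b -> locally x (fun y => a < y < b).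
Proof.
  intros H. apply filter_and. apply (open_gt a x); lra. apply (open_lt b x); lra.
Qed.

(** For heights in [e, 1/2] no pole is crossed, and the integral of [contour_df] telescopes to
    endpoint values of [contour_g]. The bound is independent of [e], so it survives the limit e ->
    0. *)
Lemma contour_shift w a e A : 1 / 2 < w -> 0 < e < 1 / 2 -> 2 * Rabs a + 2 <= A ->
  Rabs (RInt (contour_f w a (1 / 2)) (- A) A - RInt (contour_f w a e) (- A) A)
  <= 2 * (2 * w + 1) / A.
Proof.
  intros Hw He HA. pose proof (Rabs_pos a).
  assert (Hder : forall x, e <= x <= 1 / 2 ->
    is_derive (fun e => RInt (contour_f w a e) (- A) A) x (RInt (contour_df w a x) (- A) A)).
  { intros x Hx.
    assert (Hm : 0 < x < Rmin 1 w) by (split; [lra | apply Rmin_glb_lt; lra]).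
    pose proof (Rmin_l 1 w). pose proof (Rmin_r 1 w).
    apply (is_derive_RInt_parameter (contour_f w a) (contour_df w a)).
    + eapply filter_imp. 2: apply (locally_between _ _ _ Hm).
      intros y Hy t. apply is_derive_contour_f; lra.
    + eapply filter_imp. 2: apply (locally_between _ _ _ Hm).
      intros y Hy t. apply contour_f_continuous; lra.
    + intros t. apply continuity_2d_pt_contour_df; lra. }
  destruct (MVT_gen (fun e => RInt (contour_f w a e) (- A) A) e (1 / 2)
    (fun e => RInt (contour_df w a e) (- A) A)) as [c [Hc Ec]].
  - intros x Hx. rewrite Rmin_left, Rmax_right in Hx by lra. apply Hder; lra.
  - intros x Hx. rewrite Rmin_left, Rmax_right in Hx by lra.
    apply continuity_pt_filterlim.
    apply (ex_derive_continuous (V := R_NormedModule) (fun e => RInt (contour_f w a e) (- A) A)).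
    eexists. apply Hder; lra.
  - rewrite Rmin_left, Rmax_right in Hc by lra. rewrite Ec.
    assert (E : RInt (contour_df w a c) (- A) A = - (contour_g w a c A - contour_g w a c (- A))).
    { apply (is_RInt_unique (V := R_CompleteNormedModule)).
      apply is_RInt_ext with (fun u => opp (- contour_df w a c u)).
      intros x _. unfold opp; simpl; ring.
      apply (is_RInt_opp (V := R_NormedModule)).
      apply (is_RInt_derive (V := R_CompleteNormedModule) (contour_g w a c)).
      - intros x _. apply is_derive_contour_g; lra.
      - intros x _. apply (continuous_opp (V := R_NormedModule)).
        apply (continuity_2d_pt_continuous_r (contour_df w a)), continuity_2d_pt_contour_df; lra. }
    rewrite E. rewrite Rmult_comm.
    (* The lower bound on [A] ensures |a + u| >= A / 2 >= 1 at both endpoints. *)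
    assert (HB : forall u, Rabs u = A -> Rabs (contour_g w a c u) <= (2 * w + 1) / (A / 2)).
    { intros u Hu. 
      assert (A / 2 <= Rabs (a + u)).
      { revert Hu H HA. unfold Rabs; repeat destruct Rcase_abs; lra. }
      eapply Rle_trans. apply contour_g_bound; lra.
      apply Rmult_le_compat_l. lra. apply Rinv_le_contravar; lra. }
    replace (2 * (2 * w + 1) / A) with (1 / 2 * ((2 * w + 1) / (A / 2) + (2 * w + 1) / (A / 2))) by (field; lra).
    apply Rabs_mult_le. rewrite Rabs_right; lra.
    rewrite Rabs_Ropp. apply Rabs_minus_le; apply HB.
    apply Rabs_right; lra. rewrite Rabs_Ropp. apply Rabs_right; lra.
Qed.

(** An antiderivative is atan (tanh (pi u) cot (pi e)) / pi. Over the whole line the mass is 1 - 2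
    e, which tends to 1 with e -> 0: the kernel is an approximate identity. *)
Lemma is_RInt_coth_im e A : 0 < e < 1 -> 
  is_RInt (coth_im e) (- A) A
    (2 / PI * atan (sinh (PI * A) / cosh (PI * A) * (cos (PI * e) / sin (PI * e)))).
Proof.
  intros He. pose proof PI_RGT_0.
  assert (Hs : 0 < sin (PI * e)) by (apply sin_gt_0; nra).
  pose (F := fun u => / PI * atan (sinh (PI * u) / cosh (PI * u) * (cos (PI * e) / sin (PI * e)))).
  replace (2 / PI * atan (sinh (PI * A) / cosh (PI * A) * (cos (PI * e) / sin (PI * e))))
    with (minus (F A) (F (- A))).
  - apply (is_RInt_derive (V := R_CompleteNormedModule) F).
    + intros x _. unfold F, coth_im, coth_den. pose proof (cosh_pos (PI * x)).
      auto_derive. lra.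
      pose proof (cosh_sq (PI * x)) as E. pose proof (sin2_cos2 (PI * e)) as E2. unfold Rsqr in E2.
      revert E E2 Hs H0. generalize (sinh (PI * x)) (cosh (PI * x)) (sin (PI * e)) (cos (PI * e)).
      intros sh ch s c E E2 Hs Hch.
      assert (Hq : 0 < sh ^ 2 + s ^ 2) by nra.
      assert (E3 : s * s * (ch * ch) + sh * sh * (c * c) = sh ^ 2 + s ^ 2).
      { replace (ch * ch) with (1 + sh ^ 2) by lra. replace (c * c) with (1 - s * s) by lra. ring. }
      assert (E4 : 1 * ch * ch - sh * (1 * sh) = 1) by lra.
      replace (PI * 1 * ch * / ch + sh * (- (PI * 1 * sh) * / (ch * ch))) with (PI / (ch * ch)).
      2: { transitivity (PI * (1 * ch * ch - sh * (1 * sh)) / (ch * ch)). rewrite E4; field; lra. field; lra. }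
      replace (1 + sh * / ch * (c / s) * (sh * / ch * (c / s) * 1))
        with ((sh ^ 2 + s ^ 2) / (s * s * (ch * ch))).
      2: { rewrite <- E3. field; lra. }
      field. simpl in *; lra.
    + intros x _. apply (continuity_2d_pt_continuous_r coth_im).
      pose proof (coth_den_pos e x He). unfold coth_im, coth_den in *. cont2d; lra.
  - unfold F, minus, plus, opp; simpl. replace (PI * - A) with (- (PI * A)) by ring.
    rewrite sinh_opp, cosh_opp. 
    replace (- sinh (PI * A) / cosh (PI * A) * (cos (PI * e) / sin (PI * e))) with
     (- (sinh (PI * A) / cosh (PI * A) * (cos (PI * e) / sin (PI * e)))).
    rewrite atan_opp. field. lra. unfold Rdiv; ring.
Qed.

Lemma cos_ge_half x : 0 <= x <= 1 -> 1 / 2 <= cos x.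
Proof.
  intros Hx. replace x with (2 * (x / 2)) by field. rewrite cos_2a_sin.
  destruct (Req_dec x 0) as [->|Hn]. replace (0 / 2) with 0 by field. rewrite sin_0. lra.
  pose proof (sin_lt_x (x / 2) ltac:(lra)). pose proof PI2_3_2.
  assert (0 <= sin (x / 2)) by (apply sin_ge_0; lra). nra.
Qed.

Lemma sin_ge_half x : 0 <= x <= 1 -> x / 2 <= sin x.
Proof.
  intros Hx. destruct (MVT_gen sin 0 x cos) as [c [Hc Ec]].
  - intros y _. apply is_derive_Reals, derivable_pt_lim_sin.
  - intros y _. apply continuity_sin.
  - rewrite Rmin_left, Rmax_right in Hc by lra. rewrite sin_0, !Rminus_0_r in Ec.
    rewrite Ec. pose proof (cos_ge_half c ltac:(lra)). nra.
Qed.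

Lemma trig_small e : 0 < e <= 1 / 4 ->
  e <= sin (PI * e) <= 4 * e /\ 1 / 2 <= cos (PI * e) <= 1.
Proof.
  intros He. pose proof PI2_3_2. pose proof PI_4.
  assert (0 < PI * e <= 1) by nra.
  pose proof (sin_ge_half (PI * e) ltac:(lra)). pose proof (sin_lt_x (PI * e) ltac:(lra)).
  pose proof (cos_ge_half (PI * e) ltac:(lra)). pose proof (COS_bound (PI * e)).
  repeat split; nra.
Qed.

(** The constant 16: tanh (pi A) >= 1/2 and cot (pi e) >= 1 / (8 e) put the argument of atan above 1
    / (16 e), so atan misses pi / 2 by at most 16 e, and 2 / pi <= 1. *)
Lemma RInt_coth_im e A : 0 < e <= 1 / 4 -> 1 <= A ->
  1 - 16 * e <= RInt (coth_im e) (- A) A <= 1.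
Proof.
  intros He HA. rewrite (is_RInt_unique (V := R_CompleteNormedModule) _ _ _ _ (is_RInt_coth_im e A ltac:(lra))).
  destruct (trig_small e He) as [Hs Hc]. pose proof PI2_3_2.
  set (y := sinh (PI * A) / cosh (PI * A) * (cos (PI * e) / sin (PI * e))).
  assert (Ht : 1 / 2 <= sinh (PI * A) / cosh (PI * A)).
  { pose proof (tanh_bound (PI * A) ltac:(nra)) as Hb.
    assert (2 / (PI * A) <= 1 / 2 + 1 / 6).
    { apply Rmult_le_reg_r with (PI * A). nra. unfold Rdiv at 1. rewrite Rmult_assoc, Rinv_l; nra. }
    pose proof (cosh_sq (PI * A)). pose proof (sinh_sq_ge (PI * A)). pose proof (cosh_pos (PI * A)).
    assert (0 <= sinh (PI * A)).
    { rewrite <- sinh_0. left. apply sinh_lt. nra. }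
    apply Rmult_le_reg_r with (cosh (PI * A)); auto.
    unfold Rdiv at 2. rewrite Rmult_assoc, Rinv_l, Rmult_1_r by lra.
    assert (9 <= (PI * A) ^ 2) by (assert (3 <= PI * A) by nra; nra). nra. }
  assert (Hcs : 1 / (8 * e) <= cos (PI * e) / sin (PI * e)).
  { apply Rmult_le_reg_r with (8 * e * sin (PI * e)). nra.
    replace (1 / (8 * e) * (8 * e * sin (PI * e))) with (sin (PI * e)) by (field; lra).
    replace (cos (PI * e) / sin (PI * e) * (8 * e * sin (PI * e))) with (8 * e * cos (PI * e)) by (field; lra).
    nra. }
  assert (He0 : 0 < 1 / (8 * e)) by (apply Rdiv_lt_0_compat; lra).
  assert (Hy : 1 / (16 * e) <= y).
  { unfold y. replace (1 / (16 * e)) with (1 / 2 * (1 / (8 * e))) by (field; lra).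
    apply Rmult_le_compat; lra. }
  assert (Hy0 : 0 < 1 / (16 * e)) by (apply Rdiv_lt_0_compat; lra).
  pose proof (atan_tail y ltac:(lra)). pose proof (atan_bound y).
  assert (/ y <= 16 * e).
  { replace (16 * e) with (/ (1 / (16 * e))) by (field; lra). apply Rinv_le_contravar; auto. }
  split.
  - replace (1 - 16 * e) with (2 / PI * (PI / 2 - 8 * PI * e)) by (field; lra).
    apply Rmult_le_compat_l. left; apply Rdiv_lt_0_compat; lra. nra.
  - replace 1 with (2 / PI * (PI / 2)) by (field; lra).
    apply Rmult_le_compat_l. left; apply Rdiv_lt_0_compat; lra. lra.
Qed.

(** The threshold 1/4 is what w - e exceeds when w > 1/2 and e <= 1/4; the partial derivatives are
    then at most (1/4)^(-2) = 16. *)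
Lemma inv_re_lipschitz w a s v : 1 / 4 <= w -> 1 / 4 <= s ->
  Rabs (inv_re s v - inv_re w a) <= 16 * (Rabs (s - w) + Rabs (v - a)).
Proof.
  intros Hw Hs.
  assert (HB : forall x, 1 / 4 <= x -> / x ^ 2 <= 16).
  { intros x Hx. replace 16 with (/ (1 / 4) ^ 2) by field. apply Rinv_le_contravar; nra. }
  replace (inv_re s v - inv_re w a) with ((inv_re s v - inv_re w v) + (inv_re w v - inv_re w a)) by ring.
  rewrite Rmult_plus_distr_l. apply Rabs_plus_le.
  - destruct (MVT_gen (fun s => inv_re s v) w s (fun s => - inv_sq_re s v)) as [c [Hc Ec]].
    + intros x Hx. apply is_derive_inv_re_l. revert Hx. unfold Rmin; destruct Rle_dec; lra.
    + intros x Hx. apply continuity_pt_filterlim.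
      apply (ex_derive_continuous (V := R_NormedModule) (fun s => inv_re s v)).
      eexists. apply is_derive_inv_re_l. revert Hx. unfold Rmin; destruct Rle_dec; lra.
    + rewrite Ec, Rabs_mult. apply Rmult_le_compat_r. apply Rabs_pos. rewrite Rabs_Ropp.
      assert (1 / 4 <= c) by (revert Hc; unfold Rmin; destruct Rle_dec; lra).
      eapply Rle_trans. apply (inv_sq_bounds c v). lra. auto.
  - apply (lipschitz_of_derive (fun v => inv_re w v) (fun v => - inv_sq_im w v)).
    intros x. apply is_derive_inv_re_r; lra.
    intros x. rewrite Rabs_Ropp. eapply Rle_trans. apply (inv_sq_bounds w x). lra. auto.
Qed.

Lemma inv_im_lipschitz s s' v : 1 / 4 <= s' -> 1 / 4 <= s ->
  Rabs (inv_im s v - inv_im s' v) <= 16 * Rabs (s - s').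
Proof.
  intros Hw Hs.
  assert (HB : forall x, 1 / 4 <= x -> / x ^ 2 <= 16).
  { intros x Hx. replace 16 with (/ (1 / 4) ^ 2) by field. apply Rinv_le_contravar; nra. }
  destruct (MVT_gen (fun s => inv_im s v) s' s (fun s => - inv_sq_im s v)) as [c [Hc Ec]].
  + intros x Hx. apply is_derive_inv_im_l. revert Hx. unfold Rmin; destruct Rle_dec; lra.
  + intros x Hx. apply continuity_pt_filterlim.
    apply (ex_derive_continuous (V := R_NormedModule) (fun s => inv_im s v)).
    eexists. apply is_derive_inv_im_l. revert Hx. unfold Rmin; destruct Rle_dec; lra.
  + rewrite Ec, Rabs_mult. apply Rmult_le_compat_r. apply Rabs_pos. rewrite Rabs_Ropp.
    assert (1 / 4 <= c) by (revert Hc; unfold Rmin; destruct Rle_dec; lra).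
    eapply Rle_trans. apply (inv_sq_bounds c v). lra. auto.
Qed.

(** A factor |x| near the peak is traded for a small multiple [t] of the peak plus x^2 / t, where
    the square cancels the denominator of the cotangent and leaves a factor e. *)
Lemma amgm_split x t : 0 < t -> Rabs x <= t + x ^ 2 / t.
Proof.
  intros Ht. apply Rmult_le_reg_r with t; auto.
  replace ((t + x ^ 2 / t) * t) with (t ^ 2 + x ^ 2) by (field; lra).
  rewrite <- (pow2_abs x). pose proof (pow2_ge_0 (t - Rabs x)). pose proof (Rabs_pos x). nra.
Qed.

Lemma cosh_le_exp x A : Rabs x <= A -> cosh x <= exp A.
Proof.
  intros H. assert (Hle : forall y, y <= A -> exp y <= exp A).
  { intros y Hy. destruct (Req_dec y A) as [->|]. lra. left; apply exp_increasing; lra. }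
  pose proof (Hle x). pose proof (Hle (- x)). unfold cosh.
  revert H. unfold Rabs; destruct Rcase_abs; lra.
Qed.

Lemma coth_im_nonneg e u : 0 < e <= 1 / 4 -> 0 <= coth_im e u.
Proof.
  intros He. destruct (trig_small e He) as [Hs Hc]. pose proof (coth_den_pos e u ltac:(lra)).
  unfold coth_im. apply Rmult_le_pos. apply Rmult_le_pos; lra. left; apply Rinv_0_lt_compat; auto.
Qed.

(* As e -> 0 the imaginary part of coth tends to a Dirac mass at 0; the odd real part only contributes through a difference of size O(e), and [amgm_split] absorbs its 1/u singularity. *)
Lemma contour_f_near_delta w a e u A t : 1 / 2 < w -> 0 < e <= 1 / 4 -> 0 < t -> Rabs u <= A ->
  Rabs (contour_f w a e u - inv_re w a * coth_im e u)
  <= 16 * (e + t + 2 * exp (PI * A) * t) * coth_im e u + 16 * (4 + exp (PI * A)) * e / t.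
Proof.
  intros Hw He Ht Hu. set (H := exp (PI * A)).
  pose proof (coth_im_nonneg e u He) as HS.
  destruct (trig_small e He) as [Hs Hc]. pose proof (coth_den_pos e u ltac:(lra)) as Hq.
  pose proof PI2_3_2 as Hpi.
  (* As u^2 <= [coth_den e u], the peak times u^2 is at most sin (pi e) cos (pi e) <= 4 e. *)
  assert (HSu : coth_im e u * Rabs u <= t * coth_im e u + 4 * e / t).
  { apply Rle_trans with (coth_im e u * (t + u ^ 2 / t)).
    apply Rmult_le_compat_l; auto. apply amgm_split; auto.
    assert (coth_im e u * u ^ 2 <= 4 * e).
    { unfold coth_im. apply Rmult_le_reg_r with (coth_den e u); auto.
      replace (sin (PI * e) * cos (PI * e) / coth_den e u * u ^ 2 * coth_den e u) with
        (sin (PI * e) * cos (PI * e) * u ^ 2) by (field; lra).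
      assert (u ^ 2 <= coth_den e u).
      { unfold coth_den. pose proof (sinh_sq_ge (PI * u)). pose proof (pow2_ge_0 (sin (PI * e))).
        assert (u ^ 2 <= (PI * u) ^ 2) by (rewrite Rpow_mult_distr; assert (1 <= PI ^ 2) by nra; pose proof (pow2_ge_0 u); nra). lra. }
      pose proof (pow2_ge_0 u). apply Rmult_le_compat; auto; nra. }
    replace (coth_im e u * (t + u ^ 2 / t)) with (t * coth_im e u + coth_im e u * u ^ 2 / t) by (field; lra).
    apply Rplus_le_compat_l, Rmult_le_compat_r; auto. left; apply Rinv_0_lt_compat; auto. }
  (* Here sinh (pi u) is split instead of u; the part t e / [coth_den e u] is absorbed by the peak
     because e <= 2 sin (pi e) cos (pi e). *)
  assert (HRe : Rabs (coth_re e u) * e <= H * (2 * t * coth_im e u + e / t)).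
  { assert (Hch : cosh (PI * u) <= H).
    { apply cosh_le_exp. rewrite Rabs_mult, Rabs_right by lra. apply Rmult_le_compat_l; lra. }
    pose proof (cosh_pos (PI * u)).
    unfold coth_re, Rdiv. rewrite !Rabs_mult, Rabs_inv, (Rabs_right (cosh _)), (Rabs_right (coth_den _ _)) by lra.
    apply Rle_trans with (H * (Rabs (sinh (PI * u)) * e / coth_den e u)).
    { replace (Rabs (sinh (PI * u)) * cosh (PI * u) * / coth_den e u * e) with
      (cosh (PI * u) * (Rabs (sinh (PI * u)) * e / coth_den e u)) by (field; lra).
      apply Rmult_le_compat_r; auto. apply Rmult_le_pos. apply Rmult_le_pos. apply Rabs_pos. lra.
      left; apply Rinv_0_lt_compat; auto. }
    apply Rmult_le_compat_l. lra.
    apply Rmult_le_reg_r with (coth_den e u); auto.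
    replace (Rabs (sinh (PI * u)) * e / coth_den e u * coth_den e u) with (Rabs (sinh (PI * u)) * e) by (field; lra).
    unfold coth_im.
    replace ((2 * t * (sin (PI * e) * cos (PI * e) / coth_den e u) + e * / t) * coth_den e u) with
      (t * (2 * (sin (PI * e) * cos (PI * e))) + coth_den e u / t * e) by (field; lra).
    apply Rle_trans with ((t + sinh (PI * u) ^ 2 / t) * e).
    apply Rmult_le_compat_r. lra. apply amgm_split; auto.
    rewrite Rmult_plus_distr_r. apply Rplus_le_compat.
    apply Rmult_le_compat_l; nra.
    apply Rmult_le_compat_r. lra. apply Rmult_le_compat_r. left; apply Rinv_0_lt_compat; auto.
    unfold coth_den. pose proof (pow2_ge_0 (sin (PI * e))). lra. }
  set (S := coth_im e u) in *. set (Q := coth_re e u) in *.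
  assert (B1 : Rabs (inv_re (w + e) (a + u) - inv_re w a) <= 16 * (e + Rabs u)).
  { eapply Rle_trans. apply inv_re_lipschitz; lra.
    replace (w + e - w) with e by ring. replace (a + u - a) with u by ring.
    rewrite (Rabs_right e); lra. }
  assert (B2 : Rabs (inv_re (w - e) (a + u) - inv_re w a) <= 16 * (e + Rabs u)).
  { eapply Rle_trans. apply inv_re_lipschitz; lra.
    replace (w - e - w) with (- e) by ring. replace (a + u - a) with u by ring.
    rewrite Rabs_Ropp, (Rabs_right e); lra. }
  assert (B3 : Rabs (inv_im (w - e) (a + u) - inv_im (w + e) (a + u)) <= 32 * e).
  { eapply Rle_trans. apply inv_im_lipschitz; lra.
    replace (w - e - (w + e)) with (- (2 * e)) by ring. rewrite Rabs_Ropp, Rabs_right; lra. }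
  replace (contour_f w a e u - inv_re w a * S) with
    ((S * ((inv_re (w + e) (a + u) - inv_re w a) + (inv_re (w - e) (a + u) - inv_re w a))
     + Q * (inv_im (w - e) (a + u) - inv_im (w + e) (a + u))) / 2) by (unfold contour_f; fold S Q; field).
  apply Rabs_div_le. lra.
  eapply Rle_trans.
  - apply Rabs_plus_le; apply Rabs_mult_le. apply Rle_refl. apply Rabs_plus_le; [apply B1 | apply B2].
    apply Rle_refl. apply B3.
  - rewrite (Rabs_right S) by lra. 
    replace (16 * (4 + H) * e / t) with (16 * (4 * e / t) + 16 * (H * (e / t))) by (field; lra).
    lra.
Qed.

(** In a fixed window, letting e -> 0 evaluates the integral near height zero at the point mass;
    only the error of the shift remains. *)
Lemma contour_limit w a A : 1 / 2 < w -> 2 * Rabs a + 2 <= A ->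
  Rabs (RInt (contour_f w a (1 / 2)) (- A) A - inv_re w a) <= 2 * (2 * w + 1) / A.
Proof.
  intros Hw HA. pose proof (Rabs_pos a) as Ha. apply le_epsilon. intros eps Heps.
  set (H := exp (PI * A)). assert (HH : 0 < H) by apply exp_pos.
  (* The order of choice matters: [t] makes 16 (t + 2 H t) equal to eps / 2, and only then is [e]
     taken so small that all terms proportional to it, collected in e * K, stay below eps / 2. *)
  set (t := eps / 2 / (16 * (1 + 2 * H))).
  assert (Ht : 0 < t) by (apply Rdiv_lt_0_compat; lra).
  set (K := 16 + 32 * A * (4 + H) / t + 16 * Rabs (inv_re w a)).
  assert (HK : 0 < K).
  { unfold K. pose proof (Rabs_pos (inv_re w a)).
    assert (0 < 32 * A * (4 + H) / t) by (apply Rdiv_lt_0_compat; nra). lra. }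
  set (e := Rmin (1 / 4) (eps / 2 / K)).
  assert (He0 : 0 < eps / 2 / K) by (apply Rdiv_lt_0_compat; lra).
  assert (He : 0 < e <= 1 / 4).
  { split. apply Rmin_glb_lt; lra. apply Rmin_l. }
  assert (HeK : e * K <= eps / 2).
  { apply Rle_trans with (eps / 2 / K * K). apply Rmult_le_compat_r. lra. apply Rmin_r. right; field; lra. }
  pose proof (contour_shift w a e A Hw ltac:(lra) HA) as H1.
  pose proof (RInt_coth_im e A He ltac:(lra)) as HS.
  assert (HcS : forall u, continuous (coth_im e) u).
  { intros u. apply (continuity_2d_pt_continuous_r coth_im).
    pose proof (coth_den_pos e u ltac:(lra)). unfold coth_im, coth_den in *. cont2d; lra. }
  assert (H2 : Rabs (RInt (contour_f w a e) (- A) A - inv_re w a * RInt (coth_im e) (- A) A)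
    <= 16 * (e + t + 2 * H * t) * RInt (coth_im e) (- A) A + 2 * A * (16 * (4 + H) * e / t)).
  { rewrite <- (RInt_scal (V := R_CompleteNormedModule) (coth_im e) _ _ (inv_re w a)) by (apply continuous_ex_RInt; auto).
    eapply Rle_trans.
    apply RInt_minus_le with (h := fun u => 16 * (e + t + 2 * H * t) * coth_im e u + 16 * (4 + H) * e / t).
    - lra.
    - intros; apply contour_f_continuous; lra.
    - intros. apply (continuous_scal_r (V := R_NormedModule)); auto.
    - intros. apply (continuous_plus (V := R_NormedModule)).
      apply (continuous_scal_r (V := R_NormedModule)); auto. apply continuous_const.
    - intros u Hu. apply contour_f_near_delta; auto. apply Rabs_le; lra.
    - right. apply (is_RInt_unique (V := R_CompleteNormedModule)).
      apply (is_RInt_plus (V := R_NormedModule) (fun u => 16 * (e + t + 2 * H * t) * coth_im e u)).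
      apply (is_RInt_scal (V := R_NormedModule)).
      apply (RInt_correct (V := R_CompleteNormedModule)), continuous_ex_RInt; auto.
      replace (2 * A * (16 * (4 + H) * e / t)) with (scal (A - - A) (16 * (4 + H) * e / t)).
      apply (is_RInt_const (V := R_NormedModule)). 
      unfold scal; simpl; unfold mult; simpl. ring. }
  assert (H3 : Rabs (inv_re w a * RInt (coth_im e) (- A) A - inv_re w a) <= Rabs (inv_re w a) * (16 * e)).
  { replace (inv_re w a * RInt (coth_im e) (- A) A - inv_re w a) with
      (inv_re w a * (RInt (coth_im e) (- A) A - 1)) by ring.
    apply Rabs_mult_le. lra. apply Rabs_le; lra. }
  assert (H4 : 16 * (e + t + 2 * H * t) * RInt (coth_im e) (- A) A <= 16 * (e + t + 2 * H * t)).
  { rewrite <- (Rmult_1_r (16 * (e + t + 2 * H * t))) at 2. apply Rmult_le_compat_l.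
    assert (0 < H * t) by (apply Rmult_lt_0_compat; auto). lra. lra. }
  assert (H5 : 16 * (t + 2 * H * t) = eps / 2).
  { unfold t. field. lra. }
  assert (H6 : e * K = 16 * e + 2 * A * (16 * (4 + H) * e / t) + Rabs (inv_re w a) * (16 * e)).
  { unfold K. field. lra. }
  replace (RInt (contour_f w a (1 / 2)) (- A) A - inv_re w a) with
    ((RInt (contour_f w a (1 / 2)) (- A) A - RInt (contour_f w a e) (- A) A)
     + ((RInt (contour_f w a e) (- A) A - inv_re w a * RInt (coth_im e) (- A) A)
       + (inv_re w a * RInt (coth_im e) (- A) A - inv_re w a))) by ring.
  eapply Rle_trans.
  - apply Rabs_plus_le. apply H1. apply Rabs_plus_le. apply H2. apply H3.
  - lra.
Qed.

(** * The difference equation of the logarithmic potential *)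

Definition log_step (w v : R) : R := logmod (w + 1 / 2) v - logmod (w - 1 / 2) v.

Lemma continuous_logmod (s v : R) : 0 < s -> continuous (logmod s) v.
Proof.
  intros Hs. apply (ex_derive_continuous (V := R_NormedModule) (logmod s)).
  eexists. apply is_derive_logmod_r; auto.
Qed.

Lemma continuous_log_step (w v : R) : 1 / 2 < w -> continuous (log_step w) v.
Proof. intros Hw. apply (continuous_minus (V := R_NormedModule)); apply continuous_logmod; lra. Qed.

Lemma ln_le_sub_1 x : 0 < x -> ln x <= x - 1.
Proof. intros Hx. pose proof (exp_ineq1_le (ln x)). rewrite exp_ln in H; lra. Qed.

(** The upper bound is ln q <= q - 1 for the quotient q of the squared moduli, whose difference is 2
    w. *)
Lemma log_step_bounds w v : 1 / 2 < w -> 0 <= log_step w v <= w / ((w - 1 / 2) ^ 2 + v ^ 2).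
Proof.
  intros Hw. pose proof (sum_sq_pos (w - 1 / 2) v ltac:(lra)) as H2.
  pose proof (sum_sq_pos (w + 1 / 2) v ltac:(lra)) as H1.
  unfold log_step, logmod. split.
  - assert (ln ((w - 1 / 2) ^ 2 + v ^ 2) <= ln ((w + 1 / 2) ^ 2 + v ^ 2)).
    { apply ln_le; auto. nra. }
    lra.
  - replace (ln ((w + 1 / 2) ^ 2 + v ^ 2) / 2 - ln ((w - 1 / 2) ^ 2 + v ^ 2) / 2) with
      (ln (((w + 1 / 2) ^ 2 + v ^ 2) / ((w - 1 / 2) ^ 2 + v ^ 2)) / 2).
    + pose proof (ln_le_sub_1 (((w + 1 / 2) ^ 2 + v ^ 2) / ((w - 1 / 2) ^ 2 + v ^ 2))
        ltac:(apply Rdiv_lt_0_compat; auto)).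
      replace (w / ((w - 1 / 2) ^ 2 + v ^ 2)) with
        ((((w + 1 / 2) ^ 2 + v ^ 2) / ((w - 1 / 2) ^ 2 + v ^ 2) - 1) / 2) by (field; simpl in *; lra).
      lra.
    + rewrite ln_div by auto. field.
Qed.

Lemma log_step_bounded w v : 1 / 2 < w -> Rabs (log_step w v) <= w / (w - 1 / 2) ^ 2.
Proof.
  intros Hw. pose proof (log_step_bounds w v Hw). rewrite Rabs_right by lra.
  eapply Rle_trans. apply H. apply Rmult_le_compat_l. lra. apply Rinv_le_contravar.
  apply pow_lt; lra. pose proof (pow2_ge_0 v). lra.
Qed.

(** At this height the cotangent is the real function tanh. The result is the integrand left, sign
    included, by integrating [log_step] against rho_1 by parts. *)
Lemma contour_f_half w a u : contour_f w a (1 / 2) u =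
  - (sinh (PI * u) / cosh (PI * u) / 2 * (inv_im (w + 1 / 2) (a + u) - inv_im (w - 1 / 2) (a + u))).
Proof.
  unfold contour_f, coth_re, coth_im, coth_den.
  replace (PI * (1 / 2)) with (PI / 2) by field. rewrite cos_PI2, sin_PI2.
  replace (sinh (PI * u) ^ 2 + 1 ^ 2) with (cosh (PI * u) ^ 2) by (rewrite cosh_sq; ring).
  pose proof (cosh_pos (PI * u)). field. lra.
Qed.

Lemma intR_log_step_rho1 (w a : R) : 1 / 2 < w ->
  intR (fun u => log_step w (a + u) * rho1 u) = inv_re w a.
Proof.
  intros Hw.
  assert (Hc : forall u, continuous (fun u => log_step w (a + u)) u).
  { intros u. apply (continuous_comp (fun u => a + u) (log_step w)).
    apply (continuous_plus (V := R_NormedModule)). apply continuous_const. apply continuous_id.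
    apply continuous_log_step; auto. }
  destruct (rapid_decay_dominated_bounded rho1 (fun u => log_step w (a + u)) (w / (w - 1 / 2) ^ 2)
    rapid_decay_rho1 Hc) as [C HC].
  { intros x. apply log_step_bounded; auto. }
  apply intR_unique with C; auto.
  (* The rate adds the error of [contour_limit] and w / A for each of the two boundary values of the
     integration by parts. *)
  apply is_lim_of_inv_bound with (2 * (2 * w + 1) + 2 * w) (2 * Rabs a + 2).
  intros A HA. pose proof (Rabs_pos a).
  pose (F := fun u => sinh (PI * u) / cosh (PI * u) / 2 * log_step w (a + u)).
  assert (HF : RInt (fun u => log_step w (a + u) * rho1 u) (- A) A =
    F A - F (- A) + RInt (contour_f w a (1 / 2)) (- A) A).
  { apply (is_RInt_unique (V := R_CompleteNormedModule)).
    apply is_RInt_ext with (fun u => (log_step w (a + u) * rho1 u - contour_f w a (1 / 2) u) + contour_f w a (1 / 2) u).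
    { intros x _. unfold Rminus. rewrite Rplus_assoc, Rplus_opp_l. apply Rplus_0_r. }
    apply (is_RInt_plus (V := R_NormedModule)).
    2: { apply (RInt_correct (V := R_CompleteNormedModule)), continuous_ex_RInt.
         intros; apply contour_f_continuous; lra. }
    apply (is_RInt_derive (V := R_CompleteNormedModule) F).
    - intros x _. unfold F. eapply is_derive_eq.
      apply is_derive_mul. apply is_derive_half_tanh.
      apply (is_derive_comp_add (log_step w)). unfold log_step.
      apply is_derive_sub; apply is_derive_logmod_r; lra.
      rewrite contour_f_half. ring.
    - intros x _. apply (continuous_minus (V := R_NormedModule)). apply HC.
      apply contour_f_continuous; lra. }
  rewrite HF.
  assert (HB : forall u, Rabs u = A -> Rabs (F u) <= w / A).
  { intros u Hu. unfold F.
    assert (A / 2 <= Rabs (a + u)).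
    { revert Hu H HA. unfold Rabs; repeat destruct Rcase_abs; lra. }
    pose proof (log_step_bounds w (a + u) Hw) as HD.
    apply Rle_trans with (1 / 2 * (2 * w / A)). 2: right; field; lra.
    apply Rabs_mult_le.
    - pose proof (cosh_pos (PI * u)). pose proof (cosh_sq (PI * u)).
      apply Rabs_div_le. lra. apply Rabs_div_le. auto.
      apply Rabs_le. split; nra.
    - rewrite Rabs_right by lra. eapply Rle_trans. apply HD.
      replace (2 * w / A) with (w / (A / 2)) by (field; lra).
      apply Rmult_le_compat_l. lra. apply Rinv_le_contravar. lra.
      rewrite <- (pow2_abs (a + u)). pose proof (pow2_ge_0 (w - 1 / 2)). nra. }
  replace ((2 * (2 * w + 1) + 2 * w) / A) with ((w / A + w / A) + 2 * (2 * w + 1) / A) by (field; lra).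
  replace (F A - F (- A) + RInt (contour_f w a (1 / 2)) (- A) A - inv_re w a) with
    ((F A - F (- A)) + (RInt (contour_f w a (1 / 2)) (- A) A - inv_re w a)) by ring.
  apply Rabs_plus_le. apply Rabs_minus_le; apply HB.
  apply Rabs_right; lra. rewrite Rabs_Ropp. apply Rabs_right; lra.
  apply contour_limit; lra.
Qed.

Lemma intR_log_step_shifted (w s : R) : 1 / 2 < w ->
  intR (fun u => log_step w u * rho1 (u - s)) = inv_re w s.
Proof.
  intros Hw.
  destruct (rapid_decay_dominated_bounded rho1 (fun u => log_step w (s + u)) (w / (w - 1 / 2) ^ 2)
    rapid_decay_rho1) as [C HC].
  { intros u. apply (continuous_comp (fun u => s + u) (log_step w)).
    apply (continuous_plus (V := R_NormedModule)). apply continuous_const. apply continuous_id.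
    apply continuous_log_step; auto. }
  { intros x. apply log_step_bounded; auto. }
  rewrite <- (intR_log_step_rho1 w s Hw), <- (intR_shift _ _ (- s) HC).
  symmetry. eapply intR_ext. apply (dominated_shift _ _ (- s) HC).
  intros u. simpl. f_equal. f_equal. ring.
Qed.

(** This is F_(n+1) of the overview, since [rhoS] is indexed from zero. *)
Definition log_potential (n : nat) (w : R) : R := intR (fun u => logmod w u * rhoS n u).

Lemma logmod_bound (w u : R) : 0 < w -> Rabs (logmod w u) <= (w ^ 2 + / w ^ 2 + 1) * (1 + u ^ 2).
Proof.
  intros Hw. pose proof (sum_sq_pos w u Hw) as H. unfold logmod.
  assert (H1 : / (w ^ 2 + u ^ 2) <= / w ^ 2).
  { apply Rinv_le_contravar. apply pow_lt; auto. pose proof (pow2_ge_0 u). lra. }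
  pose proof (ln_le_sub_1 _ H).
  pose proof (ln_le_sub_1 _ (Rinv_0_lt_compat _ H)) as H2. rewrite ln_Rinv in H2 by auto.
  pose proof (pow2_ge_0 u). pose proof (pow2_ge_0 w).
  assert (0 < / w ^ 2) by (apply Rinv_0_lt_compat, pow_lt; auto).
  assert (0 <= / w ^ 2 * u ^ 2) by (apply Rmult_le_pos; lra).
  assert (0 <= w ^ 2 * u ^ 2) by (apply Rmult_le_pos; lra).
  apply Rabs_le. split; nra.
Qed.

Lemma logmod_rhoS_dominated n w : 0 < w -> exists C, dominated (fun u => logmod w u * rhoS n u) C.
Proof.
  intros Hw. apply rapid_decay_dominated with (w ^ 2 + / w ^ 2 + 1) 1%nat.
  apply rapid_decay_rhoS. intros; apply continuous_logmod; auto.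
  intros u. rewrite pow_1. apply logmod_bound; auto.
Qed.

Lemma log_potential_step n w : 1 / 2 < w ->
  log_potential n (w + 1 / 2) - log_potential n (w - 1 / 2) =
  intR (fun u => log_step w u * rhoS n u).
Proof.
  intros Hw. destruct (logmod_rhoS_dominated n (w + 1 / 2)) as [C HC]. lra.
  destruct (logmod_rhoS_dominated n (w - 1 / 2)) as [D HD]. lra.
  unfold log_potential. rewrite <- (intR_minus _ _ _ _ HC HD).
  eapply intR_ext. apply (dominated_minus _ _ _ _ HC HD).
  intros u. unfold log_step. ring.
Qed.

Lemma log_potential_step_0 w : 1 / 2 < w ->
  log_potential 0 (w + 1 / 2) - log_potential 0 (w - 1 / 2) = / w.
Proof.
  intros Hw. rewrite log_potential_step by auto.
  transitivity (inv_re w 0). 2: unfold inv_re; field; lra.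
  rewrite <- intR_log_step_shifted by auto.
  destruct (rapid_decay_dominated_bounded rho1 (log_step w) (w / (w - 1 / 2) ^ 2)
    rapid_decay_rho1) as [C HC].
  intros; apply continuous_log_step; auto. intros; apply log_step_bounded; auto.
  apply intR_ext with C; auto. intros u. rewrite Rminus_0_r. reflexivity.
Qed.

Lemma continuous_inv_re (s v : R) : 0 < s -> continuous (inv_re s) v.
Proof.
  intros Hs. apply (ex_derive_continuous (V := R_NormedModule) (inv_re s)).
  eexists. apply is_derive_inv_re_r; auto.
Qed.

(** Adjointness moves one factor rho_1 onto [log_step], where it yields Re (1 / (w + i u)). The
    right-hand side is the derivative of [log_potential n] at w. *)
Lemma log_potential_step_S n w : 1 / 2 < w ->
  log_potential (S n) (w + 1 / 2) - log_potential (S n) (w - 1 / 2) =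
  intR (fun u => rhoS n u * inv_re w u).
Proof.
  intros Hw. rewrite log_potential_step by auto.
  apply (intR_convol_swap (rhoS n) rho1 (log_step w) (inv_re w) (PI ^ 2) (w / (w - 1 / 2) ^ 2)).
  - apply rapid_decay_rhoS.
  - apply rapid_decay_rho1.
  - apply rho1_lipschitz.
  - intros; apply continuous_log_step; auto.
  - intros u. eapply Rle_trans. apply log_step_bounded; auto.
    rewrite <- (Rmult_1_r (w / (w - 1 / 2) ^ 2)) at 1. apply Rmult_le_compat_l.
    apply Rmult_le_pos. lra. left; apply Rinv_0_lt_compat, pow_lt; lra.
    pose proof (pow2_ge_0 u); lra.
  - intros s. apply intR_log_step_shifted; auto.
  - intros s. apply continuous_inv_re; lra.
Qed.

(** * Derivatives and asymptotics of the logarithmic potential *)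

(* Real and imaginary parts of [(w + i u)^(-k)]. *)
Fixpoint inv_pow (k : nat) (w u : R) : R * R :=
  match k with
  | O => (1, 0)
  | S k => (fst (inv_pow k w u) * inv_re w u + snd (inv_pow k w u) * inv_im w u,
            snd (inv_pow k w u) * inv_re w u - fst (inv_pow k w u) * inv_im w u)
  end.

Lemma inv_sq_re_eq w u : 0 < w -> inv_sq_re w u = inv_re w u ^ 2 - inv_im w u ^ 2.
Proof.
  intros Hw. pose proof (sum_sq_pos w u Hw). unfold inv_sq_re, inv_re, inv_im.
  field. simpl in *; lra.
Qed.

Lemma inv_sq_im_eq w u : 0 < w -> inv_sq_im w u = 2 * inv_re w u * inv_im w u.
Proof.
  intros Hw. pose proof (sum_sq_pos w u Hw). unfold inv_sq_im, inv_re, inv_im.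
  field. simpl in *; lra.
Qed.

Lemma is_derive_inv_pow k (w u : R) : 0 < w ->
  is_derive (fun w => fst (inv_pow k w u)) w (- INR k * fst (inv_pow (S k) w u)) /\
  is_derive (fun w => snd (inv_pow k w u)) w (- INR k * snd (inv_pow (S k) w u)).
Proof.
  intros Hw. induction k as [|k [IH1 IH2]].
  - change (INR 0) with 0. rewrite Ropp_0, !Rmult_0_l.
    split; [apply (is_derive_const (V := R_NormedModule) 1) | apply (is_derive_const (V := R_NormedModule) 0)].
  - pose proof (is_derive_inv_re_l w u Hw) as H1. pose proof (is_derive_inv_im_l w u Hw) as H2.
    rewrite S_INR. split.
    + apply (is_derive_eq (fun w => fst (inv_pow k w u) * inv_re w u + snd (inv_pow k w u) * inv_im w u) w
        (- INR k * fst (inv_pow (S k) w u) * inv_re w u + fst (inv_pow k w u) * - inv_sq_re w u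
         + (- INR k * snd (inv_pow (S k) w u) * inv_im w u + snd (inv_pow k w u) * - inv_sq_im w u))).
      exact (is_derive_add _ _ _ _ _ (is_derive_mul _ _ _ _ _ IH1 H1) (is_derive_mul _ _ _ _ _ IH2 H2)).
      rewrite inv_sq_re_eq, inv_sq_im_eq by auto. cbn [inv_pow fst snd]. ring.
    + apply (is_derive_eq (fun w => snd (inv_pow k w u) * inv_re w u - fst (inv_pow k w u) * inv_im w u) w
        (- INR k * snd (inv_pow (S k) w u) * inv_re w u + snd (inv_pow k w u) * - inv_sq_re w u
         - (- INR k * fst (inv_pow (S k) w u) * inv_im w u + fst (inv_pow k w u) * - inv_sq_im w u))).
      exact (is_derive_sub _ _ _ _ _ (is_derive_mul _ _ _ _ _ IH2 H1) (is_derive_mul _ _ _ _ _ IH1 H2)).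
      rewrite inv_sq_re_eq, inv_sq_im_eq by auto. cbn [inv_pow fst snd]. ring.
Qed.

Lemma continuous_inv_im (s v : R) : 0 < s -> continuous (inv_im s) v.
Proof.
  intros Hs. apply (ex_derive_continuous (V := R_NormedModule) (inv_im s)).
  eexists. apply is_derive_inv_im_r; auto.
Qed.

Lemma continuous_inv_pow k (w u : R) : 0 < w ->
  continuous (fun u => fst (inv_pow k w u)) u /\ continuous (fun u => snd (inv_pow k w u)) u.
Proof.
  intros Hw. induction k as [|k [IH1 IH2]].
  - split; apply continuous_const.
  - pose proof (continuous_inv_re w u Hw). pose proof (continuous_inv_im w u Hw). split.
    + apply (continuous_plus (V := R_NormedModule)); apply (continuous_mult (K := R_AbsRing)); auto.
    + apply (continuous_minus (V := R_NormedModule)); apply (continuous_mult (K := R_AbsRing)); auto.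
Qed.

Lemma inv_pow_modulus k w u : 0 < w ->
  fst (inv_pow k w u) ^ 2 + snd (inv_pow k w u) ^ 2 <= (/ w ^ k) ^ 2.
Proof.
  intros Hw. induction k as [|k IH]. simpl. right; field.
  pose proof (sum_sq_pos w u Hw) as Hs.
  assert (E : inv_re w u ^ 2 + inv_im w u ^ 2 = / (w ^ 2 + u ^ 2)).
  { unfold inv_re, inv_im. field. simpl in *; lra. }
  cbn [inv_pow fst snd].
  match goal with |- ?l <= _ => replace l with
    ((fst (inv_pow k w u) ^ 2 + snd (inv_pow k w u) ^ 2) * (inv_re w u ^ 2 + inv_im w u ^ 2)) by ring end.
  rewrite E. replace ((/ w ^ S k) ^ 2) with ((/ w ^ k) ^ 2 * / w ^ 2).
  2: { simpl. field. split. apply pow_nonzero; lra. lra. }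
  apply Rmult_le_compat; auto.
  - pose proof (pow2_ge_0 (fst (inv_pow k w u))). pose proof (pow2_ge_0 (snd (inv_pow k w u))). lra.
  - left. apply Rinv_0_lt_compat; auto.
  - apply Rinv_le_contravar. apply pow_lt; auto. pose proof (pow2_ge_0 u); lra.
Qed.

Lemma inv_pow_re_bound k w u : 0 < w -> Rabs (fst (inv_pow k w u)) <= / w ^ k.
Proof.
  intros Hw. pose proof (inv_pow_modulus k w u Hw). pose proof (pow2_ge_0 (snd (inv_pow k w u))).
  assert (0 < / w ^ k) by (apply Rinv_0_lt_compat, pow_lt; auto).
  rewrite <- (Rabs_right (/ w ^ k)) by lra. apply Rsqr_le_abs_0. unfold Rsqr. lra.
Qed.

Lemma inv_pow_im_bound k w u : 0 < w -> Rabs (w ^ k * snd (inv_pow k w u)) <= 1.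
Proof.
  intros Hw. pose proof (inv_pow_modulus k w u Hw). pose proof (pow2_ge_0 (fst (inv_pow k w u))).
  assert (0 < w ^ k) by (apply pow_lt; auto).
  assert (Rabs (snd (inv_pow k w u)) <= / w ^ k).
  { assert (0 < / w ^ k) by (apply Rinv_0_lt_compat; auto).
    rewrite <- (Rabs_right (/ w ^ k)) by lra. apply Rsqr_le_abs_0. unfold Rsqr. lra. }
  rewrite Rabs_mult, Rabs_right by lra. apply Rmult_le_reg_l with (/ w ^ k).
  apply Rinv_0_lt_compat; auto. rewrite <- Rmult_assoc, Rinv_l by lra. lra.
Qed.

(** Each factor w / (w + i u) is within |u| / w of 1 in its real part and of 0 in its imaginary
    part, and its powers have modulus at most 1: every new power costs 2 |u| / w. *)
Lemma inv_pow_asymptotic k w u : 0 < w ->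
  Rabs (w ^ k * fst (inv_pow k w u) - 1) <= 2 * INR k * (Rabs u / w).
Proof.
  intros Hw.
  pose proof (sum_sq_pos w u Hw) as Hs.
  assert (Hb : Rabs (w * inv_im w u) <= Rabs u / w).
  { unfold inv_im. replace (w * (u / (w ^ 2 + u ^ 2))) with ((w * u) / (w ^ 2 + u ^ 2)) by (field; simpl in *; lra).
    apply Rabs_div_le; auto. rewrite Rabs_mult, Rabs_right by lra. pose proof (Rabs_pos u).
    apply Rmult_le_reg_r with w; auto.
    replace (Rabs u / w * (w ^ 2 + u ^ 2) * w) with (Rabs u * (w ^ 2 + u ^ 2)) by (field; lra).
    pose proof (pow2_ge_0 u). nra. }
  assert (Ha : Rabs (w * inv_re w u - 1) <= Rabs u / w).
  { unfold inv_re. replace (w * (w / (w ^ 2 + u ^ 2)) - 1) with (- (u * u) / (w ^ 2 + u ^ 2)) by (field; simpl in *; lra).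
    apply Rabs_div_le; auto. rewrite Rabs_Ropp, Rabs_mult. pose proof (Rabs_pos u).
    rewrite <- (pow2_abs u).
    apply Rmult_le_reg_r with w; auto.
    replace (Rabs u / w * (w ^ 2 + Rabs u ^ 2) * w) with (Rabs u * (w ^ 2 + Rabs u ^ 2)) by (field; lra).
    assert (Rabs u * w <= w ^ 2 + Rabs u ^ 2) by (pose proof (pow2_ge_0 (w - Rabs u)); nra). nra. }
  assert (Ha1 : Rabs (w * inv_re w u) <= 1).
  { unfold inv_re. replace (w * (w / (w ^ 2 + u ^ 2))) with (w * w / (w ^ 2 + u ^ 2)) by (field; simpl in *; lra).
    apply Rabs_div_le; auto. rewrite Rabs_right by nra. pose proof (pow2_ge_0 u). lra. }
  assert (Hu : 0 <= Rabs u / w).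
  { apply Rmult_le_pos. apply Rabs_pos. left; apply Rinv_0_lt_compat; auto. }
  revert Hb Ha Ha1 Hu. generalize (Rabs u / w). intros d Hb Ha Ha1 Hd.
  induction k as [|k IH].
  - simpl. rewrite Rmult_1_r, Rminus_diag, Rabs_R0. lra.
  - pose proof (inv_pow_im_bound k w u Hw) as Hi.
    cbn [inv_pow fst snd].
    match goal with |- Rabs ?l <= _ => replace l with
      ((w ^ k * fst (inv_pow k w u) - 1) * (w * inv_re w u)
       + ((w ^ k * snd (inv_pow k w u)) * (w * inv_im w u) + (w * inv_re w u - 1))) by (simpl; ring) end.
    rewrite S_INR. eapply Rle_trans.
    + apply Rabs_plus_le. apply Rabs_mult_le. apply IH. apply Ha1.
      apply Rabs_plus_le. apply Rabs_mult_le. apply Hi. apply Hb. apply Ha.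
    + lra.
Qed.

(* Successive [w]-derivatives of [logmod w u = Re (log (w + i u))]. *)
Definition logmod_deriv (k : nat) (w u : R) : R :=
  match k with
  | O => logmod w u
  | S j => (-1) ^ j * INR (fact j) * fst (inv_pow k w u)
  end.

Lemma is_derive_logmod_deriv k (w u : R) : 0 < w ->
  is_derive (fun w => logmod_deriv k w u) w (logmod_deriv (S k) w u).
Proof.
  intros Hw. destruct k as [|j].
  - eapply is_derive_eq. apply is_derive_logmod_l; auto. simpl. ring.
  - destruct (is_derive_inv_pow (S j) w u Hw) as [H _].
    unfold logmod_deriv. rewrite fact_simpl, mult_INR.
    change ((-1) ^ S j) with (-1 * (-1) ^ j).
    revert H. generalize (INR (S j)) (inv_pow (S (S j)) w u).
    generalize (inv_pow (S j)) (INR (fact j)). intros p c m q H.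
    apply (is_derive_eq (fun w => (-1) ^ j * c * fst (p w u)) w ((-1) ^ j * c * (- m * fst q))).
    apply is_derive_scal, H. ring.
Qed.

Lemma continuous_logmod_deriv k (w u : R) : 0 < w -> continuous (logmod_deriv k w) u.
Proof.
  intros Hw. destruct k as [|j]. apply continuous_logmod; auto.
  apply (continuous_scal_r (V := R_NormedModule) ((-1) ^ j * INR (fact j))).
  apply continuous_inv_pow; auto.
Qed.

Lemma logmod_deriv_S_bound j w u : 0 < w ->
  Rabs (logmod_deriv (S j) w u) <= INR (fact j) * / w ^ S j.
Proof.
  intros Hw. unfold logmod_deriv. apply Rabs_mult_le.
  - rewrite Rabs_mult, pow_1_abs, Rmult_1_l, Rabs_right. lra. apply Rle_ge, pos_INR.
  - apply inv_pow_re_bound; auto.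
Qed.

Lemma logmod_deriv_dominated n k w : 0 < w ->
  exists C, dominated (fun u => logmod_deriv k w u * rhoS n u) C.
Proof.
  intros Hw. destruct k as [|j]. apply logmod_rhoS_dominated; auto.
  apply rapid_decay_dominated_bounded with (INR (fact j) * / w ^ S j).
  apply rapid_decay_rhoS. intros; apply continuous_logmod_deriv; auto.
  intros; apply logmod_deriv_S_bound; auto.
Qed.

Definition log_potential_deriv (n k : nat) (w : R) : R :=
  intR (fun u => logmod_deriv k w u * rhoS n u).

Lemma is_derive_log_potential n k (w : R) : 0 < w ->
  is_derive (log_potential_deriv n k) w (log_potential_deriv n (S k) w).
Proof.
  intros Hw.
  destruct (rapid_decay_dominated_1 _ (rapid_decay_rhoS n)) as [D HD].
  destruct (logmod_deriv_dominated n (S k) w Hw) as [C1 HC1].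
  pose proof (pos_INR (fact (S k))).
  (* On the radius w / 2 one has y > w / 2, which bounds the second derivative uniformly in y. *)
  apply (is_derive_intR (fun y u => logmod_deriv k y u * rhoS n u)
    (fun y u => logmod_deriv (S k) y u * rhoS n u)
    (fun y u => logmod_deriv (S (S k)) y u * rhoS n u)
    C1 (INR (fact (S k)) * / (w / 2) ^ S (S k) * D) w (w / 2)).
  - lra.
  - intros y Hy. apply logmod_deriv_dominated. apply Rabs_lt_between in Hy. lra.
  - exact HC1.
  - intros y u Hy. apply Rabs_lt_between in Hy. 
    eapply is_derive_eq. apply is_derive_mul. apply is_derive_logmod_deriv; lra.
    apply (is_derive_const (V := R_NormedModule)). unfold zero; simpl; ring.
  - intros y u Hy. apply Rabs_lt_between in Hy. 
    eapply is_derive_eq. apply is_derive_mul. apply is_derive_logmod_deriv; lra.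
    apply (is_derive_const (V := R_NormedModule)). unfold zero; simpl; ring.
  - intros y u Hy. apply Rabs_lt_between in Hy.
    rewrite Rmult_assoc. apply Rabs_mult_le. 2: apply HD.
    eapply Rle_trans. apply logmod_deriv_S_bound; lra.
    apply Rmult_le_compat_l; auto. apply Rinv_le_contravar.
    apply pow_lt; lra. apply pow_incr; lra.
Qed.

(** A single constant serves all [g]: of the two powers of decay, one pays for the weight 1 + u^2
    and one is kept for integrability. *)
Lemma intR_rhoS_weighted_bound n : exists M, 0 <= M /\ forall g c,
  (forall u, continuous g u) -> (forall u, Rabs (g u) <= c * (1 + u ^ 2)) ->
  Rabs (intR (fun u => g u * rhoS n u)) <= c * M.
Proof.
  destruct (proj2 (rapid_decay_rhoS n) 2%nat) as [C HC].
  pose proof (decay_const_nonneg _ _ _ HC). pose proof PI_RGT_0.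
  exists (C * PI). split. apply Rmult_le_pos; lra.
  intros g c Hg Hb. rewrite <- Rmult_assoc. apply dominated_intR_le. split.
  - intros u. apply (continuous_mult (K := R_AbsRing)); auto. apply rapid_decay_rhoS.
  - intros u. eapply Rle_trans. apply Rabs_mult_le. apply Hb. apply HC.
    right. field. apply Rgt_not_eq, one_plus_sq_pos.
Qed.

(** Up to a relative error O(|u| / w), the derivatives of log |w + i u| are those of log w, and the
    density has mass 1. *)
Lemma log_potential_deriv_asymptotic n j :
  is_lim (fun w => w ^ S j * log_potential_deriv n (S j) w) p_infty ((-1) ^ j * INR (fact j)).
Proof.
  destruct (intR_rhoS_weighted_bound n) as [M [HM HMb]].
  set (a := (-1) ^ j * INR (fact j)).
  apply is_lim_of_inv_bound with (Rabs a * (2 * INR (S j)) * M) 0. intros w Hw.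
  destruct (rapid_decay_dominated_1 _ (rapid_decay_rhoS n)) as [D HD].
  destruct (logmod_deriv_dominated n (S j) w Hw) as [C HC].
  unfold log_potential_deriv. rewrite <- (intR_scal _ (w ^ S j) _ HC).
  replace a with (a * intR (rhoS n)) at 1 by (rewrite intR_rhoS; ring).
  rewrite <- (intR_scal _ a _ HD).
  rewrite <- (intR_minus _ _ _ _ (dominated_scal _ (w ^ S j) _ HC) (dominated_scal _ a _ HD)).
  rewrite (intR_ext _ (fun u => (a * (w ^ S j * fst (inv_pow (S j) w u) - 1)) * rhoS n u) _
    (dominated_minus _ _ _ _ (dominated_scal _ (w ^ S j) _ HC) (dominated_scal _ a _ HD))).
  2: { intros u. unfold logmod_deriv. fold a. ring. }
  replace (Rabs a * (2 * INR (S j)) * M / w) with (Rabs a * (2 * INR (S j)) / w * M) by (field; lra).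
  apply HMb.
  - intros u. apply (continuous_scal_r (V := R_NormedModule) a).
    apply (continuous_minus (V := R_NormedModule)). 2: apply continuous_const.
    apply (continuous_scal_r (V := R_NormedModule) (w ^ S j)). apply continuous_inv_pow; auto.
  - intros u. replace (Rabs a * (2 * INR (S j)) / w * (1 + u ^ 2)) with
      (Rabs a * (2 * INR (S j) * ((1 + u ^ 2) / w))) by (field; lra).
    apply Rabs_mult_le. lra. eapply Rle_trans. apply inv_pow_asymptotic; auto.
    pose proof (pos_INR (S j)). apply Rmult_le_compat_l. lra.
    apply Rmult_le_compat_r. left; apply Rinv_0_lt_compat; auto.
    rewrite <- (pow2_abs u). pose proof (pow2_ge_0 (1 - Rabs u)). pose proof (Rabs_pos u). nra.
Qed.

(** * The integral of the theorem in terms of the potential *)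

Lemma log_excess w u : 0 < w -> ln (1 + / w ^ 2 * u ^ 2) = 2 * (logmod w u - ln w).
Proof.
  intros Hw. pose proof (sum_sq_pos w u Hw). unfold logmod.
  replace (1 + / w ^ 2 * u ^ 2) with ((w ^ 2 + u ^ 2) / (w * w)) by (field; lra).
  rewrite ln_div, ln_mult by (auto; nra). field.
Qed.

Lemma continuous_log_excess (w u : R) : 0 < w -> continuous (fun u => ln (1 + / w ^ 2 * u ^ 2)) u.
Proof.
  intros Hw. apply continuous_ext with (fun u => 2 * (logmod w u - ln w)).
  intros v. symmetry. apply log_excess; auto.
  apply (continuous_scal_r (V := R_NormedModule) 2).
  apply (continuous_minus (V := R_NormedModule)). apply continuous_logmod; auto. apply continuous_const.
Qed.

Lemma log_excess_bound w u : 0 < w -> 0 <= ln (1 + / w ^ 2 * u ^ 2) <= u ^ 2 / w ^ 2.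
Proof.
  intros Hw. assert (0 < / w ^ 2) by (apply Rinv_0_lt_compat, pow_lt; auto).
  assert (0 <= / w ^ 2 * u ^ 2) by (apply Rmult_le_pos; [lra | apply pow2_ge_0]).
  split.
  - rewrite <- ln_1. apply ln_le; lra.
  - pose proof (ln_le_sub_1 (1 + / w ^ 2 * u ^ 2) ltac:(lra)). unfold Rdiv. lra.
Qed.

Lemma log_excess_dominated n w : 0 < w ->
  exists C, dominated (fun u => ln (1 + / w ^ 2 * u ^ 2) * rhoS n u) C.
Proof.
  intros Hw. apply rapid_decay_dominated with (/ w ^ 2) 1%nat. apply rapid_decay_rhoS.
  - intros u. apply continuous_log_excess; lra.
  - intros u. pose proof (log_excess_bound w u Hw). rewrite Rabs_right by lra.
    assert (0 < / w ^ 2) by (apply Rinv_0_lt_compat, pow_lt; auto).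
    rewrite pow_1. unfold Rdiv in *. lra.
Qed.

Lemma intR_log_excess n w : 0 < w ->
  intR (fun u => ln (1 + / w ^ 2 * u ^ 2) * rhoS n u) = 2 * (log_potential n w - ln w).
Proof.
  intros Hw.
  destruct (rapid_decay_dominated_1 _ (rapid_decay_rhoS n)) as [D HD].
  destruct (logmod_rhoS_dominated n w Hw) as [C HC].
  destruct (log_excess_dominated n w Hw) as [E HE].
  unfold log_potential. replace (ln w) with (ln w * intR (rhoS n)) by (rewrite intR_rhoS; apply Rmult_1_r).
  rewrite <- (intR_scal _ (ln w) _ HD).
  rewrite <- (intR_minus _ _ _ _ HC (dominated_scal _ (ln w) _ HD)).
  rewrite <- (intR_scal _ 2 _ (dominated_minus _ _ _ _ HC (dominated_scal _ (ln w) _ HD))).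
  apply intR_ext with E; auto. intros u.
  rewrite log_excess by auto. ring.
Qed.

Lemma log_potential_asymptotic n : is_lim (fun w => log_potential n w - ln w) p_infty 0.
Proof.
  destruct (intR_rhoS_weighted_bound n) as [M [HM HMb]].
  apply is_lim_of_inv_bound with M 1. intros w Hw. rewrite Rminus_0_r.
  replace (log_potential n w - ln w) with (/ 2 * (2 * (log_potential n w - ln w))) by field.
  rewrite <- intR_log_excess by lra.
  apply Rle_trans with (1 / 2 * (/ w * M)).
  2: { unfold Rdiv. assert (0 < / w) by (apply Rinv_0_lt_compat; lra).
       assert (0 <= / w * M) by (apply Rmult_le_pos; lra). lra. }
  apply Rabs_mult_le. rewrite Rabs_right; lra.
  apply HMb.
  - intros u. apply continuous_log_excess; lra.
  - intros u. pose proof (log_excess_bound w u ltac:(lra)). rewrite Rabs_right by lra.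
    eapply Rle_trans. apply H. unfold Rdiv. rewrite Rmult_comm.
    pose proof (pow2_ge_0 u).
    apply Rmult_le_compat; try lra. left; apply Rinv_0_lt_compat, pow_lt; lra.
    apply Rinv_le_contravar; nra.
Qed.

(** The density is even, so the half-line carries half of the integral; this cancels the factor 2 of
    [log_excess]. *)
Lemma RInt_gen_log_excess n w : 0 < w ->
  RInt_gen (fun u => ln (1 + / w ^ 2 * u ^ 2) * rhoS n u) (at_point 0) (Rbar_locally p_infty)
  = log_potential n w - ln w.
Proof.
  intros Hw. destruct (log_excess_dominated n w Hw) as [C HC].
  set (f := fun u => ln (1 + / w ^ 2 * u ^ 2) * rhoS n u) in *.
  assert (Hex : forall a b, ex_RInt f a b) by (intros; apply continuous_ex_RInt, HC).
  assert (Hev : forall u, f (- u) = f u).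
  { intros u. unfold f. rewrite rhoS_even. replace ((- u) ^ 2) with (u ^ 2) by ring. auto. }
  assert (Hsym : forall A, RInt f (- A) A = 2 * RInt f 0 A).
  { intros A. rewrite <- (RInt_Chasles (V := R_CompleteNormedModule) f (- A) 0 A) by auto.
    replace (RInt f (- A) 0) with (RInt f 0 A). unfold plus; simpl; ring.
    rewrite (RInt_ext_all f (fun u => f (- u))) by auto.
    rewrite RInt_reflect by apply HC. rewrite Ropp_0. auto. }
  apply (is_RInt_gen_unique (V := R_CompleteNormedModule)).
  pose proof (intR_is_lim f C HC) as Hl. unfold f in Hl at 2. rewrite intR_log_excess in Hl by auto.
  apply is_lim_spec in Hl.
  intros P [e He]. 
  destruct (Hl e) as [B HB].
  (* For the filter [at_point 0] the lower endpoint may be taken equal to 0. *)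
  exists (fun a => a = 0) (fun b => B < b).
  - reflexivity.
  - exists B; auto.
  - intros a b -> Hb. exists (RInt f 0 b). split.
    apply (RInt_correct (V := R_CompleteNormedModule)), Hex.
    apply He. specialize (HB b Hb). rewrite Hsym in HB.
    unfold ball; simpl. unfold AbsRing_ball, abs, minus, plus, opp; simpl.
    pose proof (cond_pos e).
    revert HB. unfold Rabs; repeat destruct Rcase_abs; lra.
Qed.

(** * The digamma function *)

(** The integrand of Gamma after the substitution t = exp s. Both ends of (0, infinity) become ends
    of the line with exponential decay, so the singularity at 0 for x < 1 needs no separate
    treatment. *)
Definition gamma_density (x s : R) : R := exp (x * s - exp s).

Lemma is_derive_gamma_density_r (x s : R) :
  is_derive (gamma_density x) s ((x - exp s) * gamma_density x s).
Proof.
  unfold gamma_density, Rminus. auto_derive; auto.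
  match goal with |- @eq _ ?a ?b => change (@eq R a b) end. ring.
Qed.

Lemma is_derive_gamma_density_l (x s : R) :
  is_derive (fun x => gamma_density x s) x (s * gamma_density x s).
Proof.
  unfold gamma_density, Rminus. auto_derive; auto.
  match goal with |- @eq _ ?a ?b => change (@eq R a b) end. ring.
Qed.

Lemma continuous_gamma_density (x s : R) : continuous (gamma_density x) s.
Proof.
  apply (ex_derive_continuous (V := R_NormedModule) (gamma_density x)).
  eexists. apply is_derive_gamma_density_r.
Qed.

Lemma gamma_density_pos x s : 0 < gamma_density x s.
Proof. apply exp_pos. Qed.

Lemma exp_le_exp x y : x <= y -> exp x <= exp y.
Proof. intros [H| ->]. left; apply exp_increasing; auto. lra. Qed.

(** For s < 0 the factor exp (x s) decays. For s >= 0 the tangent of exp at ln (x + 1) gives x s -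
    exp s <= - s + (x + 1) ln (x + 1), which explains the constant. *)
Lemma rapid_decay_gamma_density x : 0 < x -> rapid_decay (gamma_density x).
Proof.
  intros Hx.
  apply rapid_decay_of_exp with (exp ((x + 1) * ln (x + 1))) (Rmin x 1).
  - apply Rmin_glb_lt; lra.
  - intros; apply continuous_gamma_density.
  - intros s. rewrite Rabs_right by (apply Rle_ge; left; apply gamma_density_pos).
    unfold gamma_density. rewrite <- exp_plus. apply exp_le_exp.
    pose proof (Rmin_l x 1). pose proof (Rmin_r x 1).
    assert (Hm : 0 < Rmin x 1) by (apply Rmin_glb_lt; lra).
    assert (Hl : 0 <= ln (x + 1)) by (rewrite <- ln_1; apply ln_le; lra).
    pose proof (exp_pos s). assert (0 <= (x + 1) * ln (x + 1)) by (apply Rmult_le_pos; lra).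
    unfold Rabs; destruct Rcase_abs.
    + assert (0 <= (x - Rmin x 1) * - s) by (apply Rmult_le_pos; lra). lra.
    + assert (He : (x + 1) * (1 + (s - ln (x + 1))) <= exp s).
      { replace (exp s) with (exp (ln (x + 1)) * exp (s - ln (x + 1))).
        rewrite exp_ln by lra. apply Rmult_le_compat_l. lra. apply exp_ineq1_le.
        rewrite <- exp_plus. f_equal. ring. }
      assert (0 <= (1 - Rmin x 1) * s) by (apply Rmult_le_pos; lra). lra.
Qed.

Lemma Gamma_eq_intR x : 0 < x -> Gamma x = intR (gamma_density x).
Proof.
  intros Hx. destruct (rapid_decay_dominated_1 _ (rapid_decay_gamma_density x Hx)) as [C HC].
  unfold Gamma. apply (is_RInt_gen_unique (V := R_CompleteNormedModule)).
  intros P [e He].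
  destruct (ex_radius (4 * C) e (cond_pos e)) as [A [HA HK]].
  exists (fun a => 0 < a < exp (- A)) (fun b => exp A < b).
  - exists (mkposreal _ (exp_pos (- A))). intros y Hy Hy0. simpl in Hy.
    unfold ball in Hy; simpl in Hy; unfold AbsRing_ball, abs, minus, plus, opp in Hy; simpl in Hy.
    rewrite Ropp_0, Rplus_0_r, Rabs_right in Hy; lra.
  - exists (exp A). auto.
  - intros a b [Ha0 Ha] Hb. simpl. exists (RInt (gamma_density x) (ln a) (ln b)).
    pose proof (exp_pos A).
    assert (Hpos : forall y, Rmin a b <= y <= Rmax a b -> 0 < y).
    { intros y [Hy _]. eapply Rlt_le_trans. 2: apply Hy. apply Rmin_glb_lt; lra. }
    split.
    + apply is_RInt_ext with (fun y => scal (/ y) (gamma_density x (ln y))).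
      * intros y Hy. assert (0 < y) by (apply Hpos; lra).
        unfold scal; simpl; unfold mult; simpl. unfold gamma_density, Rpower.
        rewrite exp_ln by auto.
        replace (/ y) with (exp (- ln y)) by (rewrite exp_Ropp, exp_ln; auto).
        rewrite <- !exp_plus. f_equal. ring.
      * apply (is_RInt_comp (V := R_CompleteNormedModule)).
        intros; apply continuous_gamma_density.
        intros y Hy. specialize (Hpos y Hy). split.
        apply is_derive_Reals, derivable_pt_lim_ln; auto.
        apply (ex_derive_continuous (V := R_NormedModule) (fun y => / y)). auto_derive. lra.
    + apply He. assert (Hla : ln a <= - A).
      { rewrite <- (ln_exp (- A)). apply ln_le; lra. }
      assert (Hlb : A <= ln b).
      { rewrite <- (ln_exp A). apply ln_le; lra. }
      pose proof (dominated_RInt_window _ _ _ _ _ HC HA Hla Hlb).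
      pose proof (intR_approx _ _ _ HC HA).
      unfold ball; simpl. unfold AbsRing_ball, abs, minus, plus, opp; simpl.
      replace (4 * C / A) with (2 * C / A + 2 * C / A) in HK by (field; lra).
      revert H0 H1. unfold Rabs; repeat destruct Rcase_abs; lra.
Qed.

Lemma intR_pos f C : dominated f C -> (forall x, 0 < f x) -> 0 < intR f.
Proof.
  intros Hd Hf. assert (Hex : forall a b, ex_RInt f a b) by (intros; apply continuous_ex_RInt, Hd).
  apply Rlt_le_trans with (RInt f (-1) 1).
  - apply RInt_gt_0. lra. auto. intros; apply Hd.
  - apply (is_lim_le_loc (fun _ => RInt f (-1) 1) (fun A => RInt f (- A) A) p_infty
      (Finite (RInt f (-1) 1)) (Finite (intR f))).
    + exists 1. intros A HA.
      rewrite <- (RInt_Chasles (V := R_CompleteNormedModule) f (- A) (-1) A) by auto.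
      rewrite <- (RInt_Chasles (V := R_CompleteNormedModule) f (-1) 1 A) by auto.
      assert (0 <= RInt f (- A) (-1)) by (apply RInt_ge_0; auto; [lra | intros; left; auto]).
      assert (0 <= RInt f 1 A) by (apply RInt_ge_0; auto; [lra | intros; left; auto]).
      unfold plus; simpl. lra.
    + apply is_lim_const.
    + apply (intR_is_lim f C Hd).
Qed.

Lemma gamma_density_dominated k x : 0 < x ->
  exists C, dominated (fun s => s ^ k * gamma_density x s) C.
Proof.
  intros Hx. apply rapid_decay_dominated with 1 k. apply rapid_decay_gamma_density; auto.
  - intros s. apply (ex_derive_continuous (V := R_NormedModule) (fun s => s ^ k)). auto_derive. auto.
  - intros s. rewrite Rmult_1_l, <- RPow_abs. apply pow_incr. split. apply Rabs_pos.
    rewrite <- (pow2_abs s). pose proof (pow2_ge_0 (1 - Rabs s)). pose proof (pow2_ge_0 (Rabs s)). lra.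
Qed.

Lemma Gamma_pos x : 0 < x -> 0 < Gamma x.
Proof.
  intros Hx. rewrite Gamma_eq_intR by auto.
  destruct (rapid_decay_dominated_1 _ (rapid_decay_gamma_density x Hx)) as [C HC].
  apply intR_pos with C; auto. intros; apply gamma_density_pos.
Qed.

Lemma locally_pos (x : R) : 0 < x -> locally x (fun y => 0 < y).
Proof. apply (open_gt 0). Qed.

Lemma is_derive_Gamma (x : R) : 0 < x ->
  is_derive Gamma x (intR (fun s => s * gamma_density x s)).
Proof.
  intros Hx. apply is_derive_ext_loc with (fun y => intR (gamma_density y)).
  { eapply filter_imp. 2: apply (locally_pos x Hx). intros y Hy. symmetry. apply Gamma_eq_intR, Hy. }
  (* For |y - x| < x / 2 the density at [y] is dominated by the one at 3 x / 2 where s >= 0 and by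
     the one at x / 2 where s < 0; their sum serves for both. *)
  destruct (gamma_density_dominated 1 x Hx) as [C1 H1].
  destruct (gamma_density_dominated 2 (x / 2)) as [C2 H2]. lra.
  destruct (gamma_density_dominated 2 (3 * x / 2)) as [C3 H3]. lra.
  apply (is_derive_intR gamma_density (fun y s => s * gamma_density y s)
    (fun y s => s * (s * gamma_density y s)) C1 (C2 + C3) x (x / 2)).
  - lra.
  - intros y Hy. apply Rabs_lt_between in Hy. apply rapid_decay_dominated_1, rapid_decay_gamma_density. lra.
  - eapply dominated_ext. 2: exact H1. intros s. simpl. ring.
  - intros y s _. apply is_derive_gamma_density_l.
  - intros y s _. apply (is_derive_scal (fun y => gamma_density y s)), is_derive_gamma_density_l.
  - intros y s Hy. apply Rabs_lt_between in Hy.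
    eapply Rle_trans. 2: apply (proj2 (dominated_plus _ _ _ _ H2 H3) s).
    pose proof (gamma_density_pos y s). pose proof (gamma_density_pos (x / 2) s).
    pose proof (gamma_density_pos (3 * x / 2) s).
    replace (s * (s * gamma_density y s)) with (s ^ 2 * gamma_density y s) by ring.
    pose proof (pow2_ge_0 s).
    rewrite Rabs_right by (apply Rle_ge, Rmult_le_pos; lra).
    eapply Rle_trans. 2: apply Rle_abs.
    rewrite <- Rmult_plus_distr_l. apply Rmult_le_compat_l; auto.
    destruct (Rle_dec 0 s) as [Hs|Hs].
    + apply Rle_trans with (gamma_density (3 * x / 2) s). 2: lra.
      apply exp_le_exp. apply Rplus_le_compat_r. apply Rmult_le_compat_r; lra.
    + apply Rle_trans with (gamma_density (x / 2) s). 2: lra.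
      apply exp_le_exp. apply Rplus_le_compat_r. nra.
Qed.

Lemma gamma_density_succ x s : gamma_density (x + 1) s = exp s * gamma_density x s.
Proof. unfold gamma_density. rewrite <- exp_plus. f_equal. ring. Qed.

(** The derivative of [gamma_density x] is x times itself minus [gamma_density (x + 1)], and its
    integral over the line vanishes because the density decays at both ends. *)
Lemma Gamma_succ x : 0 < x -> Gamma (x + 1) = x * Gamma x.
Proof.
  intros Hx. rewrite !Gamma_eq_intR by lra.
  destruct (rapid_decay_dominated_1 _ (rapid_decay_gamma_density x Hx)) as [C HC].
  destruct (rapid_decay_dominated_1 _ (rapid_decay_gamma_density (x + 1) ltac:(lra))) as [D HD].
  rewrite <- (intR_scal _ x _ HC).
  apply Rminus_diag_uniq_sym. rewrite <- (intR_minus _ _ _ _ (dominated_scal _ x _ HC) HD).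
  eapply intR_unique. apply (dominated_minus _ _ _ _ (dominated_scal _ x _ HC) HD).
  apply is_lim_of_inv_bound with (2 * C) 0. intros A HA. rewrite Rminus_0_r.
  rewrite (is_RInt_unique (V := R_CompleteNormedModule) _ (- A) A
    (minus (gamma_density x A) (gamma_density x (- A)))).
  - replace (2 * C / A) with (C / A + C / A) by (field; lra).
    assert (H2 : C * / (1 + A ^ 2) <= C / A).
    { pose proof (dominated_nonneg _ _ HC). apply Rmult_le_compat_l; auto.
      apply Rinv_le_contravar; nra. }
    apply Rabs_minus_le; eapply Rle_trans; try apply HC; auto.
    replace ((- A) ^ 2) with (A ^ 2) by ring. auto.
  - apply is_RInt_ext with (fun s => (x - exp s) * gamma_density x s).
    { intros s _. rewrite gamma_density_succ. apply Rmult_minus_distr_r. }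
    apply (is_RInt_derive (V := R_CompleteNormedModule) (gamma_density x)).
    intros; apply is_derive_gamma_density_r.
    intros s _. apply (continuous_mult (K := R_AbsRing)). 2: apply continuous_gamma_density.
    apply (continuous_minus (V := R_NormedModule)). apply continuous_const. apply continuous_exp.
Qed.

Lemma digamma_succ x : 0 < x -> digamma (x + 1) = digamma x + / x.
Proof.
  intros Hx. pose proof (is_derive_Gamma x Hx) as H0.
  pose proof (is_derive_Gamma (x + 1) ltac:(lra)) as H1.
  set (d0 := intR (fun s => s * gamma_density x s)) in *.
  set (d1 := intR (fun s => s * gamma_density (x + 1) s)) in *.
  assert (E : d1 = Gamma x + x * d0).
  { rewrite <- (is_derive_unique (fun y => Gamma (y + 1)) x d1).
    - rewrite <- (is_derive_unique (fun y => y * Gamma y) x (Gamma x + x * d0)).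
      + apply Derive_ext_loc. eapply filter_imp. 2: apply (locally_pos x Hx).
        intros y Hy. apply Gamma_succ, Hy.
      + apply (is_derive_eq _ _ (1 * Gamma x + x * d0)). 2: ring.
        apply is_derive_mul. apply (is_derive_id (K := R_AbsRing)). apply H0.
    - apply is_derive_ext with (fun y => Gamma (1 + y)). intros t; f_equal; apply Rplus_comm.
      apply (is_derive_comp_add Gamma). rewrite Rplus_comm. exact H1. }
  unfold digamma. rewrite (is_derive_unique _ _ _ H0), (is_derive_unique _ _ _ H1), E.
  rewrite Gamma_succ by auto. pose proof (Gamma_pos x Hx). field. lra.
Qed.

(* Jensen's inequality for the logarithm, by its tangent line at [x]. *)
Lemma digamma_le_ln x : 0 < x -> digamma x <= ln x.
Proof.
  intros Hx. unfold digamma. rewrite (is_derive_unique _ _ _ (is_derive_Gamma x Hx)).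
  pose proof (Gamma_pos x Hx) as HG.
  apply Rmult_le_reg_r with (Gamma x); auto.
  unfold Rdiv. rewrite Rmult_assoc, Rinv_l, Rmult_1_r by lra.
  destruct (rapid_decay_dominated_1 _ (rapid_decay_gamma_density x Hx)) as [C HC].
  destruct (rapid_decay_dominated_1 _ (rapid_decay_gamma_density (x + 1) ltac:(lra))) as [D HD].
  destruct (gamma_density_dominated 1 x Hx) as [C1 H1].
  assert (E : ln x * Gamma x = intR (fun s => (ln x - 1) * gamma_density x s + / x * gamma_density (x + 1) s)).
  { rewrite (intR_plus _ _ _ _ (dominated_scal _ (ln x - 1) _ HC) (dominated_scal _ (/ x) _ HD)).
    rewrite (intR_scal _ _ _ HC), (intR_scal _ _ _ HD), <- !Gamma_eq_intR, Gamma_succ by lra. field. lra. }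
  rewrite E. eapply intR_le.
  - eapply dominated_ext. 2: exact H1. intros s. simpl. rewrite Rmult_1_r. reflexivity.
  - apply (dominated_plus _ _ _ _ (dominated_scal _ (ln x - 1) _ HC) (dominated_scal _ (/ x) _ HD)).
  - intros s. rewrite gamma_density_succ.
    replace ((ln x - 1) * gamma_density x s + / x * (exp s * gamma_density x s)) with
      ((ln x - 1 + exp s / x) * gamma_density x s) by (field; lra).
    apply Rmult_le_compat_r. left; apply gamma_density_pos.
    pose proof (exp_ineq1_le (s - ln x)) as He.
    replace (exp (s - ln x)) with (exp s / x) in He. lra.
    unfold Rminus. rewrite exp_plus, exp_Ropp, exp_ln; auto.
Qed.

(** Jensen's inequality for exp (-s) under the normalised density at x + 1: there s has mean digamma
    (x + 1) and exp (-s) has mean Gamma x / Gamma (x + 1) = 1/x. The tangent is taken at s = ln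
    x. *)
Lemma ln_le_digamma_succ x : 0 < x -> ln x <= digamma (x + 1).
Proof.
  intros Hx. unfold digamma. rewrite (is_derive_unique _ _ _ (is_derive_Gamma (x + 1) ltac:(lra))).
  pose proof (Gamma_pos (x + 1) ltac:(lra)) as HG.
  apply Rmult_le_reg_r with (Gamma (x + 1)); auto.
  unfold Rdiv. rewrite Rmult_assoc, Rinv_l, Rmult_1_r by lra.
  destruct (rapid_decay_dominated_1 _ (rapid_decay_gamma_density x Hx)) as [C HC].
  destruct (rapid_decay_dominated_1 _ (rapid_decay_gamma_density (x + 1) ltac:(lra))) as [D HD].
  destruct (gamma_density_dominated 1 (x + 1)) as [C1 H1]. lra.
  assert (E : ln x * Gamma (x + 1) = intR (fun s => (ln x + 1) * gamma_density (x + 1) s + - x * gamma_density x s)).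
  { rewrite (intR_plus _ _ _ _ (dominated_scal _ (ln x + 1) _ HD) (dominated_scal _ (- x) _ HC)).
    rewrite (intR_scal _ _ _ HC), (intR_scal _ _ _ HD), <- !Gamma_eq_intR, Gamma_succ by lra. ring. }
  rewrite E. eapply intR_le.
  - apply (dominated_plus _ _ _ _ (dominated_scal _ (ln x + 1) _ HD) (dominated_scal _ (- x) _ HC)).
  - eapply dominated_ext. 2: exact H1. intros s. simpl. rewrite Rmult_1_r. reflexivity.
  - intros s. rewrite gamma_density_succ.
    replace ((ln x + 1) * (exp s * gamma_density x s) + - x * gamma_density x s) with
      (((ln x + 1) * exp s - x) * gamma_density x s) by ring.
    rewrite <- Rmult_assoc. apply Rmult_le_compat_r. left; apply gamma_density_pos.
    pose proof (exp_ineq1_le (ln x - s)) as He. pose proof (exp_pos s).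
    apply Rmult_le_compat_r with (r := exp s) in He; [| lra].
    replace (exp (ln x - s) * exp s) with x in He. lra.
    rewrite <- exp_plus. replace (ln x - s + s) with (ln x) by ring. rewrite exp_ln; auto.
Qed.

Lemma digamma_asymptotic : is_lim (fun x => digamma x - ln x) p_infty 0.
Proof.
  apply is_lim_of_inv_bound with 1 0. intros x Hx. rewrite Rminus_0_r.
  pose proof (digamma_le_ln x Hx). pose proof (ln_le_digamma_succ x Hx).
  rewrite digamma_succ in H0 by auto. unfold Rdiv. apply Rabs_le. lra.
Qed.

(** * Iterated derivatives of binomial multiples of digamma *)

Lemma is_lim_shift (f : R -> R) (l s : R) : is_lim f p_infty l ->
  is_lim (fun w => f (w + s)) p_infty l.
Proof.
  intros H. apply is_lim_spec in H. apply is_lim_spec. intros eps.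
  destruct (H eps) as [M HM]. exists (M - s). intros x Hx. apply HM. lra.
Qed.

Lemma is_lim_ln_shift s : is_lim (fun w => ln (w + s) - ln w) p_infty 0.
Proof.
  apply is_lim_of_inv_bound with (2 * Rabs s) (2 * Rabs s). intros w Hw.
  pose proof (Rabs_pos s). rewrite Rminus_0_r.
  assert (Hs : - Rabs s <= s <= Rabs s) by (split; [pose proof (Rle_abs (- s)) as Q; rewrite Rabs_Ropp in Q; lra | apply Rle_abs]).
  assert (Hws : 0 < w + s) by lra.
  apply Rabs_le. split.
  - pose proof (ln_le_sub_1 (w / (w + s)) ltac:(apply Rdiv_lt_0_compat; lra)) as H1.
    rewrite ln_div in H1 by lra.
    replace (w / (w + s) - 1) with (- s / (w + s)) in H1 by (field; lra).
    assert (- s / (w + s) <= 2 * Rabs s / w).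
    { apply Rle_trans with (Rabs s / (w + s)).
      apply Rmult_le_compat_r. left; apply Rinv_0_lt_compat; lra. lra.
      replace (2 * Rabs s / w) with (Rabs s / (w / 2)) by (field; lra).
      apply Rmult_le_compat_l. lra. apply Rinv_le_contravar; lra. }
    lra.
  - pose proof (ln_le_sub_1 ((w + s) / w) ltac:(apply Rdiv_lt_0_compat; lra)) as H1.
    rewrite ln_div in H1 by lra.
    replace ((w + s) / w - 1) with (s / w) in H1 by (field; lra).
    assert (s / w <= 2 * Rabs s / w).
    { apply Rmult_le_compat_r. left; apply Rinv_0_lt_compat; lra. lra. }
    lra.
Qed.

Lemma periodic_vanishing (f : R -> R) : (forall w, 0 < w -> f (w + 1) = f w) ->
  is_lim f p_infty 0 -> forall w, 0 < w -> f w = 0.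
Proof.
  intros Hp Hl w Hw. apply cond_eq. intros eps He.
  apply is_lim_spec in Hl. destruct (Hl (mkposreal eps He)) as [M HM]. simpl in HM.
  assert (Hn : forall n, f (w + INR n) = f w).
  { induction n as [|n IH]. simpl. f_equal; ring.
    rewrite S_INR, <- Rplus_assoc, Hp; auto. pose proof (pos_INR n). lra. }
  destruct (INR_unbounded (M - w)) as [n Hn']. rewrite <- (Hn n). apply HM. lra.
Qed.

Lemma log_potential_0 w : 0 < w -> log_potential 0 w = digamma (w + 1 / 2).
Proof.
  intros Hw. apply Rminus_diag_uniq.
  apply (periodic_vanishing (fun w => log_potential 0 w - digamma (w + 1 / 2))); auto.
  (* Centred at v + 1/2, the difference equation is available for every v > 0. *)
  - intros v Hv. pose proof (log_potential_step_0 (v + 1 / 2) ltac:(lra)) as H.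
    replace (v + 1 / 2 + 1 / 2) with (v + 1) in H by field.
    replace (v + 1 / 2 - 1 / 2) with v in H by field.
    replace (v + 1 + 1 / 2) with (v + 1 / 2 + 1) by field.
    rewrite (digamma_succ (v + 1 / 2)) by lra. lra.
  - pose proof (is_lim_minus' _ _ _ _ _ (log_potential_asymptotic 0)
      (is_lim_plus' _ _ _ _ _ (is_lim_shift _ _ (1 / 2) digamma_asymptotic) (is_lim_ln_shift (1 / 2)))) as H.
    replace (0 - (0 + 0)) with 0 in H by ring.
    eapply is_lim_ext. 2: exact H. intros y. simpl. ring.
Qed.

(** Iterated derivatives are carried as explicit sequences on (a, infinity), so that
    differentiability comes together with the formula; [Derive_n] is reached only through
    [tower_Derive_n]. *)
Definition tower (a : R) (d : nat -> R -> R) : Prop :=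
  forall n y, a < y -> is_derive (d n) y (d (S n) y).

Lemma locally_gt (a x : R) : a < x -> locally x (fun y => a < y).
Proof. apply (open_gt a). Qed.

Lemma tower_Derive_n a d f n y : tower a d -> (forall y, a < y -> f y = d 0%nat y) ->
  a < y -> Derive_n f n y = d n y.
Proof.
  intros Hd H0. revert y. induction n as [|n IH]; intros y Hy. apply H0, Hy.
  simpl. rewrite (Derive_ext_loc _ (d n)). apply is_derive_unique, Hd, Hy.
  eapply filter_imp. 2: apply (locally_gt a y Hy). exact IH.
Qed.

Lemma tower_unique a d e n y : tower a d -> tower a e ->
  (forall y, a < y -> d 0%nat y = e 0%nat y) -> a < y -> d n y = e n y.
Proof.
  intros Hd He H0 Hy. rewrite <- (tower_Derive_n a d (d 0%nat) n y), <- (tower_Derive_n a e (d 0%nat) n y); auto.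
Qed.

(* Leibniz' rule for multiplication by [y - a]. *)
Definition tower_mul (a : R) (d : nat -> R -> R) (k : nat) (y : R) : R :=
  (y - a) * d k y + INR k * d (pred k) y.

Lemma tower_mul_tower b a d : tower b d -> tower b (tower_mul a d).
Proof.
  intros Hd k y Hy. unfold tower_mul.
  assert (H1 : is_derive (fun y => (y - a) * d k y) y (1 * d k y + (y - a) * d (S k) y)).
  { apply (is_derive_mul (fun y => y - a) (d k)); [| apply Hd, Hy]. auto_derive; auto; ring. }
  assert (H2 : is_derive (fun y => INR k * d (pred k) y) y (INR k * d k y)).
  { destruct k as [|k].
    - simpl. apply is_derive_ext with (fun _ => 0). intros; symmetry; apply Rmult_0_l.
      rewrite Rmult_0_l. apply (is_derive_const (V := R_NormedModule)).
    - apply is_derive_scal. apply (Hd k y Hy). }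
  apply (is_derive_eq _ _ _ _ (is_derive_add _ _ _ _ _ H1 H2)).
  rewrite S_INR. simpl. ring.
Qed.

(** A tower ending in zeros replaces the coefficients: all that matters later is that the
    derivatives of order above [m] vanish. *)
Definition poly_degree_le (m : nat) (f : R -> R) : Prop :=
  exists d, (forall b, tower b d) /\ (forall y, d 0%nat y = f y) /\
    (forall k y, (m < k)%nat -> d k y = 0).

Lemma poly_degree_le_1 : poly_degree_le 0 (fun _ => 1).
Proof.
  exists (fun k _ => match k with O => 1 | S _ => 0 end). split; [| split].
  - intros b k y _. destruct k; apply (is_derive_const (V := R_NormedModule)).
  - auto.
  - intros [|k] y Hk; [lia | auto].
Qed.

Lemma poly_degree_le_mul m f a : poly_degree_le m f -> poly_degree_le (S m) (fun y => f y * (y - a)).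
Proof.
  intros [d [Hd [H0 Hm]]]. exists (tower_mul a d). split; [| split].
  - intros b. apply tower_mul_tower, Hd.
  - intros y. unfold tower_mul. rewrite H0. simpl. ring.
  - intros k y Hk. unfold tower_mul. rewrite !Hm by lia. ring.
Qed.

Lemma poly_degree_le_ext m f g : (forall y, f y = g y) -> poly_degree_le m f -> poly_degree_le m g.
Proof.
  intros He [d [Hd [H0 Hm]]]. exists d. split; [| split]; auto. intros y. rewrite H0. auto.
Qed.

(** * Falling factorials *)

Lemma poly_degree_le_falling a n : poly_degree_le n (fun y => falling (y - a) n).
Proof.
  induction n as [|n IH]. apply poly_degree_le_1.
  apply poly_degree_le_ext with (fun y => falling (y - a) n * (y - (a + INR n))).
  intros y. simpl. ring. apply poly_degree_le_mul, IH.
Qed.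

(** [q] is the product of the y - (a + i) over i <= n with the factor i = j left out. It will cancel
    a simple pole at a + j. *)
Lemma falling_remove_factor a n j : (j < S n)%nat -> exists q, poly_degree_le n q /\
  forall y, falling (y - a) (S n) = q y * (y - (a + INR j)).
Proof.
  induction n as [|n IH]; intros Hj.
  - exists (fun _ => 1). split. apply poly_degree_le_1. intros y.
    replace j with 0%nat by lia. simpl. ring.
  - destruct (Nat.eq_dec j (S n)) as [->|Hn].
    + exists (fun y => falling (y - a) (S n)). split. apply poly_degree_le_falling.
      intros y. change (falling (y - a) (S (S n))) with (falling (y - a) (S n) * (y - a - INR (S n))). ring.
    + destruct IH as [q [Hq Eq]]. lia. exists (fun y => q y * (y - (a + INR (S n)))). split.
      apply poly_degree_le_mul, Hq. intros y.
      change (falling (y - a) (S (S n))) with (falling (y - a) (S n) * (y - a - INR (S n))).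
      rewrite Eq. ring.
Qed.

Lemma falling_head x n : falling x (S n) = x * falling (x - 1) n.
Proof.
  induction n as [|n IH]. simpl. ring.
  change (falling x (S (S n))) with (falling x (S n) * (x - INR (S n))).
  rewrite IH, S_INR. simpl. ring.
Qed.

Lemma falling_pascal y n : falling y (S n) - falling (y - 1) (S n) = INR (S n) * falling (y - 1) n.
Proof.
  rewrite falling_head, S_INR. simpl. ring.
Qed.

(** These are the derivatives of digamma (z + 1) - 1/z. Using digamma z = F_1(z - 1/2) directly
    would restrict z to values above 1/2, whereas all z > 0 are wanted. *)
Definition digamma_tower (k : nat) (z : R) : R :=
  log_potential_deriv 0 k (z + 1 / 2) - (-1) ^ k * INR (fact k) * / z ^ S k.

Lemma digamma_tower_0 z : 0 < z -> digamma_tower 0 z = digamma z.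
Proof.
  intros Hz. unfold digamma_tower.
  change (log_potential_deriv 0 0 (z + 1 / 2)) with (log_potential 0 (z + 1 / 2)).
  rewrite log_potential_0 by lra.
  replace (z + 1 / 2 + 1 / 2) with (z + 1) by field. rewrite digamma_succ by auto.
  simpl. field. lra.
Qed.

Lemma is_derive_inv_pow_real k (z : R) : 0 < z ->
  is_derive (fun z => / z ^ S k) z (- INR (S k) * / z ^ S (S k)).
Proof.
  intros Hz. auto_derive. apply (pow_nonzero z (S k)); lra.
  simpl pred. rewrite <- !tech_pow_Rmult. change (match k with 0%nat => 1 | S _ => INR k + 1 end) with (INR (S k)).
  match goal with |- @eq _ ?a ?b => change (@eq R a b) end. field. split. apply pow_nonzero; lra. lra.
Qed.

Lemma digamma_tower_tower : tower 0 digamma_tower.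
Proof.
  intros k z Hz. unfold digamma_tower.
  apply (is_derive_eq (fun z => log_potential_deriv 0 k (z + 1 / 2) - (-1) ^ k * INR (fact k) * / z ^ S k) z
    (log_potential_deriv 0 (S k) (z + 1 / 2) - (-1) ^ k * INR (fact k) * (- INR (S k) * / z ^ S (S k)))).
  - apply is_derive_sub.
    + apply is_derive_ext with (fun z => log_potential_deriv 0 k (1 / 2 + z)).
      intros t. f_equal. apply Rplus_comm.
      apply (is_derive_comp_add (log_potential_deriv 0 k)). rewrite (Rplus_comm (1 / 2)).
      apply is_derive_log_potential; lra.
    + apply is_derive_scal, is_derive_inv_pow_real; auto.
  - rewrite fact_simpl, mult_INR. change ((-1) ^ S k) with (-1 * (-1) ^ k). ring.
Qed.

(** * Behaviour of the iterated derivatives at infinity *)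

Lemma is_lim_mul (f g : R -> R) (a b : R) : is_lim f p_infty a -> is_lim g p_infty b ->
  is_lim (fun y => f y * g y) p_infty (a * b).
Proof. intros Hf Hg. apply (is_lim_mult f g p_infty a b Hf Hg). exact I. Qed.

Lemma is_lim_pow (f : R -> R) n : is_lim f p_infty 1 -> is_lim (fun y => f y ^ n) p_infty 1.
Proof.
  intros H. induction n as [|n IH]. simpl. apply is_lim_const.
  simpl. replace 1 with (1 * 1) by ring.
  apply (is_lim_mul _ _ _ _ H IH).
Qed.

Lemma is_lim_pow_mul_shift (f : R -> R) n (l s : R) : is_lim (fun w => w ^ n * f w) p_infty l ->
  is_lim (fun y => y ^ n * f (y + s)) p_infty l.
Proof.
  intros H. pose proof (Rabs_pos s).
  assert (Hr : is_lim (fun y => y / (y + s)) p_infty 1).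
  { apply is_lim_of_inv_bound with (2 * Rabs s) (2 * Rabs s). intros y Hy.
    assert (Hs : - Rabs s <= s) by (pose proof (Rle_abs (- s)) as Q; rewrite Rabs_Ropp in Q; lra).
    replace (y / (y + s) - 1) with (- s / (y + s)) by (field; lra).
    apply Rabs_div_le. lra. rewrite Rabs_Ropp.
    apply Rmult_le_reg_r with y. lra.
    replace (2 * Rabs s / y * (y + s) * y) with (2 * Rabs s * (y + s)) by (field; lra). nra. }
  pose proof (is_lim_mul _ _ _ _ (is_lim_pow _ n Hr) (is_lim_shift _ _ s H)) as HH.
  rewrite Rmult_1_l in HH.
  eapply is_lim_ext_loc. 2: exact HH.
  exists (Rabs s). intros y Hy. simpl.
  assert (Hs : - Rabs s <= s) by (pose proof (Rle_abs (- s)) as Q; rewrite Rabs_Ropp in Q; lra).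
  rewrite <- Rmult_assoc, <- Rpow_mult_distr. f_equal. f_equal. field. lra.
Qed.

Lemma is_lim_div_id (f : R -> R) (l : R) : is_lim (fun y => y * f y) p_infty l -> is_lim f p_infty 0.
Proof.
  intros H. assert (H1 : is_lim (fun y => / y) p_infty 0).
  { apply is_lim_of_inv_bound with 1 0. intros y Hy. rewrite Rminus_0_r, Rabs_right. lra.
    apply Rle_ge; left; apply Rinv_0_lt_compat; auto. }
  pose proof (is_lim_mul _ _ _ _ H1 H) as H2. rewrite Rmult_0_l in H2.
  eapply is_lim_ext_loc. 2: exact H2. exists 0. intros y Hy. simpl. field. lra.
Qed.

(** The correction by the derivatives of 1/z is of lower order: multiplied by y^(j+1) it is
    O(1/y). *)
Lemma digamma_tower_asymptotic j s :
  is_lim (fun y => y ^ S j * digamma_tower (S j) (y + s)) p_infty ((-1) ^ j * INR (fact j)).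
Proof.
  pose proof (is_lim_pow_mul_shift _ _ _ (s + 1 / 2) (log_potential_deriv_asymptotic 0 j)) as H1.
  set (c := (-1) ^ S j * INR (fact (S j))).
  assert (H2 : is_lim (fun w => w ^ S j * (c * / w ^ S (S j))) p_infty 0).
  { apply is_lim_of_inv_bound with (Rabs c) 0. intros w Hw. rewrite Rminus_0_r.
    replace (w ^ S j * (c * / w ^ S (S j))) with (c / w).
    2: { simpl. field. split. apply pow_nonzero; lra. lra. }
    unfold Rdiv. rewrite Rabs_mult, Rabs_inv, (Rabs_right w) by lra. lra. }
  apply (is_lim_pow_mul_shift (fun w => c * / w ^ S (S j)) (S j) 0 s) in H2.
  pose proof (is_lim_minus' _ _ _ _ _ H1 H2) as H3. rewrite Rminus_0_r in H3.
  eapply is_lim_ext. 2: exact H3. intros y. simpl. unfold digamma_tower. fold c.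
  rewrite Rplus_assoc. rewrite <- Rmult_minus_distr_l. reflexivity.
Qed.

(* Iterated derivatives of [falling (y - 1) m * digamma (y - b)]. *)
Fixpoint falling_digamma (b : R) (m : nat) : nat -> R -> R :=
  match m with
  | O => fun k y => digamma_tower k (y - b)
  | S m => tower_mul (1 + INR m) (falling_digamma b m)
  end.

Lemma falling_digamma_0 b m y : b < y ->
  falling_digamma b m 0 y = falling (y - 1) m * digamma (y - b).
Proof.
  intros Hy. induction m as [|m IH].
  - simpl. rewrite digamma_tower_0 by lra. ring.
  - cbn [falling_digamma]. unfold tower_mul. rewrite IH. simpl. ring.
Qed.

Lemma falling_digamma_tower b m : tower b (falling_digamma b m).
Proof.
  induction m as [|m IH].
  - intros k y Hy. simpl. apply is_derive_ext with (fun y => digamma_tower k (- b + y)).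
    intros t. f_equal. apply Rplus_comm.
    apply (is_derive_comp_add (digamma_tower k)). rewrite Rplus_comm. apply digamma_tower_tower. lra.
  - apply tower_mul_tower, IH.
Qed.

(** The model is y^m log y, whose derivative of order m + j + 1 is (-1)^j m! j! y^(-j-1). In the
    Leibniz step the coefficients combine as -(j + 1) + (m + j + 2) = m + 1. *)
Lemma falling_digamma_asymptotic_S b m : forall j,
  is_lim (fun y => y ^ S j * falling_digamma b m (m + S j) y) p_infty
    ((-1) ^ j * INR (fact m) * INR (fact j)).
Proof.
  induction m as [|m IH]; intros j.
  - replace ((-1) ^ j * INR (fact 0) * INR (fact j)) with ((-1) ^ j * INR (fact j)) by (simpl; ring).
    apply (digamma_tower_asymptotic j (- b)).
  - pose proof (IH (S j)) as H1. pose proof (IH j) as H2.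
    set (f := falling_digamma b m) in *.
    assert (H3 : is_lim (fun y => y ^ S j * f (m + S (S j))%nat y) p_infty 0).
    { apply is_lim_div_id with ((-1) ^ S j * INR (fact m) * INR (fact (S j))).
      eapply is_lim_ext. 2: exact H1. intros y. simpl. ring. }
    pose proof (is_lim_plus' _ _ _ _ _ (is_lim_minus' _ _ _ _ _ H1
      (is_lim_scal_l _ (1 + INR m) _ _ H3)) (is_lim_scal_l _ (INR (S m + S j)) _ _ H2)) as H.
    simpl Rbar_mult in H.
    replace ((-1) ^ j * INR (fact (S m)) * INR (fact j)) with
      ((-1) ^ S j * INR (fact m) * INR (fact (S j)) - (1 + INR m) * 0
       + INR (S m + S j) * ((-1) ^ j * INR (fact m) * INR (fact j))).
    + eapply is_lim_ext. 2: exact H. intros y. cbn [falling_digamma]. fold f. unfold tower_mul.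
      replace (S m + S j)%nat with (m + S (S j))%nat by lia.
      replace (pred (m + S (S j))) with (m + S j)%nat by lia.
      simpl pow. ring.
    + rewrite !fact_simpl, !mult_INR, plus_INR, !S_INR. change ((-1) ^ S j) with (-1 * (-1) ^ j). ring.
Qed.

(** The model is the derivative of order m of y^m log y, equal to m! (log y + H_m). The new term 1 /
    (m + 1) comes from y times the derivative of order m + 1, which tends to m!. *)
Lemma falling_digamma_asymptotic_0 b m :
  is_lim (fun y => falling_digamma b m m y - INR (fact m) * (ln y + harmonic m)) p_infty 0.
Proof.
  induction m as [|m IH].
  - pose proof (is_lim_plus' _ _ _ _ _ (is_lim_shift _ _ (- b) digamma_asymptotic) (is_lim_ln_shift (- b))) as H.
    rewrite Rplus_0_l in H. eapply is_lim_ext_loc. 2: exact H.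
    exists b. intros y Hy. cbn [falling_digamma]. rewrite digamma_tower_0 by lra.
    simpl. unfold Rminus. ring.
  - set (f := falling_digamma b m) in *.
    pose proof (falling_digamma_asymptotic_S b m 0) as H1. fold f in H1.
    replace ((-1) ^ 0 * INR (fact m) * INR (fact 0)) with (INR (fact m)) in H1 by (simpl; ring).
    assert (H2 : is_lim (f (m + 1)%nat) p_infty 0).
    { apply is_lim_div_id with (INR (fact m)).
      eapply is_lim_ext. 2: exact H1. intros y. cbv beta. rewrite pow_1. reflexivity. }
    pose proof (is_lim_plus' _ _ _ _ _ (is_lim_minus' _ _ _ _ _
      (is_lim_minus' _ _ _ _ _ H1 (is_lim_const (INR (fact m)) p_infty))
      (is_lim_scal_l _ (1 + INR m) _ _ H2)) (is_lim_scal_l _ (INR (S m)) _ _ IH)) as H.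
    simpl Rbar_mult in H.
    replace (INR (fact m) - INR (fact m) - (1 + INR m) * 0 + INR (S m) * 0) with 0 in H by ring.
    eapply is_lim_ext. 2: exact H. intros y. cbn [falling_digamma]. fold f. unfold tower_mul.
    replace (m + 1)%nat with (S m) by lia. simpl pred. cbv beta. rewrite pow_1.
    change (harmonic (S m)) with (harmonic m + / INR (S m)).
    rewrite fact_simpl, mult_INR. 
    pose proof (pos_INR m). rewrite S_INR. field. lra.
Qed.

(** * The difference equation on the digamma side *)

Lemma digamma_sub_1 z : 1 < z -> digamma (z - 1) = digamma z - / (z - 1).
Proof.
  intros Hz. pose proof (digamma_succ (z - 1) ltac:(lra)) as H.
  replace (z - 1 + 1) with z in H by ring. lra.
Qed.

(* The digamma shift produces a pole at [y = b] that is cancelled by a factor of the falling factorial, so that the discrepancy is a polynomial. *)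
Lemma falling_digamma_diff_0 m : exists q, poly_degree_le m q /\ forall y, INR (Nat.div2 (S (S m))) < y ->
  falling y (S m) * digamma (y + 1 - INR (Nat.div2 (S (S m))))
  - falling (y - 1) (S m) * digamma (y - INR (Nat.div2 (S (S m))))
  = INR (S m) * (falling (y - 1) m * digamma (y - INR (Nat.div2 (S m)))) + q y.
Proof.
  destruct (Nat.Even_Odd_dec m) as [[p Hp]|[p Hp]].
  (* For m = 2 p the offset rises from p to p + 1, and it is the digamma at y - (p + 1) that is
     shifted; its pole y = p + 1 is a root of [falling (y - 1) (S m)]. *)
  - assert (E1 : Nat.div2 (S (S m)) = S p) by (simpl; f_equal; rewrite Hp; apply Nat.div2_double).
    assert (E2 : Nat.div2 (S m) = p) by (rewrite Hp; apply Nat.div2_succ_double).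
    destruct (falling_remove_factor 1 m p) as [q [Hq Eq]]. lia.
    exists q. split; auto. intros y. rewrite E1, E2, S_INR. intros Hy.
    replace (y + 1 - (INR p + 1)) with (y - INR p) by ring.
    replace (y - (INR p + 1)) with (y - INR p - 1) by ring.
    rewrite digamma_sub_1 by lra.
    rewrite <- Rmult_assoc, <- falling_pascal, Eq. field. lra.
  (* For m = 2 p + 1 the offset stays at p + 1, and the digamma at y + 1 - (p + 1) is shifted; the
     pole y = p + 1 is now a root of [falling y (S m)]. *)
  - assert (E1 : Nat.div2 (S (S m)) = S p) by (simpl; f_equal; rewrite Hp, Nat.add_1_r; apply Nat.div2_succ_double).
    assert (E2 : Nat.div2 (S m) = S p).
    { rewrite Hp. replace (S (2 * p + 1)) with (2 * S p)%nat by lia. apply Nat.div2_double. }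
    destruct (falling_remove_factor 0 m (S p)) as [q [Hq Eq]]. lia.
    exists q. split; auto. intros y. rewrite E1, E2. intros Hy.
    specialize (Eq y). rewrite Rminus_0_r, Rplus_0_l in Eq.
    replace (y + 1 - INR (S p)) with (y - INR (S p) + 1) by ring.
    rewrite digamma_succ by lra.
    rewrite <- Rmult_assoc, <- falling_pascal, Eq. field. lra.
Qed.

(** The identity of order 0 is differentiated m + 1 times, one more than the degree of its
    polynomial remainder. *)
Lemma falling_digamma_step m y : INR (Nat.div2 (S (S m))) < y ->
  falling_digamma (INR (Nat.div2 (S (S m)))) (S m) (S m) (y + 1)
  - falling_digamma (INR (Nat.div2 (S (S m)))) (S m) (S m) y
  = INR (S m) * falling_digamma (INR (Nat.div2 (S m))) m (S m) y.
Proof.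
  intros Hy. destruct (falling_digamma_diff_0 m) as [q [[d [Hd [H0 Hm]]] Hq]].
  assert (Hle : INR (Nat.div2 (S m)) <= INR (Nat.div2 (S (S m)))).
  { apply le_INR. rewrite !Nat.div2_div. apply Nat.Div0.div_le_mono. lia. }
  set (b := INR (Nat.div2 (S (S m)))) in *. set (b' := INR (Nat.div2 (S m))) in *.
  (* Both sides of the order 0 identity become towers on (b, infinity), so their agreement there
     passes to every order. *)
  pose (L := fun k y => falling_digamma b (S m) k (y + 1) - falling_digamma b (S m) k y).
  pose (Q := fun k y => INR (S m) * falling_digamma b' m k y + d k y).
  assert (HL : tower b L).
  { intros k z Hz. apply is_derive_sub.
    - apply is_derive_ext with (fun z => falling_digamma b (S m) k (1 + z)).
      intros t. f_equal. apply Rplus_comm.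
      apply (is_derive_comp_add (falling_digamma b (S m) k)). rewrite (Rplus_comm 1).
      apply falling_digamma_tower. lra.
    - apply falling_digamma_tower. lra. }
  assert (HQ : tower b Q).
  { intros k z Hz. apply is_derive_add.
    - apply is_derive_scal, falling_digamma_tower. lra.
    - apply (Hd b). auto. }
  change (L (S m) y = INR (S m) * falling_digamma b' m (S m) y).
  rewrite (tower_unique b L Q (S m) y HL HQ); auto.
  - unfold Q. rewrite Hm by lia. ring.
  - intros z Hz. unfold L, Q. rewrite !falling_digamma_0, H0 by lra.
    rewrite <- Hq by auto. replace (z + 1 - 1) with z by ring. reflexivity.
Qed.

(** Keeps the argument x - floor (l/2) of digamma positive at x = w + l/2. *)
Lemma div2_lt_half_add l w : 0 < w -> INR (Nat.div2 l) < w + INR l / 2.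
Proof.
  intros Hw. assert (H : (2 * Nat.div2 l <= l)%nat).
  { pose proof (Nat.div2_odd l). lia. }
  apply le_INR in H. rewrite mult_INR in H. simpl (INR 2) in H. lra.
Qed.

(** Here l = n + 1 and x = w + l/2; division by n! turns the falling factorial into the binomial
    coefficient, and H_n removes the constant at infinity. *)
Lemma log_potential_eq n : forall w, 0 < w ->
  log_potential n w =
  falling_digamma (INR (Nat.div2 (S n))) n n (w + INR (S n) / 2) / INR (fact n) - harmonic n.
Proof.
  induction n as [|m IH]; intros w Hw.
  - rewrite log_potential_0 by auto. simpl. rewrite digamma_tower_0 by lra.
    replace (w + 1 / 2 - 0) with (w + 1 / 2) by ring. field.
  - set (n := S m) in *. set (b := INR (Nat.div2 (S n))).
    assert (Hf : 0 < INR (fact m)) by (apply lt_0_INR, lt_O_fact).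
    assert (Hn : 0 < INR n) by (apply lt_0_INR; unfold n; lia).
    assert (Ef : INR (fact n) = INR n * INR (fact m)) by (unfold n; rewrite fact_simpl, mult_INR; auto).
    apply Rminus_diag_uniq.
    apply (periodic_vanishing (fun w => log_potential n w -
      (falling_digamma b n n (w + INR (S n) / 2) / INR (fact n) - harmonic n))); auto.
    + intros v Hv.
      pose proof (log_potential_step_S m (v + 1 / 2) ltac:(lra)) as H1. fold n in H1.
      replace (v + 1 / 2 + 1 / 2) with (v + 1) in H1 by field.
      replace (v + 1 / 2 - 1 / 2) with v in H1 by field.
      (* The induction hypothesis is differentiated at v + 1/2, where its argument v + 1/2 + n/2
         coincides with the argument v + (n + 1)/2 of the new level. *)
      assert (E : intR (fun u => rhoS m u * inv_re (v + 1 / 2) u) =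
        falling_digamma (INR (Nat.div2 n)) m n (v + INR (S n) / 2) / INR (fact m)).
      { pose proof (is_derive_log_potential m 0 (v + 1 / 2) ltac:(lra)) as H2.
        destruct (logmod_deriv_dominated m 1 (v + 1 / 2) ltac:(lra)) as [C HC].
        rewrite <- (intR_ext _ (fun u => rhoS m u * inv_re (v + 1 / 2) u) _ HC)
          by (intros u; simpl; ring).
        change (log_potential_deriv m 1 (v + 1 / 2) =
          falling_digamma (INR (Nat.div2 n)) m n (v + INR (S n) / 2) / INR (fact m)).
        rewrite <- (is_derive_unique _ _ _ H2).
        apply is_derive_unique.
        apply is_derive_ext_loc with (fun w => / INR (fact m) * falling_digamma (INR (Nat.div2 n)) m m (INR n / 2 + w) - harmonic m).
        - eapply filter_imp. 2: apply (locally_pos (v + 1 / 2)); lra.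
          intros t Ht. change (log_potential_deriv m 0 t) with (log_potential m t).
          rewrite IH by auto. fold n. rewrite (Rplus_comm t). unfold Rdiv. rewrite (Rmult_comm (/ INR (fact m))). reflexivity.
        - apply (is_derive_eq _ _ (/ INR (fact m) * falling_digamma (INR (Nat.div2 n)) m n (INR n / 2 + (v + 1 / 2)) - 0)).
          + apply is_derive_sub. 2: apply (is_derive_const (V := R_NormedModule)).
            apply is_derive_scal.
            apply (is_derive_comp_add (falling_digamma (INR (Nat.div2 n)) m m)).
            apply falling_digamma_tower. rewrite (Rplus_comm (INR n / 2)). apply div2_lt_half_add; lra.
          + rewrite S_INR. replace (INR n / 2 + (v + 1 / 2)) with (v + (INR n + 1) / 2) by field.
            unfold Rdiv. ring. }
      rewrite E in H1.
      pose proof (falling_digamma_step m (v + INR (S n) / 2) (div2_lt_half_add (S n) v Hv)) as H3.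
      fold n in H3. fold b in H3.
      replace (v + INR (S n) / 2 + 1) with (v + 1 + INR (S n) / 2) in H3 by ring.
      rewrite Ef.
      assert (H4 : falling_digamma (INR (Nat.div2 n)) m n (v + INR (S n) / 2) / INR (fact m) =
        falling_digamma b n n (v + 1 + INR (S n) / 2) / (INR n * INR (fact m))
        - falling_digamma b n n (v + INR (S n) / 2) / (INR n * INR (fact m))).
      { rewrite <- (Rplus_minus (falling_digamma b n n (v + INR (S n) / 2))
          (falling_digamma b n n (v + 1 + INR (S n) / 2))), H3. field. lra. }
      lra.
    (* At infinity H_n cancels, and the shift of the argument by (n + 1)/2 changes the logarithm by
       o(1). *)
    + pose proof (is_lim_shift _ _ (INR (S n) / 2) (falling_digamma_asymptotic_0 b n)) as H1.
      pose proof (is_lim_minus' _ _ _ _ _ (log_potential_asymptotic n)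
        (is_lim_plus' _ _ _ _ _ (is_lim_scal_l _ (/ INR (fact n)) _ _ H1) (is_lim_ln_shift (INR (S n) / 2)))) as H.
      replace (0 - (/ INR (fact n) * 0 + 0)) with 0 in H by ring.
      eapply is_lim_ext. 2: exact H. intros y. cbv beta. field.
      apply Rgt_not_eq. rewrite Ef. apply Rmult_lt_0_compat; auto.
Qed.

Theorem theorem1p3 (l : nat) (x : R) (hl : (1 <= l)%nat) (hx : INR l / 2 < x) :
  let b := / (x - INR l / 2) ^ 2 in
  RInt_gen (fun u => ln (1 + b * u ^ 2) * rho l u)
           (at_point 0) (Rbar_locally p_infty)
  = - ln (Rabs (x - INR l / 2)) - harmonic (l - 1)
    + Derive_n (fun y => gbinom (y - 1) (l - 1) * digamma (y - INR (Nat.div2 l)))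
               (l - 1) x.
Proof.
  intros b. destruct l as [|n]. lia.
  assert (Hx : 0 < x - INR (S n) / 2) by lra.
  unfold b, rho. replace (S n - 1)%nat with n by lia.
  rewrite RInt_gen_log_excess, log_potential_eq, Rabs_right by lra.
  replace (x - INR (S n) / 2 + INR (S n) / 2) with x by ring.
  pose proof (div2_lt_half_add (S n) _ Hx) as Hb.
  replace (x - INR (S n) / 2 + INR (S n) / 2) with x in Hb by ring.
  (* The factor 1 / n! is placed inside the tower so that its order 0 function is the product with
     [gbinom]. *)
  rewrite (tower_Derive_n (INR (Nat.div2 (S n)))
    (fun k y => / INR (fact n) * falling_digamma (INR (Nat.div2 (S n))) n k y)).
  - unfold Rdiv. match goal with |- @eq _ ?a ?b => change (@eq R a b) end. ring.
  - intros k y Hy. apply is_derive_scal, falling_digamma_tower, Hy.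
  - intros y Hy. rewrite falling_digamma_0 by auto. unfold gbinom, Rdiv. ring.
  - exact Hb.
Qed.
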